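(* Suppose that $k\in\mathbb{N}$, $2\ge\alpha_1>\cdots>\alpha_k>1$ and $p_1,\dots,p_k>0$, and define $$\boldsymbol{\nu}(\boldsymbol{\alpha},\mathbf{p}):=\boldsymbol{\nu}_{\alpha_1}^{\boxtimes p_1}\boxtimes\cdots\boxtimes\boldsymbol{\nu}_{\alpha_k}^{\boxtimes p_k},\qquad \boldsymbol\alpha=(\alpha_1,\dots,\alpha_k),\ \mathbf p=(p_1,\dots,p_k).$$ Then $$\left(\boldsymbol{\nu}(\boldsymbol{\alpha},\mathbf{p})^{\boxtimes t}\right)^{t^{-1/\alpha_1}}\longrightarrow \mathcal{L}\!\left(e^{p_1^{1/\alpha_1}\mathbf{F}_{\alpha_1}}\right)\quad\text{weakly as } t\downarrow0,$$ where $\mathbf{F}_{\alpha_1}$ is a random variable with the free stable law $\mathbf{f}_{\alpha_1}$ and $\mathcal{L}(X)$ denotes the law of $X$.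
   Context: For a probability measure $\mu\ne\delta_0$ on $[0,\infty)$ let $G_\mu(z)=\int\frac{\mu(dx)}{z-x}$, $F_\mu=1/G_\mu$, $\eta_\mu(z)=1-zF_\mu(1/z)$, and $\Sigma_\mu(z)=\eta_\mu^{-1}(z)/z$ for $1-1/\mu(\{0\})<z<0$ (inverse of the strictly increasing function $\eta_\mu|_{(-\infty,0)}$). The $S$-transform is determined by $\Sigma_\mu(z)=S_\mu\!\left(\frac{z}{1-z}\right)$. Multiplicative free convolution $\boxtimes$ satisfies $S_{\mu\boxtimes\nu}=S_\mu S_\nu$ near $0$ on the negative axis. If $\mu$ on $(0,\infty)$ is $\boxtimes$-infinitely divisible (has an $n$-th $\boxtimes$-convolution root for every $n$), then for $t\ge0$, $\mu^{\boxtimes t}$ is the unique probability measure on $(0,\infty)$ with $S_{\mu^{\boxtimes t}}=S_\mu^t$ on $(-1,0)$. For a measure $\nu$ on $(0,\infty)$ and $p\in\mathbb{R}$, $\nu^p$ is the push-forward of $\nu$ by $x\mapsto x^p$. For $\alpha\in(1,2]$, $\boldsymbol{\nu}_\alpha$ is the ($\boxtimes$-infinitely divisible) probability measure on $(0,\infty)$ with $S_{\boldsymbol{\nu}_\alpha}(z)=e^{(-z)^{\alpha-1}}$, $z\in(-1,0)$. For a probability measure $\mu$ on $\mathbb{R}$, the Voiculescu transform is $\varphi_\mu(z)=F_\mu^{-1}(z)-z$ on a suitable truncated cone $\{z:\Im z>0,|\Re z|<a\Im z,|z|>b\}$. For $\alpha\in(1,2]$, $\mathbf{f}_\alpha$ is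 the free stable law with $\varphi_{\mathbf{f}_\alpha}(z)=-(-z)^{1-\alpha}$ for $\Im z>0$ (principal branch). *)

(* Defs.v *)
From HB Require Import structures.
From mathcomp Require Import all_boot all_order all_algebra.
From mathcomp Require Import complex.
From mathcomp Require Import all_classical all_reals all_analysis.
From mathcomp Require Import measurable_realfun.

Set Implicit Arguments.
Unset Strict Implicit.
Unset Printing Implicit Defensive.

Import Order.TTheory GRing.Theory Num.Theory.
Import numFieldNormedType.Exports.

Local Open Scope classical_set_scope.
Local Open Scope ring_scope.
Local Open Scope complex_scope.

Section laws.
Context {R : realType}.
Implicit Types mu nu rho sigma : probability R R.

Definition positive_law mu := mu `]0, +oo[%classic = 1%E.

(* Carried by [0, +oo[ and different from the Dirac mass at 0. *)
Definition nonneg_law mu := mu `[0, +oo[%classic = 1%E /\ mu [set 0] != 1%E.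

Definition rpow (p x : R) : R := x `^ p.

HB.instance Definition _ (p : R) :=
  isMeasurableFun.Build _ _ R R (rpow p) (measurable_powR p).

Definition scaled_exp (c x : R) : R := expR (c * x).

HB.instance Definition _ (c : R) :=
  isMeasurableFun.Build _ _ R R (scaled_exp c)
    (measurableT_comp (@measurable_expR R) (mulrl_measurable c)).

Definition weakly_cvg {I : Type} (F : set_system I)
    (mu_ : I -> probability R R) mu :=
  forall f : R -> R, continuous f -> bounded_fun f ->
    (\int[mu_ i]_x f x) @[i --> F] --> \int[mu]_x f x.

End laws.

Section transforms.
Context {R : realType}.
Implicit Types mu nu rho sigma : probability R R.

Definition cauchy_transform mu (z : R[i]) : R[i] :=
  (\int[mu]_x complex.Re (z - x%:C)^-1) +i* (\int[mu]_x complex.Im (z - x%:C)^-1).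

Definition F_transform mu (z : R[i]) : R[i] := (cauchy_transform mu z)^-1.

Definition eta_transform mu (z : R[i]) : R[i] := 1 - z * F_transform mu z^-1.

(* On the negative half-line eta is real-valued and injective as soon as
   [nonneg_law mu]; the value 0 is a default outside the range of eta. *)
Definition eta_inv mu (z : R) : R :=
  xget 0 [set w : R | w < 0 /\ eta_transform mu w%:C = z%:C].

Definition Sigma_transform mu (z : R) : R := eta_inv mu z / z.

(* u = z / (1 - z) is inverted as z = u / (1 + u). *)
Definition S_transform mu (u : R) : R := Sigma_transform mu (u / (1 + u)).

End transforms.

Section multiplicative_convolution.
Context {R : realType}.
Implicit Types mu nu rho sigma : probability R R.

(* The S-transform near 0- determines a law, so the predicates below
   characterize rho up to equality on measurable sets. *)
Definition is_boxtimes mu nu rho :=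
  [/\ nonneg_law mu, nonneg_law nu, nonneg_law rho &
      exists2 e : R, 0 < e & forall z : R, - e < z < 0 ->
        S_transform rho z = S_transform mu z * S_transform nu z].

Fixpoint is_boxtimes_seq (s : seq (probability R R)) rho : Prop :=
  match s with
  | [::] => forall A, measurable A -> rho A = \d_(1 : R) A
  | mu :: s' => exists2 sigma, is_boxtimes_seq s' sigma & is_boxtimes mu sigma rho
  end.

Definition boxtimes_infdiv mu :=
  forall n, (0 < n)%N -> exists rho, is_boxtimes_seq (nseq n rho) mu.

Definition is_boxtimes_pow mu (t : R) rho :=
  [/\ positive_law mu, boxtimes_infdiv mu, positive_law rho, 0 <= t &
      forall z : R, -1 < z < 0 -> S_transform rho z = S_transform mu z `^ t].

Definition is_nu (alpha : R) mu :=
  positive_law mu /\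
  forall z : R, -1 < z < 0 -> S_transform mu z = expR ((- z) `^ (alpha - 1)).

End multiplicative_convolution.

Section free_stable.
Context {R : realType}.
Implicit Types mu : probability R R.

(* The argument in ]-pi, pi], for z != 0. *)
Definition principal_arg (z : R[i]) : R :=
  let a := acos (complex.Re z / Normc.normc z) in
  if 0 <= complex.Im z then a else - a.

Definition principal_pow (z : R[i]) (s : R) : R[i] :=
  (Normc.normc z `^ s * cos (s * principal_arg z)) +i*
  (Normc.normc z `^ s * sin (s * principal_arg z)).

Definition truncated_cone (a b : R) : set R[i] :=
  [set z | [/\ 0 < complex.Im z, `|complex.Re z| < a * complex.Im z & b < Normc.normc z]].

(* phi is F_mu^{-1}(z) - z on some truncated cone, F_mu^{-1} being the inverse
   of F_mu restricted to a truncated cone on which it is injective. *)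
Definition is_voiculescu_transform mu (phi : R[i] -> R[i]) :=
  exists a b a' b' : R,
    [/\ [/\ 0 < a, 0 < b, 0 < a' & 0 < b'],
        {in truncated_cone a' b' &, injective (F_transform mu)} &
        forall z, truncated_cone a b z ->
          exists w, [/\ truncated_cone a' b' w, F_transform mu w = z &
                        phi z = w - z]].

Definition is_free_stable (alpha : R) mu :=
  is_voiculescu_transform mu (fun z => - principal_pow (- z) (1 - alpha)).

End free_stable.

(* Main.v *)
Require Import Defs.
From HB Require Import structures.
From mathcomp Require Import all_boot all_order all_algebra.
From mathcomp Require Import complex.
From mathcomp Require Import all_classical all_reals all_analysis.
From mathcomp Require Import measurable_realfun.
From mathcomp Require Import ring lra.

Set Implicit Arguments.
Unset Strict Implicit.
Unset Printing Implicit Defensive.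

Import Order.TTheory GRing.Theory Num.Theory.
Import numFieldNormedType.Exports.

Local Open Scope classical_set_scope.
Local Open Scope ring_scope.

(** Let [X] have law [nu_t t] and put [e = (p_0 t)^(1/alpha_0)], [Y = ln X / e].
Near [0-] the S-transform of [nu_t t] is [exp (t sum_i p_i (-z)^(alpha_i - 1))],
which says that [E (X / (X + A s)) = exp s] for very negative [s], where
[A s = (exp (- s) - 1) exp (- t sum_i p_i exp ((alpha_i - 1) s))]. On the
half-line where [A] decreases, this identity continues analytically: the
moments of [(X + A s)^-1] are the coefficients of [exp] reexpanded in powers of
[A], so their geometric growth bounds [(X + A s)^-1] almost surely and the
identity moves on by a fixed step. Written for [Y] this gives [Y >= - c] almost
surely and [E (Y + u + u^(1 - alpha_0))^-1 -> u^-1] for all large real [u].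

The hypothesis on [F] gives [E (F + u + u^(1 - alpha_0))^-1 = u^-1], but only
for [u = rho exp (- i phi)] with [phi] close to [pi/2]. A Vitali argument for
power series carries the limit for [Y] from the real axis along the arc
[0 <= phi <= pi/2]. Comparing both near [phi = pi/2] yields the convergence of
all moments of [th = (Y + z)^-1], then of [|th|^2], since
[|th|^2 = (th - conj th) / (conj z - z)], and by Bernstein polynomials that of
[E (f (|th|^2))] for continuous [f]. Finally [|th|^2] determines [Y] on
[Y >= - Re z], and [Re z] can be taken arbitrarily large. *)

(** * Quantitative power series expansions *)

(** The S-transform controls only [s] near [-oo], whereas the scale [e] calls for [s = - ln (e u)],
    which tends to [+oo]; hence a continuation over [s < ln (crit / e)] with [crit] independent of
    [e]. At such [s] the kernel [X / (X + A s)] is [(1 - exp (- e (Y + S)))^-1] for some shift [S],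
    that is [(e (Y + S))^-1] up to an error at most 1. The i-th factor contributes [(p_i / p_0)
    e^(alpha_0 - alpha_i) u^(1 - alpha_i)] to [S], so only [i = 0] survives. The law of [F] is known
    through a cone of unspecified aperture about the imaginary axis, that of [Y] first on the real
    axis, and the arc joins the two. The bound [Y >= - c] keeps the poles away from the whole arc;
    it has to come out of the real continuation. Both continuations carry explicit constants for
    coefficients and remainders: constants independent of the centre give steps of fixed length, and
    constants independent of [t] let limits pass through the expansions. *)

Definition absolute_value {R : realType} {K : fieldType} (N : K -> R) :=
  [/\ forall x, 0 <= N x, forall x, (N x == 0) = (x == 0),
      forall x y, N (x * y) = N x * N y & forall x y, N (x + y) <= N x + N y].

Lemma absolute_value_norm (R : realType) :
  absolute_value (fun x : R => `|x|).
Proof.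
split=> [x|x|x y|x y]; [exact: normr_ge0|exact: normr_eq0|exact: normrM|].
exact: ler_normD.
Qed.

Lemma absolute_value_normc (R : realType) :
  absolute_value (@Normc.normc R).
Proof.
split=> [x|x|x y|x y].
- by case: x => a b; exact: sqrtr_ge0.
- apply/eqP/eqP => [/Normc.eq0_normc //|->]; exact: Normc.normc0.
- exact: Normc.normcM.
- exact: le_normcD.
Qed.

Lemma le_of_eq (R : realType) (x y : R) : x = y -> x <= y.
Proof. by move=> ->. Qed.

Section expansion.
Context {R : realType} {K : fieldType} {N : K -> R} (absN : absolute_value N).
Implicit Types (D : set K) (f g : K -> K) (a b : nat -> K) (C M : R).

Lemma abv_ge0 x : 0 <= N x. Proof. by case: absN. Qed.
Lemma abv_eq0 x : (N x == 0) = (x == 0). Proof. by case: absN. Qed.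
Lemma abvM x y : N (x * y) = N x * N y. Proof. by case: absN. Qed.
Lemma abvD x y : N (x + y) <= N x + N y. Proof. by case: absN. Qed.
Hint Resolve abv_ge0 : core.

Lemma abv0 : N 0 = 0. Proof. by apply/eqP; rewrite abv_eq0. Qed.

Lemma abv_gt0 x : (0 < N x) = (x != 0).
Proof. by rewrite lt_neqAle abv_ge0 andbT eq_sym abv_eq0. Qed.

Lemma abv1 : N 1 = 1.
Proof.
have N1 : N 1 != 0 by rewrite abv_eq0 oner_neq0.
by apply: (mulfI N1); rewrite -abvM !mulr1.
Qed.

Lemma abvN x : N (- x) = N x.
Proof.
suff N1 : N (-1) = 1 by rewrite -mulN1r abvM N1 mul1r.
apply/eqP; rewrite -(@eqrXn2 _ 2) ?abv_ge0 ?ler01 //.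
by rewrite expr2 -abvM mulrNN mulr1 abv1 expr1n.
Qed.

Lemma abvX x n : N (x ^+ n) = N x ^+ n.
Proof. by elim: n => [|n IH]; rewrite ?expr0 ?abv1// !exprS abvM IH. Qed.

Lemma abvV x : N (x^-1) = (N x)^-1.
Proof.
have [->|x0] := eqVneq x 0; first by rewrite invr0 abv0 invr0.
have Nx : N x != 0 by rewrite abv_eq0.
by apply: (mulfI Nx); rewrite -abvM !divff// abv1.
Qed.

Lemma abvB x y : N (x - y) <= N x + N y.
Proof. by rewrite -(abvN y) abvD. Qed.

Lemma abvBC x y : N (x - y) = N (y - x).
Proof. by rewrite -abvN opprB. Qed.

Lemma abv_sum (I : Type) (r : seq I) (P : pred I) (F : I -> K) :
  N (\sum_(i <- r | P i) F i) <= \sum_(i <- r | P i) N (F i).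
Proof.
elim/big_ind2 : _ => [|x y u v xu yv|//]; first by rewrite abv0.
exact: le_trans (abvD _ _) (lerD xu yv).
Qed.

(* [h = 0] is excluded so that difference quotients, whose value at [0] is the
   junk value [x / 0 = 0], are covered. *)
Definition gexp D f a C M :=
  (forall n, N (a n) <= C * M ^+ n) /\
  (forall h n, D h -> h != 0 -> M * N h <= 1 ->
    N (f h - \sum_(k < n) a k * h ^+ k) <= C * (M * N h) ^+ n).

Lemma gexp_ge0 D f a C M : gexp D f a C M -> 0 <= C.
Proof. by case=> /(_ 0%N) + _; rewrite expr0 mulr1; apply: le_trans. Qed.

Lemma gexp_weak D f a C M C' M' : 0 <= M <= M' -> C <= C' ->
  gexp D f a C M -> gexp D f a C' M'.
Proof.
move=> /andP[M0 MM] CC fa; have C0 := gexp_ge0 fa; case: fa => aC fC.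
split=> [n|h n Dh h0 Mh].
  apply: le_trans (aC n) _; apply: ler_pM => //; first exact: exprn_ge0.
  by apply: lerXn2r => //; rewrite nnegrE //; apply: le_trans MM.
apply: le_trans (fC h n Dh h0 _) _.
  by apply: le_trans Mh; rewrite ler_wpM2r.
apply: ler_pM => //; first by rewrite exprn_ge0// mulr_ge0.
apply: lerXn2r; rewrite ?nnegrE ?mulr_ge0 ?ler_wpM2r//; exact: le_trans MM.
Qed.

Lemma gexp_eq D f g a C M : (forall h, D h -> h != 0 -> M * N h <= 1 -> f h = g h) ->
  gexp D f a C M -> gexp D g a C M.
Proof.
by move=> fg [aC fC]; split=> // h n Dh h0 Mh; rewrite -fg//; exact: fC.
Qed.

Lemma gexp_const D c M : 0 <= M ->
  gexp D (fun _ => c) (fun n => if n == 0%N then c else 0) (N c) M.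
Proof.
move=> M0; split=> [[|n]|h [|n] Dh h0 Mh] /=.
- by rewrite expr0 mulr1.
- by rewrite abv0 mulr_ge0// exprn_ge0.
- by rewrite big_ord0 subr0 expr0 mulr1.
- rewrite big_ord_recl /= expr0 mulr1 big1 ?addr0 ?subrr ?abv0.
    by rewrite mulr_ge0// exprn_ge0// mulr_ge0.
  by move=> i _; rewrite mul0r.
Qed.

Lemma gexpD D f g a b C C' M : gexp D f a C M -> gexp D g b C' M ->
  gexp D (fun h => f h + g h) (fun n => a n + b n) (C + C') M.
Proof.
move=> [aC fC] [bC gC]; split=> [n|h n Dh h0 Mh].
  by rewrite mulrDl; apply: le_trans (abvD _ _) _; apply: lerD.
rewrite mulrDl; apply: le_trans (lerD (fC _ _ Dh h0 Mh) (gC _ _ Dh h0 Mh)).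
apply: le_trans (abvD _ _); rewrite addrACA -opprD -big_split /=.
by under [in leRHS]eq_bigr do rewrite -mulrDl.
Qed.

Lemma gexpZ D f a C M c : gexp D f a C M ->
  gexp D (fun h => c * f h) (fun n => c * a n) (N c * C) M.
Proof.
move=> [aC fC]; split=> [n|h n Dh h0 Mh].
  by rewrite abvM -mulrA ler_wpM2l.
have -> : c * f h - \sum_(k < n) c * a k * h ^+ k =
          c * (f h - \sum_(k < n) a k * h ^+ k).
  by rewrite mulrBr mulr_sumr; under eq_bigr do rewrite -mulrA.
by rewrite abvM -mulrA ler_wpM2l// fC.
Qed.

Lemma gexp_shift D f a C M : 0 <= M -> gexp D f a C M ->
  gexp D (fun h => (f h - a 0%N) / h) (fun n => a n.+1) (C * M) M.
Proof.
move=> M0 [aC fC]; split=> [n|h n Dh h0 Mh].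
  by rewrite -mulrA -exprS.
have -> : (f h - a 0%N) / h - \sum_(k < n) a k.+1 * h ^+ k =
          (f h - \sum_(k < n.+1) a k * h ^+ k) / h.
  rewrite big_ord_recl /= expr0 mulr1 opprD addrA [in RHS]mulrBl mulr_suml.
  congr (_ - _); apply: eq_bigr => i _.
  by rewrite /bump /= add1n exprSr mulrA mulfK.
rewrite abvM abvV ler_pdivrMr ?abv_gt0//.
apply: le_trans (fC h n.+1 Dh h0 Mh) _.
by apply: le_of_eq; rewrite exprSr; ring.
Qed.

Lemma geo_half (x : R) n : \sum_(k < n) 2^-1 ^+ k * x = x * 2 * (1 - 2^-1 ^+ n).
Proof.
elim: n => [|n IH]; first by rewrite big_ord0 expr0 subrr mulr0.
by rewrite big_ord_recr /= IH exprSr; field.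
Qed.

Lemma geo_half_le (x : R) n : 0 <= x -> \sum_(k < n) 2^-1 ^+ k * x <= 2 * x.
Proof.
move=> x0; rewrite geo_half mulrBr mulr1 mulrC gerBl.
by rewrite mulr_ge0 ?exprn_ge0 ?invr_ge0// mulr_ge0.
Qed.

Definition cauchy_prod a b n := \sum_(k < n.+1) a k * b (n - k)%N.

Lemma sum_cauchy_prod a b (h : K) n :
  \sum_(j < n) cauchy_prod a b j * h ^+ j =
  \sum_(k < n) a k * h ^+ k * \sum_(i < n - k) b i * h ^+ i.
Proof.
elim: n => [|n IH]; first by rewrite !big_ord0.
rewrite big_ord_recr /= IH big_ord_recr /= subSn// subnn.
rewrite /cauchy_prod mulr_suml (big_ord_recr n)/= subnn addrA -big_split /=.
congr (_ + _); last by rewrite big_ord1 expr0 mulr1; ring.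
apply: eq_bigr => k _; rewrite subSn ?(ltnW (ltn_ord k))// big_ord_recr /= mulrDr.
congr (_ + _); have -> : h ^+ n = h ^+ k * h ^+ (n - k) by rewrite -exprD subnKC// ltnW.
ring.
Qed.

Lemma rate_half M n : M ^+ n = 2^-1 ^+ n * (2 * M) ^+ n.
Proof. by rewrite -exprMn mulrA mulVf ?mul1r// pnatr_eq0. Qed.

(** The k-th term is at most [C * C' * (2 * M) ^+ n * 2^-1 ^+ k]: the gap between the two rates
    makes the sum geometric, where equal rates would cost a factor [n + 1]. *)
Lemma cauchy_prod_coef a b C C' M n : 0 <= M -> 0 <= C -> 0 <= C' ->
  (forall k, (k <= n)%N -> N (a k) <= C * M ^+ k) ->
  (forall k, (k <= n)%N -> N (b k) <= C' * (2 * M) ^+ k) ->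
  N (cauchy_prod a b n) <= 2 * (C * C' * (2 * M) ^+ n).
Proof.
move=> M0 C0 C'0 aC bC; have M20 : 0 <= 2 * M by rewrite mulr_ge0.
apply: le_trans (abv_sum _ _ _) _.
apply: le_trans (geo_half_le n.+1 _); last by rewrite !mulr_ge0 ?exprn_ge0.
apply: ler_sum => k _; rewrite abvM.
have kn : (k <= n)%N by rewrite -ltnS.
have -> : 2^-1 ^+ k * (C * C' * (2 * M) ^+ n) =
  (C * M ^+ k) * (C' * (2 * M) ^+ (n - k)).
  have -> : (2 * M) ^+ n = (2 * M) ^+ k * (2 * M) ^+ (n - k).
    by rewrite -exprD subnKC.
  by rewrite (rate_half M); ring.
by apply: ler_pM => //; [exact: aC|apply: bC; exact: leq_subr].
Qed.

(* The rates [M] and [2 M] are kept apart so that iterating multiplication by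
   one function costs a geometric factor only. *)
Lemma cauchy_prod_rem a b (x y h : K) C C' M n : 0 <= M -> 0 <= C -> 0 <= C' ->
  (forall k, N (a k) <= C * M ^+ k) ->
  N (x - \sum_(k < n) a k * h ^+ k) <= C * (M * N h) ^+ n ->
  (forall k, (k <= n)%N -> N (y - \sum_(i < k) b i * h ^+ i) <= C' * (2 * M * N h) ^+ k) ->
  N (x * y - \sum_(k < n) cauchy_prod a b k * h ^+ k) <= 3 * (C * C') * (2 * M * N h) ^+ n.
Proof.
move=> M0 C0 C'0 aC xC yC; have M20 : 0 <= 2 * M by rewrite mulr_ge0.
rewrite sum_cauchy_prod.
set s := \sum_(_ < _) _.
have -> : x * y - s = (x - \sum_(k < n) a k * h ^+ k) * y +
   \sum_(k < n) a k * h ^+ k * (y - \sum_(i < n - k) b i * h ^+ i).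
  rewrite mulrBl -addrA; congr (_ + _); rewrite mulr_suml.
  under [X in _ = _ + X]eq_bigr do rewrite mulrBr.
  by rewrite sumrB addrA addNr add0r.
apply: le_trans (abvD _ _) _.
set X := (2 * M * N h) ^+ n.
have X0 : 0 <= X by rewrite exprn_ge0// mulr_ge0.
have -> : 3 * (C * C') * X = C * C' * X + 2 * (C * C' * X) by ring.
apply: lerD.
  rewrite abvM.
  have := yC 0%N isT; rewrite big_ord0 subr0 expr0 mulr1 => yh.
  rewrite mulrAC; apply: ler_pM => //; apply: le_trans xC _.
  rewrite ler_wpM2l// lerXn2r ?nnegrE ?mulr_ge0//.
  by rewrite ler_wpM2r// ler_peMl// ler1n.
apply: le_trans (abv_sum _ _ _) _.
apply: le_trans (geo_half_le n _); last by rewrite !mulr_ge0.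
apply: ler_sum => k _; rewrite !abvM abvX.
have kn : (k <= n)%N by rewrite ltnW.
have -> : 2^-1 ^+ k * (C * C' * X) =
      (C * M ^+ k * N h ^+ k) * (C' * (2 * M * N h) ^+ (n - k)).
  have -> : X = (2 * M * N h) ^+ k * (2 * M * N h) ^+ (n - k).
    by rewrite -exprD subnKC.
  have -> : (2 * M * N h) ^+ k = (2 * M) ^+ k * N h ^+ k by rewrite exprMn.
  by rewrite (rate_half M); ring.
apply: ler_pM; rewrite ?mulr_ge0 ?exprn_ge0// ?ler_wpM2r ?exprn_ge0//.
by apply: yC; exact: leq_subr.
Qed.

Lemma gexpM D f g a b C C' M : 0 <= M -> gexp D f a C M -> gexp D g b C' (2 * M) ->
  gexp D (fun h => f h * g h) (cauchy_prod a b) (3 * (C * C')) (2 * M).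
Proof.
move=> M0 fa gb; have C0 := gexp_ge0 fa; have C'0 := gexp_ge0 gb.
case: fa gb => aC fC [bC gC]; have M20 : 0 <= 2 * M by rewrite mulr_ge0.
split=> [n|h n Dh h0 Mh].
  apply: le_trans (cauchy_prod_coef M0 C0 C'0 (fun k _ => aC k) (fun k _ => bC k)) _.
  rewrite mulrA; rewrite ler_wpM2r ?exprn_ge0// ler_wpM2r ?mulr_ge0//.
  by rewrite ler_nat.
apply: cauchy_prod_rem => // [|k _]; last exact: gC.
by apply: fC => //; apply: le_trans Mh; rewrite ler_wpM2r// ler_peMl// ler1n.
Qed.

Lemma gexp_near0 D f a C M h : gexp D f a C M -> D h -> h != 0 -> M * N h <= 1 ->
  N (f h - a 0%N) <= C * (M * N h).
Proof.
by move=> [_ fC] Dh h0 Mh; have := fC h 1%N Dh h0 Mh; rewrite big_ord1 !expr0 mulr1 expr1.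
Qed.

Lemma gexp_bound D f a C M h : gexp D f a C M -> D h -> h != 0 -> M * N h <= 1 ->
  N (f h) <= C.
Proof.
by move=> [_ fC] Dh h0 Mh; have := fC h 0%N Dh h0 Mh; rewrite big_ord0 subr0 expr0 mulr1.
Qed.

(* Long division: the remainders satisfy [S_{n+1} = (S_n - c_n f) / h], and their
   constants grow geometrically. *)
Lemma gexp_inv D f b C M m : 0 <= M -> 0 < m -> m <= N (b 0%N) -> gexp D f b C M ->
  (forall h, D h -> h != 0 -> 2 * M * (1 + C / m) * N h <= 1 -> m / 2 <= N (f h)) /\
  exists a, gexp D (fun h => (f h)^-1) a (2 / m) (2 * M * (1 + C / m)).
Proof.
move=> M0 m0 mb fb; have C0 := gexp_ge0 fb.
(* This rate serves twice: [M2 * N h <= 1] keeps [f h] at distance [m / 2] from 0, and half of [M2]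
   is the growth factor [L] of the remainders below. *)
set M2 := 2 * M * (1 + C / m).
have M2M : M <= M2.
  rewrite /M2 mulrAC ler_peMl// mulrDr mulr1 -[leLHS]addr0 lerD ?ler1n//.
  by rewrite mulr_ge0// divr_ge0// ltW.
have M20 : 0 <= M2 by apply: le_trans M2M.
have MM h : M2 * N h <= 1 -> M * N h <= 1.
  by apply: le_trans; rewrite ler_wpM2r.
have fm h : D h -> h != 0 -> M2 * N h <= 1 -> m / 2 <= N (f h).
  move=> Dh h0 Mh; have Mh1 : M * N h <= 1 by exact: MM.
  have := gexp_near0 fb Dh h0 Mh1; rewrite abvBC => fb0.
  have : N (b 0%N) <= N (f h) + N (b 0%N - f h).
    by rewrite addrC -{1}(subrK (f h) (b 0%N)) abvD.
  suff : C * (M * N h) <= m / 2 by lra.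
  move: Mh; rewrite /M2 -(@ler_pM2r _ (m / 2)) ?divr_gt0// mul1r.
  apply: le_trans; rewrite -subr_ge0.
  suff -> : 2 * M * (1 + C / m) * N h * (m / 2) - C * (M * N h) = M * m * N h.
    by rewrite !mulr_ge0// ltW.
  by field; rewrite gt_eqF.
split=> //.
have b0 : b 0%N != 0 by rewrite -abv_gt0 (lt_le_trans m0).
have iNb0 : (N (b 0%N))^-1 <= m^-1 by rewrite lef_pV2// posrE (lt_le_trans m0).
(* [s n] lists the coefficients of the n-th remainder, starting from those of the constant 1; [L]
   bounds their growth from one remainder to the next. *)
pose step (s : nat -> K) := fun n => s n.+1 - s 0%N / b 0%N * b n.+1.
pose s n := iter n step (fun k => if k == 0%N then 1 else 0 : K).
pose c n := s n 0%N / b 0%N.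
pose L := M * (1 + C / m).
have L0 : 0 <= L by rewrite mulr_ge0// addr_ge0// divr_ge0// ltW.
have main n : exists S, gexp D S (s n) (L ^+ n) M /\
   forall h, D h -> h != 0 -> M * N h <= 1 -> f h != 0 ->
     (f h)^-1 - \sum_(k < n) c k * h ^+ k = h ^+ n * S h / f h.
  elim: n => [|n [S [Ss SE]]].
    exists (fun=> 1); split.
      by rewrite expr0 -[X in gexp _ _ _ X _]abv1; exact: gexp_const.
    by move=> h Dh h0 Mh fh0; rewrite big_ord0 subr0 expr0 !mul1r.
  exists (fun h => (S h - c n * f h) / h); split.
    have := gexpD Ss (gexpZ (- c n) fb).
    move=> /(gexp_shift M0) E.
    have {}E : gexp D (fun h => (S h - c n * f h) / h) (s n.+1) ((L ^+ n + N (- c n) * C) * M) M.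
      have E1 : (fun n0 => s n n0.+1 + - c n * b n0.+1) = s n.+1.
        by apply/funext => k; rewrite /s iterS -/(s n) /step /c mulNr.
      rewrite -E1; apply: gexp_eq E => h _ _ _ /=.
      have cb : c n * b 0%N = s n 0%N by rewrite /c divfK.
      by rewrite !mulNr cb subrr subr0.
    apply: gexp_weak E; rewrite ?M0 ?lexx//.
    rewrite exprSr /L -/L.
    have -> : L ^+ n * (M * (1 + C / m)) = (L ^+ n + L ^+ n / m * C) * M by ring.
    rewrite ler_wpM2r// lerD2l abvN /c abvM abvV.
    have := Ss.1 0%N; rewrite expr0 mulr1 => sL.
    by rewrite ler_wpM2r//; apply: ler_pM; rewrite ?invr_ge0.
  move=> h Dh h0 Mh fh0; rewrite big_ord_recr /= opprD addrA SE//.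
  rewrite exprSr; field; by rewrite fh0 h0.
exists c; split=> [n|h n Dh h0 Mh].
  rewrite /c abvM abvV; have [S [[Ss _] _]] := main n.
  have := Ss 0%N; rewrite expr0 mulr1 => sL.
  apply: (@le_trans _ _ (L ^+ n / m)); first by apply: ler_pM; rewrite ?invr_ge0.
  rewrite mulrC; apply: ler_pM; rewrite ?invr_ge0 ?exprn_ge0// ?(ltW m0)//.
    by rewrite ler_peMl ?invr_ge0 ?(ltW m0)// ler1n.
  by rewrite lerXn2r// ?nnegrE// /L /M2 -mulrA ler_peMl// ler1n.
have [S [Ss SE]] := main n; have Mh1 := MM _ Mh.
have fh := fm _ Dh h0 Mh.
have fh0 : 0 < N (f h) by apply: lt_le_trans fh; rewrite divr_gt0.
rewrite SE// -?abv_gt0// !abvM abvV abvX.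
have Sh := gexp_bound Ss Dh h0 Mh1.
rewrite exprMn.
have -> : 2 / m * (M2 ^+ n * N h ^+ n) = N h ^+ n * M2 ^+ n * (m / 2)^-1.
  by field; rewrite gt_eqF.
apply: ler_pM; rewrite ?invr_ge0 ?mulr_ge0 ?exprn_ge0//.
  rewrite ler_wpM2l ?exprn_ge0//; apply: le_trans Sh _.
  by rewrite lerXn2r// ?nnegrE// /L /M2 -mulrA ler_peMl// ler1n.
by rewrite lef_pV2// posrE divr_gt0.
Qed.

(* The remainders of the expansion in powers of [beta] satisfy
   [S_{n+1} = (h / beta) (S_n - m_n) / h]. *)
Lemma gexp_reparam D (beta kappa N0 : K -> K) k a C C' M : 0 <= M ->
  (forall h, D h -> h != 0 -> 2 * M * N h <= 1 -> kappa h * beta h = h) ->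
  gexp D kappa k C' M -> gexp D N0 a C (2 * M) ->
  exists m : nat -> K, (forall n, N (m n) <= C * (3 * C' * (2 * M)) ^+ n) /\
    forall h n, D h -> h != 0 -> 2 * M * N h <= 1 ->
    N (N0 h - \sum_(k < n) m k * beta h ^+ k) <=
    C * ((3 * C' * (2 * M)) * N (beta h)) ^+ n.
Proof.
move=> M0 kb kC NC; have C0 := gexp_ge0 NC; have C'0 := gexp_ge0 kC.
pose s n := iter n (fun b : nat -> K => cauchy_prod k (fun i => b i.+1)) a.
(* Passing to the next remainder costs [2 * M] for the division by [h] and [3 * C'] for the product
   with [kappa], while the rate stays at [2 * M]. *)
pose m n := s n 0%N; set L := 3 * C' * (2 * M).
have L0 : 0 <= L by rewrite !mulr_ge0.
have main n : exists S, gexp D S (s n) (C * L ^+ n) (2 * M) /\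
   forall h, D h -> h != 0 -> 2 * M * N h <= 1 ->
    N0 h - \sum_(k < n) m k * beta h ^+ k = beta h ^+ n * S h.
  elim: n => [|n [S [Ss SE]]].
    exists N0; split; first by rewrite expr0 mulr1.
    by move=> h *; rewrite big_ord0 subr0 expr0 mul1r.
  exists (fun h => kappa h * ((S h - s n 0%N) / h)); split.
    have := gexpM M0 kC (gexp_shift (mulr_ge0 (ler0n _ 2) M0) Ss).
    apply: gexp_weak; first by rewrite lexx mulr_ge0.
    by rewrite exprSr le_eqVlt; apply/orP; left; apply/eqP; rewrite /L; ring.
  move=> h Dh h0 Mh; rewrite big_ord_recr /= opprD addrA SE// exprSr -/(m n).
  have -> : beta h ^+ n * beta h * (kappa h * ((S h - m n) / h)) =
            beta h ^+ n * (kappa h * beta h * ((S h - m n) / h)) by ring.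
  by rewrite kb// [h * _]mulrC divfK// mulrBr [m n * _]mulrC.
exists m; split=> [n|h n Dh h0 Mh].
  by have [S [[/(_ 0%N) + _] _]] := main n; rewrite expr0 mulr1.
have [S [Ss ->//]] := main n; rewrite abvM abvX exprMn mulrC.
rewrite mulrA ler_wpM2r ?exprn_ge0//; exact: gexp_bound Ss Dh h0 Mh.
Qed.

End expansion.

Lemma exists_geo_lt (R : realType) (C e : R) : 0 < e -> exists n, C * 2^-1 ^+ n < e.
Proof.
move=> e0; have h2 : `|2^-1 : R| < 1 by rewrite ger0_norm ?invr_ge0// invf_lt1// ltr1n.
have := @cvg_geometric _ C 2^-1 h2.
move=> /cvgrPdist_lt /(_ e e0) [n _ /(_ n (leqnn n))] /=.
by rewrite sub0r normrN => /(le_lt_trans (ler_norm _)); exists n.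
Qed.

Lemma sum_share_le (R : realType) (r : R) n : 0 <= r -> \sum_(k < n) r / n.+1%:R <= r.
Proof.
move=> r0; rewrite sumr_const card_ord -[_ *+ n]mulr_natr -mulrA ler_piMr//.
by rewrite mulrC ler_pdivrMr ?ltr0n// mul1r ler_nat.
Qed.

(** * Vitali's theorem for power series with uniform bounds *)

Section vitali.
Context {R : realType} {K : fieldType} {N : K -> R} (absN : absolute_value N).
Context {T X : Type} {F : set_system T} {FF : Filter F}.
Variables (beta : X -> K) (a : T -> nat -> K) (f : T -> X -> K) (D : set X) (C M : R).
Hypothesis M0 : 0 <= M.
Hypothesis C0 : 0 <= C.
Hypothesis fC : \forall t \near F, forall x n, D x -> M * N (beta x) <= 1 ->
  N (f t x - \sum_(k < n) a t k * beta x ^+ k) <= C * (M * N (beta x)) ^+ n.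
Hypothesis f0 : forall d, 0 < d -> exists x,
  [/\ D x, beta x != 0, N (beta x) < d &
      forall e, 0 < e -> \forall t \near F, N (f t x) < e].

(* [f t x] is the sum of [a t n * beta x ^+ n]: divide by [beta x ^+ n], let [t]
   vary first and then choose [x] with [beta x] small. *)
Lemma vitali_coef n e : 0 < e -> \forall t \near F, N (a t n) < e.
Proof.
have N0 := abv_ge0 absN.
elim/ltn_ind: n e => n IH e e0.
pose Q := C * M ^+ n.+1; have Q0 : 0 <= Q by rewrite mulr_ge0// exprn_ge0.
have e3 : 0 < e / 3 by rewrite divr_gt0.
(* These bounds on [N (beta x)] put [x] inside the domain of the expansion and make the remainder of
   order [n + 1] at most [e / 3 * N (beta x) ^+ n]. The value [f t x] and the lower terms together
   get two more such shares. *)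
have d0 : 0 < Num.min (Num.min 1 (M + 1)^-1) (e / 3 / (Q + 1)).
  by rewrite !lt_min ltr01 invr_gt0 ltr_wpDl// divr_gt0// ltr_wpDl.
have [x [Dx b0]] := f0 d0; rewrite !lt_min => /andP[/andP[b1 bM] bQ] fx.
have Nb : 0 < N (beta x) by rewrite abv_gt0.
have Mb : M * N (beta x) <= 1.
  move: bM; rewrite -div1r ltr_pdivlMr ?ltr_wpDl// mulrC => /ltW.
  by apply: le_trans; rewrite ler_wpM2r// lerDl.
pose r := e / 3 * N (beta x) ^+ n.
have r0 : 0 < r by rewrite mulr_gt0// exprn_gt0.
have rn : 0 < r / n.+1%:R by rewrite divr_gt0.
have IHr : \forall t \near F, forall k : 'I_n, N (a t k) < r / n.+1%:R.
  by apply: filter_forall => k; exact: IH.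
near=> t.
have ft : N (f t x) < r by near: t; exact: fx.
have at_ : forall k : 'I_n, N (a t k) < r / n.+1%:R by near: t.
have fCt : N (f t x - \sum_(k < n.+1) a t k * beta x ^+ k) <= C * (M * N (beta x)) ^+ n.+1.
  by move: Dx Mb; move: (x) (n.+1); near: t.
have key : N (a t n) * N (beta x) ^+ n < e * N (beta x) ^+ n.
  have -> : N (a t n) * N (beta x) ^+ n = N (a t n * beta x ^+ n).
    by rewrite (abvM absN) (abvX absN).
  have -> : a t n * beta x ^+ n = (f t x - \sum_(k < n) a t k * beta x ^+ k) -
      (f t x - \sum_(k < n.+1) a t k * beta x ^+ k) by rewrite big_ord_recr /=; ring.
  apply: le_lt_trans (abvB absN _ _) _.
  have -> : e * N (beta x) ^+ n = r + r + r by rewrite /r; field.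
  apply: ltr_leD; last first.
    apply: le_trans fCt _.
    rewrite exprMn mulrA -/Q exprS mulrA /r ler_wpM2r ?exprn_ge0//.
    move: bQ; rewrite ltr_pdivlMr ?ltr_wpDl// mulrC => /ltW; apply: le_trans.
    by rewrite ler_wpM2r// lerDl.
  apply: le_lt_trans (abvB absN _ _) _.
  apply: ltr_leD => //; apply: le_trans (abv_sum absN _ _ _) _.
  apply: (@le_trans _ _ (\sum_(k < n) r / n.+1%:R)).
    apply: ler_sum => k _; rewrite (abvM absN) (abvX absN).
    rewrite -[leRHS]mulr1; apply: ler_pM => //; rewrite ?exprn_ge0// ?(ltW (at_ k))//.
    by rewrite exprn_ile1// ltW.
  exact: sum_share_le (ltW r0).
by move: key; rewrite ltr_pM2r// exprn_gt0.
Unshelve. all: by end_near. Qed.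

(** At half the radius the tail of the series is small uniformly in [t], and the finitely many
    remaining terms vanish by [vitali_coef]. *)
Lemma vitali_val x e : D x -> M * N (beta x) <= 2^-1 -> 0 < e ->
  \forall t \near F, N (f t x) < e.
Proof.
have N0 := abv_ge0 absN.
move=> Dx Mb e0; have e2 : 0 < e / 2 by rewrite divr_gt0.
have [m Cm] := exists_geo_lt C e2.
have Mb1 : M * N (beta x) <= 1 by apply: le_trans Mb _; rewrite invf_le1// ler1n.
have r0 (k : 'I_m) : 0 < e / 2 / m.+1%:R / (N (beta x) ^+ k + 1).
  by rewrite divr_gt0 ?divr_gt0// ltr_wpDl// exprn_ge0.
have IHr : \forall t \near F, forall k : 'I_m, N (a t k) < e / 2 / m.+1%:R / (N (beta x) ^+ k + 1).
  by apply: filter_forall => k; exact: vitali_coef.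
near=> t.
have at_ : forall k : 'I_m, N (a t k) < e / 2 / m.+1%:R / (N (beta x) ^+ k + 1) by near: t.
have fCt : N (f t x - \sum_(k < m) a t k * beta x ^+ k) <= C * (M * N (beta x)) ^+ m.
  by move: Dx Mb1; move: (x) (m); near: t.
rewrite -(subrK (\sum_(k < m) a t k * beta x ^+ k) (f t x)).
apply: le_lt_trans (abvD absN _ _) _.
rewrite [e in _ < e](splitr e); apply: ltr_leD.
  apply: le_lt_trans fCt _; apply: le_lt_trans Cm; rewrite ler_wpM2l//.
  by rewrite lerXn2r ?nnegrE ?mulr_ge0 ?invr_ge0.
apply: le_trans (abv_sum absN _ _ _) _.
apply: (@le_trans _ _ (\sum_(k < m) e / 2 / m.+1%:R)).
  apply: ler_sum => k _; rewrite (abvM absN) (abvX absN).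
  have := at_ k; rewrite ltr_pdivlMr; last by rewrite ltr_wpDl// exprn_ge0.
  by move=> /ltW; apply: le_trans; rewrite ler_wpM2l// lerDl.
exact: sum_share_le (ltW e2).
Unshelve. all: by end_near. Qed.

End vitali.

(** Course-of-values recursion: a coefficient of a power series solution depends on all the earlier
    ones. [pref n] is meaningful only up to index [n], which is all that [Phi n] looks at. *)
Lemma nat_rec_prefix (T : Type) (x0 : T) (Phi : nat -> (nat -> T) -> T) :
  (forall n a b, (forall i, (i <= n)%N -> a i = b i) -> Phi n a = Phi n b) ->
  exists c, c 0%N = x0 /\ forall n, c n.+1 = Phi n c.
Proof.
move=> ext.
pose pref := fix pref n : nat -> T := if n is m.+1 then
  fun i => if i == n then Phi m (pref m) else pref m i else fun=> x0.
have prefE n i : (i <= n)%N -> pref n i = pref i i.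
  elim: n => [|n IH]; first by rewrite leqn0 => /eqP ->.
  rewrite leq_eqVlt => /orP[/eqP -> //|]; rewrite ltnS => iln.
  by rewrite /= ltn_eqF ?ltnS// IH.
exists (fun n => pref n n); split=> // n /=; rewrite eqxx.
by apply: ext => i; exact: prefE.
Qed.

Lemma is_derive_poly_shift (R : realType) (a : nat -> R) n (x : R) :
  is_derive x 1 (fun y => \sum_(k < n.+1) a k * y ^+ k)
    (\sum_(k < n) k.+1%:R * a k.+1 * x ^+ k).
Proof.
elim: n => [|n IH].
  rewrite big_ord0; under eq_fun do rewrite big_ord1 expr0 mulr1.
  exact: is_derive_cst.
under eq_fun do rewrite big_ord_recr /=.
rewrite big_ord_recr /=.
apply: is_deriveD.
have -> : (fun y : R => a n.+1 * y ^+ n.+1) = a n.+1 *: ((id : R -> R) ^+ n.+1).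
  by apply/funext => y; rewrite exprfctE.
apply: is_derive_eq; rewrite /GRing.scale /=; ring.
Qed.

(** The remainder of order [n + 1] of [g] has for derivative the remainder of order [n] of [k * g],
    so the mean value theorem drives an induction on [n]; [3 * C' <= 2 * M] absorbs the constant of
    the product. This expands exponentials of known functions without composing power series. *)
Lemma gexp_ode (R : realType) (g k : R -> R) (c : nat -> R) (C C' M : R) :
  0 <= M -> 3 * C' <= 2 * M -> gexp (N := fun x : R => `|x|) setT k c C' M ->
  (forall x : R, 2 * M * `|x| <= 1 -> is_derive x 1 g (k x * g x)) ->
  (forall x : R, 2 * M * `|x| <= 1 -> `|g x| <= C) ->
  exists a, a 0%N = g 0 /\ gexp (N := fun x : R => `|x|) setT g a C (2 * M).
Proof.
move=> M0 CM kc gd gC; have C'0 := gexp_ge0 (absolute_value_norm R) kc.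
have absR := absolute_value_norm R.
have M20 : 0 <= 2 * M by rewrite mulr_ge0.
have C0 : 0 <= C by apply: le_trans (gC 0 _); rewrite // normr0 mulr0.
case: kc => cC kC.
have [n x y xy|a [a0 aS]] := @nat_rec_prefix R (g 0) (fun n a => cauchy_prod c a n / n.+1%:R).
  by congr (_ / _); apply: eq_bigr => i _; rewrite xy// leq_subr.
have aC n : `|a n| <= C * (2 * M) ^+ n.
  elim/ltn_ind: n => -[_|n IH].
    by rewrite a0 expr0 mulr1; apply: gC; rewrite normr0 mulr0.
  rewrite aS normrM normfV [X in _ / X]ger0_norm// ler_pdivrMr ?ltr0n//.
  have := @cauchy_prod_coef _ _ _ absR c a C' C M n M0 C'0 C0 (fun k _ => cC k) (fun k kn => IH k kn).
  move=> /le_trans; apply; rewrite exprSr.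
  have -> : 2 * (C' * C * (2 * M) ^+ n) = C * (2 * M) ^+ n * (2 * C') by ring.
  rewrite [X in _ <= X * _]mulrA -[leRHS]mulrA ler_wpM2l ?mulr_ge0 ?exprn_ge0//.
  apply: (@le_trans _ _ (2 * M)); first by apply: le_trans CM; rewrite ler_wpM2r// ler_nat.
  by rewrite ler_peMr// ler1n.
exists a; split=> //; split=> // x n _ x0.
elim/ltn_ind: n x x0 => -[_|n IH] x x0 Mx.
  by rewrite big_ord0 subr0 expr0 mulr1; exact: gC.
pose R_ y := g y - \sum_(k < n.+1) a k * y ^+ k.
pose dR y := k y * g y - \sum_(j < n) cauchy_prod c a j * y ^+ j.
have RD (y : R) : 2 * M * `|y| <= 1 -> is_derive y 1 R_ (dR y).
  move=> My; have gy := gd y My; have py := is_derive_poly_shift a n y.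
  apply: is_derive_eq; rewrite /dR; congr (_ - _); apply: eq_bigr => i _.
  by rewrite aS [_ * (_ / _)]mulrC divfK// pnatr_eq0.
have R0 : R_ 0 = 0.
  rewrite /R_ big_ord_recl expr0 mulr1 a0 big1 ?addr0 ?subrr// => i _.
  by rewrite expr0n mulr0.
have dRC (y : R) : y != 0 -> `|y| <= `|x| -> `|dR y| <= 2 * M * C * (2 * M * `|x|) ^+ n.
  move=> y0 yx; have My : 2 * M * `|y| <= 1.
    by apply: le_trans Mx; rewrite ler_wpM2l.
  have := @cauchy_prod_rem _ _ _ absR c a _ _ _ _ _ _ n M0 C'0 C0 cC (kC y n I y0 _) (fun i ilen => IH i ilen y y0 My).
  have My1 : M * `|y| <= 1 by apply: le_trans My; rewrite ler_wpM2r// ler_peMl// ler1n.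
  move=> /(_ My1) /le_trans; apply.
  have -> : 3 * (C' * C) = 3 * C' * C by ring.
  apply: ler_pM => //; rewrite ?mulr_ge0 ?exprn_ge0 ?mulr_ge0// ?ler_wpM2r//.
  by rewrite lerXn2r ?nnegrE ?mulr_ge0// ler_wpM2l.
(* The expansions say nothing at 0, but the mean value theorem evaluates the derivative only inside
   the interval, which will have 0 as an endpoint. *)
have main (y z : R) : y < z -> (forall w : R, y <= w <= z -> `|w| <= `|x|) -> (forall w : R, y < w < z -> w != 0) ->
   `|R_ z - R_ y| <= 2 * M * C * (2 * M * `|x|) ^+ n * (z - y).
  move=> yz yzx yz0.
  have RDw (w : R) : y <= w <= z -> is_derive w 1 R_ (dR w).
    by move=> yw; apply: RD; apply: le_trans Mx; rewrite ler_wpM2l// yzx.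
  have [] := @MVT R R_ dR y z yz.
  - by move=> w; rewrite in_itv /= => /andP[yw wz]; apply: RDw; rewrite (ltW yw) (ltW wz).
  - apply: derivable_within_continuous => w; rewrite in_itv /= => yw.
    by have := RDw w yw; case.
  - move=> w; rewrite in_itv /= => yw ->; have zy : 0 <= z - y by rewrite subr_ge0 ltW.
    rewrite normrM [X in _ * X]ger0_norm//.
    rewrite ler_wpM2r//; apply: dRC; first exact: yz0.
    by apply: yzx; case/andP: yw => yw wz; rewrite (ltW yw) (ltW wz).
have -> : C * (2 * M * `|x|) ^+ n.+1 = 2 * M * C * (2 * M * `|x|) ^+ n * `|x|.
  by rewrite exprSr; ring.
have [xlt|xgt|xe] := ltgtP x 0; last by rewrite xe eqxx in x0.
- have := main x 0 xlt; rewrite R0 sub0r normrN sub0r ltr0_norm//; apply.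
    by move=> w /andP[xw w0]; rewrite !ler0_norm ?lerN2// ltW.
  by move=> w /andP[_ w0]; rewrite lt_eqF.
- have := main 0 x xgt; rewrite R0 !subr0 [`|x|]gtr0_norm//; apply.
    by move=> w /andP[w0 wx]; rewrite ger0_norm.
  by move=> w /andP[w0 _]; rewrite gt_eqF.
Qed.

(** * Integrals of bounded functions *)

Section bounded_measurable.
Context {d : measure_display} {T : measurableType d} {R : realType}.
Implicit Types (P : probability T R) (D : set T) (f g : T -> R).

Lemma measurable_fun_inv D f : measurable_fun D f ->
  measurable_fun D (fun x => (f x)^-1).
Proof.
move=> mf.
(* Inversion becomes a real power; the square makes its base nonnegative, and at a zero of [f] both
   sides are 0. *)
have -> : (fun x => (f x)^-1) = (fun x => f x * (f x ^+ 2) `^ (-1)).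
  apply/funext => x; rewrite powR_inv1 ?sqr_ge0//.
  by have [->|f0] := eqVneq (f x) 0; [rewrite invr0 mul0r|field].
apply: measurable_funM => //.
by apply: measurableT_comp (measurable_powR _) _; exact: measurable_funX.
Qed.

Definition bmeas D f :=
  measurable_fun D f /\ exists M, forall x, D x -> `|f x| <= M.

Lemma bmeas_cst D (c : R) : bmeas D (fun=> c).
Proof. by split; [exact: measurable_cst|exists `|c|]. Qed.

Lemma bmeasD D f g : bmeas D f -> bmeas D g -> bmeas D (fun x => f x + g x).
Proof.
move=> [mf [M fM]] [mg [M' gM]]; split; first exact: measurable_funD.
by exists (M + M') => x Dx; apply: le_trans (ler_normD _ _) _; rewrite lerD ?fM ?gM.
Qed.

Lemma bmeasM D f g : bmeas D f -> bmeas D g -> bmeas D (fun x => f x * g x).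
Proof.
move=> [mf [M fM]] [mg [M' gM]]; split; first exact: measurable_funM.
by exists (M * M') => x Dx; rewrite normrM ler_pM ?fM ?gM.
Qed.

Lemma bmeasN D f : bmeas D f -> bmeas D (fun x => - f x).
Proof.
move=> [mf [M fM]]; split; first exact: measurable_funN.
by exists M => x Dx; rewrite normrN fM.
Qed.

Lemma bmeasB D f g : bmeas D f -> bmeas D g -> bmeas D (fun x => f x - g x).
Proof. by move=> bf bg; apply: bmeasD => //; exact: bmeasN. Qed.

Lemma bmeasZ D c f : bmeas D f -> bmeas D (fun x => c * f x).
Proof. by apply: bmeasM; exact: bmeas_cst. Qed.

Lemma bmeasX D f n : bmeas D f -> bmeas D (fun x => f x ^+ n).
Proof.
move=> bf; elim: n => [|n IH]; first exact: bmeas_cst.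
by under eq_fun do rewrite exprS; exact: bmeasM.
Qed.

Lemma bmeas_inv D f (c : R) : 0 < c -> measurable_fun D f ->
  (forall x, D x -> c <= `|f x|) -> bmeas D (fun x => (f x)^-1).
Proof.
move=> c0 mf fc; split; first exact: measurable_fun_inv.
exists c^-1 => x Dx; rewrite normfV lef_pV2 ?posrE//; first exact: fc.
exact: lt_le_trans (fc x Dx).
Qed.

Lemma bmeas_sum D n (F : nat -> T -> R) : (forall k, (k < n)%N -> bmeas D (F k)) ->
  bmeas D (fun x => \sum_(k < n) F k x).
Proof.
elim: n => [|n IH] bF; first by under eq_fun do rewrite big_ord0; exact: bmeas_cst.
under eq_fun do rewrite big_ord_recr /=.
by apply: bmeasD; [apply: IH => k kn; apply: bF; exact: ltnW|exact: bF].
Qed.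

Lemma bmeas_sub D D' f : measurable D -> D' `<=` D -> bmeas D f -> bmeas D' f.
Proof.
move=> mD DD [mf [M fM]]; split; first exact: measurable_funS mf.
by exists M => x /DD; exact: fM.
Qed.

Context {P : probability T R}.

Lemma bmeas_integrable D f : measurable D -> bmeas D f -> P.-integrable D (EFin \o f).
Proof.
move=> mD [mf [M fM]]; apply: measurable_bounded_integrable => //.
  by apply: le_lt_trans (probability_le1 _ mD) _; rewrite ltry.
exists M; split; first exact: num_real.
by move=> y My x /= Dx; apply: le_trans (fM x Dx) (ltW My).
Qed.

Lemma bRintegral_D D f g : measurable D -> bmeas D f -> bmeas D g ->
  \int[P]_(x in D) (f x + g x) = \int[P]_(x in D) f x + \int[P]_(x in D) g x.
Proof. by move=> mD bf bg; apply: RintegralD => //; exact: bmeas_integrable. Qed.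

Lemma bRintegral_B D f g : measurable D -> bmeas D f -> bmeas D g ->
  \int[P]_(x in D) (f x - g x) = \int[P]_(x in D) f x - \int[P]_(x in D) g x.
Proof. by move=> mD bf bg; apply: RintegralB => //; exact: bmeas_integrable. Qed.

Lemma bRintegral_Z D c f : measurable D -> bmeas D f ->
  \int[P]_(x in D) (c * f x) = c * \int[P]_(x in D) f x.
Proof. by move=> mD bf; apply: RintegralZl => //; exact: bmeas_integrable. Qed.

Lemma bRintegral_sum D n (F : nat -> T -> R) : measurable D ->
  (forall k, (k < n)%N -> bmeas D (F k)) ->
  \int[P]_(x in D) (\sum_(k < n) F k x) = \sum_(k < n) \int[P]_(x in D) F k x.
Proof.
move=> mD; elim: n => [|n IH] bF.
  rewrite big_ord0; under eq_Rintegral do rewrite big_ord0.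
  by rewrite Rintegral_cst// mul0r.
rewrite big_ord_recr /= -IH; last by move=> k kn; apply: bF; exact: ltnW.
rewrite -bRintegral_D//; last 2 first.
- by apply: bmeas_sum => k kn; apply: bF; exact: ltnW.
- exact: bF.
by apply: eq_Rintegral => x _; rewrite big_ord_recr.
Qed.

Lemma bRintegral_le D f g : measurable D -> bmeas D f -> bmeas D g ->
  (forall x, D x -> f x <= g x) ->
  \int[P]_(x in D) f x <= \int[P]_(x in D) g x.
Proof. by move=> mD bf bg fg; apply: le_Rintegral => //; exact: bmeas_integrable. Qed.

Lemma bRintegral_cst D (c : R) : measurable D -> P D = 1%E -> \int[P]_(x in D) c = c.
Proof. by move=> mD PD; rewrite Rintegral_cst// (_ : fine _ = 1) ?mulr1//; exact: (congr1 fine PD). Qed.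

Lemma bRintegral_norm D f (M : R) : measurable D -> 0 <= M -> measurable_fun D f ->
  (forall x, D x -> `|f x| <= M) -> `|\int[P]_(x in D) f x| <= M.
Proof.
move=> mD M0 mf fM; have bf : bmeas D f by split => //; exists M.
have PD1 : fine (P D) <= 1.
  by rewrite -lee_fin fineK ?probability_le1// fin_num_measure.
have PD0 : 0 <= fine (P D) by rewrite fine_ge0.
have H1 := @bRintegral_le D f (fun=> M) mD bf (bmeas_cst _ _) (fun x Dx => le_trans (ler_norm _) (fM x Dx)).
have H2 := @bRintegral_le D (fun=> - M) f mD (bmeas_cst _ _) bf.
have {}H2 := H2 (fun x Dx => lerNnormlW (fM x Dx)).
rewrite !Rintegral_cst// in H1 H2.
rewrite ler_norml; apply/andP; split.
  by apply: le_trans H2; rewrite mulNr lerN2 ler_piMr.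
by apply: le_trans H1 _; rewrite ler_piMr.
Qed.

Lemma bRintegral_subset D D' f : measurable D -> measurable D' -> D' `<=` D -> P D' = 1%E ->
  bmeas D f -> \int[P]_(x in D) f x = \int[P]_(x in D') f x.
Proof.
move=> mD mD' DD' PD' bf; congr fine.
have mN : measurable (D `\` D') by exact: measurableD.
rewrite (negligible_integral mN mD).
- by rewrite setDD setIidr.
- exact: bmeas_integrable.
- have PD : P D = 1%E.
    apply/eqP; rewrite eq_le probability_le1//=.
    by rewrite -PD' le_measure// inE.
  rewrite measureD//; last by rewrite -ge0_fin_numE// fin_num_measure.
  rewrite setIidr//; transitivity (1 - 1 : \bar R)%E; last by rewrite subee.
  by congr (_ - _)%E.
Qed.

End bounded_measurable.

(** * Continuation of the resolvent along the real axis *)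

Lemma geo_resolvent (K : fieldType) (s b : K) n : s != 0 -> s + b != 0 ->
  (s + b)^-1 - \sum_(k < n) (- b) ^+ k / s ^+ k.+1 = (s + b)^-1 * (- b / s) ^+ n.
Proof.
move=> s0 sb0; elim: n => [|n IH]; first by rewrite big_ord0 subr0 expr0 mulr1.
rewrite big_ord_recr /= opprD addrA IH exprMn exprVn [in RHS]exprS !exprMn exprVn.
rewrite [s ^+ n.+1]exprS; field.
by rewrite sb0 expf_neq0// s0.
Qed.

Section resolvent.
Context {R : realType} (mu : probability R R).
Implicit Types (D : set R) (a q : R).

Definition pos_set a : set R := [set x | 0 < x /\ 0 < x + a].

Lemma measurable_pos_set a : measurable (pos_set a).
Proof.
rewrite (_ : pos_set a = `]Num.max 0 (- a), +oo[%classic) //.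
apply/seteqP; split => x; rewrite /= in_itv /= andbT gt_max.
  by move=> [x0 xa]; rewrite x0 -subr_gt0 opprK.
by move=> /andP[x0 xa]; split => //; rewrite -(opprK a) subr_gt0.
Qed.
Hint Resolve measurable_pos_set : core.

(** Along the continuation [a] becomes negative, and the pole [- a] could meet the support. The
    first clause excludes this; it has to be carried along with the identity, and it later yields
    the lower bound on [Y]. *)
Definition resolvent_eq a q :=
  mu (pos_set a) = 1%E /\ \int[mu]_(x in pos_set a) (x / (x + a)) = q.

Lemma measurable_resolvent D a : measurable_fun D (fun x : R => x / (x + a)).
Proof.
apply: measurable_funM; first exact: measurable_id.
by apply: measurable_fun_inv; apply: measurable_funD.
Qed.

Lemma resolvent_full a D : measurable D -> D `<=` pos_set a -> mu D = 1%E ->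
  mu (pos_set a) = 1%E /\
  \int[mu]_(x in pos_set a) (x / (x + a)) = \int[mu]_(x in D) (x / (x + a)).
Proof.
move=> mD Da muD.
have muP : mu (pos_set a) = 1%E.
  apply/eqP; rewrite eq_le probability_le1//=.
  by rewrite -muD le_measure// inE.
split => //; congr fine.
rewrite (@ge0_negligible_integral _ _ _ mu (pos_set a) (pos_set a `\` D))//.
- by rewrite setDD setIidr.
- exact: measurableD.
- by apply/measurable_EFinP; exact: measurable_resolvent.
- by move=> x [x0 xa]; rewrite lee_fin divr_ge0// ltW.
- rewrite measureD//; last by rewrite -ge0_fin_numE// fin_num_measure.
  rewrite setIidr//; transitivity (1 - 1 : \bar R)%E; last by rewrite subee.
  by congr (_ - _)%E.
Qed.

Lemma resolvent_bound (x a d : R) : 0 < d -> d <= x + a -> 0 < x ->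
  x / (x + a) <= 1 + `|a| / d.
Proof.
move=> d0 dx x0; have xa : 0 < x + a by apply: lt_le_trans dx.
rewrite ler_pdivrMr// mulrDl mul1r -lerBlDl opprD addrA subrr sub0r.
apply: le_trans (ler_norm _) _; rewrite normrN mulrAC ler_pdivlMr//.
by rewrite ler_wpM2l.
Qed.

Definition moment D a k := \int[mu]_(x in D) (x / (x + a) ^+ k.+1).

Section moments.
Variables (D : set R) (a d : R).
Hypothesis mD : measurable D.
Hypothesis muD : mu D = 1%E.
Hypothesis d0 : 0 < d.
Hypothesis dD : forall x, D x -> 0 < x /\ d <= x + a.

Lemma bmeas_moment k : bmeas D (fun x => x / (x + a) ^+ k.+1).
Proof.
have -> : (fun x => x / (x + a) ^+ k.+1) =
  (fun x => (x / (x + a)) * ((x + a)^-1) ^+ k).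
  by apply/funext => x; rewrite exprS invfM exprVn mulrA.
apply: bmeasM.
  split; first exact: measurable_resolvent.
  exists (1 + `|a| / d) => x /dD[x0 dx]; rewrite ger0_norm; last first.
    by rewrite divr_ge0// ltW// (lt_le_trans d0).
  exact: resolvent_bound.
apply: bmeasX; apply: (bmeas_inv d0); first exact: measurable_funD.
by move=> x /dD[x0 dx]; apply: le_trans dx (ler_norm _).
Qed.

(** Neumann series of the resolvent around [a]. The kernel at [a + b] is controlled by [W]
    separately, so that the same bound serves positive [b] of any size and small [b] of any sign. *)
Lemma moment_expansion b (W : R) n : 0 <= W ->
  (forall x, D x -> 0 < x + a + b /\ x / (x + a + b) <= W) ->
  `|\int[mu]_(x in D) (x / (x + (a + b))) - \sum_(k < n) (- 1) ^+ k * moment D a k * b ^+ k|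
   <= W * (d^-1 * `|b|) ^+ n.
Proof.
move=> W0 DW.
have E x : D x -> x / (x + (a + b)) - \sum_(k < n) (- b) ^+ k * (x / (x + a) ^+ k.+1) =
   x / (x + a + b) * (- b / (x + a)) ^+ n.
  move=> Dx; have [x0 dx] := dD Dx; have [xb _] := DW x Dx.
  rewrite -mulrA -geo_resolvent; last 2 first.
  - by rewrite gt_eqF// (lt_le_trans d0).
  - by rewrite gt_eqF.
  rewrite mulrBr addrA mulr_sumr; congr (_ - _); apply: eq_bigr => k _; ring.
have b1 : bmeas D (fun x => x / (x + (a + b))).
  split; first exact: measurable_resolvent.
  exists W => x Dx; have [xb xW] := DW x Dx; have [x0 _] := dD Dx.
  by rewrite addrA ger0_norm// divr_ge0// ltW.
have b2 k : bmeas D (fun x => (- b) ^+ k * (x / (x + a) ^+ k.+1)).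
  exact: bmeasZ (bmeas_moment k).
have -> : \sum_(k < n) (- 1) ^+ k * moment D a k * b ^+ k =
    \int[mu]_(x in D) (\sum_(k < n) (- b) ^+ k * (x / (x + a) ^+ k.+1)).
  rewrite (bRintegral_sum (F := fun (k : nat) (x : R) => (- b) ^+ k * (x / (x + a) ^+ k.+1)))//.
  apply: eq_bigr => k _; rewrite bRintegral_Z//; last exact: bmeas_moment.
  by rewrite -/(moment D a k) [in RHS]exprNn; ring.
have b3 := bmeas_sum (F := fun (k : nat) (x : R) => (- b) ^+ k * (x / (x + a) ^+ k.+1))
  (fun k (_ : (k < n)%N) => b2 k).
rewrite -bRintegral_B//.
apply: bRintegral_norm => //; first by rewrite mulr_ge0// exprn_ge0// mulr_ge0// invr_ge0 ltW.
  by have [] := bmeasB b1 b3.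
move=> x Dx; rewrite E//; have [xb xW] := DW x Dx; have [x0 dx] := dD Dx.
have w0 : 0 <= x / (x + a + b) by rewrite divr_ge0// ltW.
rewrite normrM [X in X * _]ger0_norm// normrX normrM normrN.
have xa : 0 < x + a by apply: lt_le_trans dx.
apply: ler_pM => //.
rewrite lerXn2r ?nnegrE ?mulr_ge0 ?invr_ge0 ?(ltW d0) ?(ltW xa)//.
rewrite mulrC ler_wpM2r// normfV gtr0_norm// lef_pV2//.
Qed.

(* [x / s ^+ k.+1] are the moments of [s^-1] under the density [x / s], which is
   positive, so a geometric bound on them bounds [s^-1] almost surely. *)
Lemma moment_support (C K : R) : 0 < K -> (forall k, moment D a k <= C * K ^+ k) ->
  mu (D `&` [set x | (2 * K)^-1 <= x + a]) = 1%E.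
Proof.
move=> K0 MC.
pose B := [set x | (2 * K)^-1 <= x + a].
have mB : measurable B.
  rewrite (_ : B = `[(2 * K)^-1 - a, +oo[%classic)//.
  by apply/seteqP; split => x; rewrite /B /= in_itv /= andbT lerBlDr.
have mDB : measurable (D `\` B) by exact: measurableD.
have sDB : D `\` B `<=` D by move=> x [].
suff DB0 : mu (D `\` B) = 0%E.
  have -> : D `&` B = D `\` (D `\` B) by rewrite setDD.
  rewrite measureD//; last by rewrite -ge0_fin_numE// fin_num_measure.
  rewrite setIidr//; transitivity (1 - 0 : \bar R)%E; last by rewrite sube0.
  by congr (_ - _)%E.
have K20 : 0 < 2 * K by rewrite mulr_gt0.
have w0 k x : (D `\` B) x -> 0 <= x / (x + a) ^+ k.+1.
  by move=> [/dD[x0 dx] _]; rewrite divr_ge0 ?exprn_ge0 ?ltW// (lt_le_trans d0).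
(* Outside [B] the factor [(x + a)^-1] exceeds [2 * K], so [(2 * K) ^+ n] times this integral is at
   most the n-th moment, hence at most [C * K ^+ n]. *)
have I0 : \int[mu]_(x in D `\` B) (x / (x + a) ^+ 1) = 0.
  apply/eqP; rewrite eq_le Rintegral_ge0; last by move=> x; exact: w0.
  rewrite andbT leNgt; apply/negP => I0.
  have [n Cn] := exists_geo_lt C I0.
  suff : \int[mu]_(x in D `\` B) (x / (x + a) ^+ 1) <= C * 2^-1 ^+ n by rewrite leNgt Cn.
  have -> : C * 2^-1 ^+ n = (C * K ^+ n) * ((2 * K)^-1) ^+ n.
    by rewrite invfM exprMn -!mulrA; congr (_ * _); rewrite [RHS]mulrCA -exprMn divff ?expr1n ?mulr1// gt_eqF.
  rewrite -ler_pdivrMr ?exprn_gt0 ?invr_gt0//.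
  apply: le_trans (MC n); rewrite mulrC -bRintegral_Z//; last first.
    by apply: bmeas_sub sDB _ => //; exact: bmeas_moment.
  apply: (@le_trans _ _ (\int[mu]_(x in D `\` B) (x / (x + a) ^+ n.+1))).
    apply: bRintegral_le => //.
    - by apply: bmeasZ; apply: bmeas_sub sDB _ => //; exact: bmeas_moment.
    - by apply: bmeas_sub sDB _ => //; exact: bmeas_moment.
    - move=> x [Dx Bx]; have [x0 dx] := dD Dx.
      have xa : 0 < x + a by apply: lt_le_trans dx.
      have -> : x / (x + a) ^+ n.+1 = ((x + a)^-1) ^+ n * (x / (x + a) ^+ 1).
        by rewrite exprS expr1 exprVn; field; rewrite expf_neq0 gt_eqF.
      rewrite exprVn invrK ler_wpM2r ?w0// lerXn2r ?nnegrE ?invr_ge0 ?(ltW xa) ?(ltW K20)//.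
      rewrite -[leLHS]invrK lef_pV2 ?posrE ?invr_gt0//.
      by apply/ltW; rewrite ltNge; apply/negP.
  apply: fine_le.
  - by apply: integrable_fin_num => //; apply: bmeas_integrable => //; apply: bmeas_sub sDB _ => //; exact: bmeas_moment.
  - by apply: integrable_fin_num => //; apply: bmeas_integrable => //; exact: bmeas_moment.
  - apply: ge0_subset_integral => //.
      by apply/measurable_EFinP; have [] := bmeas_moment n.
    by move=> x /dD[x0 dx]; rewrite lee_fin divr_ge0 ?exprn_ge0 ?ltW// (lt_le_trans d0).
have w1 x : (D `\` B) x -> 0 < x / (x + a) ^+ 1.
  by move=> [/dD[x0 dx] _]; rewrite expr1 divr_gt0// (lt_le_trans d0).
have bw : bmeas (D `\` B) (fun x => x / (x + a) ^+ 1).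
  by apply: bmeas_sub sDB _ => //; exact: bmeas_moment.
have mw : measurable_fun (D `\` B) (EFin \o (fun x : R => x / (x + a) ^+ 1)).
  by apply/measurable_EFinP; have [] := bw.
have iw0 : (\int[mu]_(x in D `\` B) abse ((x / (x + a) ^+ 1)%:E))%E = 0%E.
  transitivity (\int[mu]_(x in D `\` B) (x / (x + a) ^+ 1)%:E)%E.
    by apply: eq_integral => x; rewrite inE => xDB; rewrite /= ger0_norm ?w0.
  have /fineK <- := integrable_fin_num mDB (bmeas_integrable (P := mu) mDB bw).
  by congr (_%:E).
have [Z [mZ Z0 sZ]] := proj1 (@ae_eq_integral_abs _ _ _ mu _ mDB _ mw) iw0.
apply/eqP; rewrite -measure_le0 -Z0 le_measure ?inE//.
move=> x DBx; apply: sZ => /= H; have := w1 x DBx.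
by have [->] := H DBx; rewrite ltxx.
Qed.
End moments.
End resolvent.

Lemma eq_of_geo (R : realType) (x y C : R) : 
  (forall n, `|x - y| <= C * 2^-1 ^+ n) -> x = y.
Proof.
move=> H; apply/eqP; rewrite -subr_eq0 -normr_le0 leNgt; apply/negP => e0.
have [n Cn] := exists_geo_lt C e0.
by have := H n; rewrite leNgt Cn.
Qed.

Section real_step.
Context {R : realType} (mu : probability R R) (A : R -> R).
Local Notation gexpR := (gexp (N := fun x : R => `|x|) setT).

(** Two expansions of one function in powers of [A (t1 + h) - A t1] have the same coefficients: this
    is [vitali_coef] for a constant family and the zero function. Points [h < 0] are taken because
    the increment of [A] is then nonnegative, so the kernel at [A (t1 + h)] is dominated by the one
    at [A t1]. *)
Lemma moment_coefE (D : set R) t1 (kappa : R -> R) k a C C' M L d eta : 0 <= M -> 0 <= L ->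
  measurable D -> mu D = 1%E -> 0 < d ->
  (forall x, D x -> 0 < x /\ d <= x + A t1) ->
  gexpR kappa k C' M -> gexpR (fun h => expR (t1 + h)) a C (2 * M) ->
  (forall h, h != 0 -> 2 * M * `|h| <= 1 -> kappa h * (A (t1 + h) - A t1) = h) ->
  (forall h, 2 * M * `|h| <= 1 -> `|A (t1 + h) - A t1| <= L * `|h|) ->
  0 < eta ->
  (forall h, - eta < h < 0 ->
     0 <= A (t1 + h) - A t1 /\ \int[mu]_(x in D) (x / (x + A (t1 + h))) = expR (t1 + h)) ->
  forall m : nat -> R,
  (forall n, `|m n| <= C * (3 * C' * (2 * M)) ^+ n) ->
  (forall h n, h != 0 -> 2 * M * `|h| <= 1 ->
    `|expR (t1 + h) - \sum_(k < n) m k * (A (t1 + h) - A t1) ^+ k| <=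
    C * ((3 * C' * (2 * M)) * `|A (t1 + h) - A t1|) ^+ n) ->
  forall n, (-1) ^+ n * moment mu D (A t1) n = m n.
Proof.
move=> M0 L0 mD muD d0 dD kC NC kb bL eta0 hE m mC mE n.
have absR := absolute_value_norm R.
have C'0 := gexp_ge0 absR kC; have C0 := gexp_ge0 absR NC.
set K := 3 * C' * (2 * M); have K0 : 0 <= K by rewrite !mulr_ge0.
set W := 1 + `|A t1| / d; have W0 : 0 <= W by rewrite addr_ge0// divr_ge0// ltW.
have di0 : 0 <= d^-1 by rewrite invr_ge0 ltW.
pose M' := K + d^-1; have M'0 : 0 <= M' by rewrite addr_ge0.
have KM n' x : 0 <= x -> (K * x) ^+ n' <= (M' * x) ^+ n'.
  by move=> x0; rewrite lerXn2r ?nnegrE ?mulr_ge0// ler_wpM2r// lerDl.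
have dM n' x : 0 <= x -> (d^-1 * x) ^+ n' <= (M' * x) ^+ n'.
  by move=> x0; rewrite lerXn2r ?nnegrE ?mulr_ge0// ler_wpM2r// lerDr.
pose beta h := A (t1 + h) - A t1.
pose u n := (-1) ^+ n * moment mu D (A t1) n - m n.
pose Dp := [set h : R | - eta < h < 0 /\ 2 * M * `|h| <= 1].
suff : forall e, 0 < e -> \forall t \near \oo, `|u n| < e.
  move=> H; apply/eqP; rewrite -subr_eq0 -normr_le0 leNgt; apply/negP => e0.
  by have [t] := filter_ex (H _ e0); rewrite ltxx.
move=> e e0.
apply: (@vitali_coef R R (fun x => `|x|) absR nat R \oo _ beta (fun _ => u) (fun _ _ => 0)
  Dp (W + C) M') => //.
- by rewrite addr_ge0.
- apply: nearW => _ h n' [/[dup] hn /andP[_ h0] Mh] _; have [b0 iE] := hE h hn => /=.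
  have hne : h != 0 by rewrite lt_eqF.
  have -> : 0 - \sum_(k0 < n') u k0 * beta h ^+ k0 =
    (\int[mu]_(x in D) (x / (x + A (t1 + h)))
      - \sum_(k < n') (- 1) ^+ k * moment mu D (A t1) k * beta h ^+ k) -
    (expR (t1 + h) - \sum_(k < n') m k * beta h ^+ k).
    rewrite iE /u; under eq_bigr do rewrite mulrBl.
    by rewrite sumrB; ring.
  rewrite mulrDl; apply: le_trans (ler_normB _ _) _; apply: lerD; last first.
    apply: le_trans (mE h n' hne Mh) _; rewrite ler_wpM2l//; exact: KM.
  have -> : A (t1 + h) = A t1 + beta h by rewrite /beta; ring.
  apply: le_trans (@moment_expansion R mu D (A t1) d mD d0 dD (beta h) W n' W0 _) _.
    move=> x Dx; have [x0 dx] := dD x Dx; split.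
      by rewrite ltr_wpDr// (lt_le_trans d0).
    apply: le_trans (resolvent_bound d0 dx x0).
    rewrite ler_wpM2l ?(ltW x0)// lef_pV2 ?posrE; first by rewrite lerDl.
      by rewrite ltr_wpDr// (lt_le_trans d0).
    by rewrite (lt_le_trans d0).
  by rewrite ler_wpM2l//; apply: dM.
- move=> d' d'0; have L1 : 0 < L + 1 by rewrite ltr_wpDl.
  have M1 : 0 < 2 * M + 1 by rewrite ltr_wpDl// mulr_ge0.
  pose r := Num.min (eta / 2) (Num.min (2 * M + 1)^-1 (d' / (L + 1) / 2)).
  have r0 : 0 < r by rewrite !lt_min invr_gt0 M1 !divr_gt0.
  have r1 : r <= eta / 2 by rewrite ge_min lexx.
  have r2 : r <= (2 * M + 1)^-1 by rewrite !ge_min lexx orbT.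
  have r3 : r <= d' / (L + 1) / 2 by rewrite !ge_min lexx !orbT.
  have Mr : 2 * M * `|- r| <= 1.
    rewrite normrN gtr0_norm//; apply: (@le_trans _ _ ((2 * M + 1) * (2 * M + 1)^-1)).
      by apply: ler_pM => //; rewrite ?mulr_ge0// ?(ltW r0)// lerDl.
    by rewrite divff// gt_eqF.
  have rne : - r != 0 by rewrite oppr_eq0 gt_eqF.
  exists (- r); split.
  + by split => //; apply/andP; split; lra.
  + apply/negP => /eqP b0; have := kb (- r) rne Mr.
    by rewrite -/(beta _) b0 mulr0 => /esym/eqP; rewrite (negbTE rne).
  + apply: le_lt_trans (bL _ Mr) _; rewrite normrN gtr0_norm//.
    apply: (@le_lt_trans _ _ ((L + 1) * (d' / (L + 1) / 2))).
      by apply: ler_pM => //; rewrite ?(ltW r0)// lerDl.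
    have -> : (L + 1) * (d' / (L + 1) / 2) = d' / 2 by field; rewrite gt_eqF.
    by rewrite ltr_pdivrMr// ltr_pMr// ltr1n.
  + by move=> e' e'0; apply: nearW => _; rewrite normr0.
Qed.

(** The neighbourhood of [t1] where the identity is known may be arbitrarily small: it only serves
    to identify the moments. Their growth rate is dictated by the expansions of [expR] and [kappa],
    so [delta] depends on [C], [C'], [M] and [L] alone and the step can be iterated. *)
Lemma resolvent_step (C C' M L : R) : 0 <= C -> 0 <= C' -> 0 <= M -> 0 <= L ->
  exists2 delta, 0 < delta & forall t1 (kappa : R -> R) k a eta,
  gexpR kappa k C' M -> gexpR (fun h => expR (t1 + h)) a C (2 * M) ->
  (forall h, h != 0 -> 2 * M * `|h| <= 1 -> kappa h * (A (t1 + h) - A t1) = h) ->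
  (forall h, 2 * M * `|h| <= 1 -> `|A (t1 + h) - A t1| <= L * `|h|) ->
  0 < eta ->
  (forall t, t1 - eta < t < t1 + eta -> resolvent_eq mu (A t) (expR t)) ->
  (forall x y, t1 - eta < x -> x < y -> y < t1 + eta -> A y < A x) ->
  forall h, 0 <= h <= delta -> resolvent_eq mu (A (t1 + h)) (expR (t1 + h)).
Proof.
move=> C0 C'0 M0 L0.
set K := 3 * C' * (2 * M); have K0 : 0 <= K by rewrite !mulr_ge0.
pose K1 := K + 1; have K10 : 0 < K1 by rewrite ltr_wpDl.
have M1 : 0 < 2 * M + 1 by rewrite ltr_wpDl// mulr_ge0.
have L1 : 0 < L + 1 by rewrite ltr_wpDl.
(* The first bound keeps [h] in the domain of the expansions; the second gives
   [K1 * |A (t1 + h) - A t1| <= 1 / 4], so the increment is at most half of the margin [(2 * K1)^-1]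
   obtained below. *)
exists (Num.min (2 * M + 1)^-1 (4 * K1 * (L + 1))^-1).
  by rewrite lt_min !invr_gt0 M1 !mulr_gt0.
move=> t1 kappa k a eta kC NC kb bL eta0 hE Adec h; rewrite le_min => /andP[h0 /andP[hM hL]].
have absR := absolute_value_norm R.
have [->|hne] := eqVneq h 0.
  by rewrite addr0; apply: hE; rewrite ltrBlDr ltrDl eta0.
have hgt : 0 < h by rewrite lt_neqAle eq_sym hne.
have kb' (h' : R) : setT h' -> h' != 0 -> 2 * M * `|h'| <= 1 -> kappa h' * (A (t1 + h') - A t1) = h'.
  by move=> _; exact: kb.
have [m [mC mE]] := gexp_reparam absR M0 kb' kC NC.
have e2 : 0 < eta / 2 by rewrite divr_gt0.
(* The identity is known a little to the right of [t1], where [A] is smaller; this leaves a first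
   margin [d > 0] between the pole at [t1] and the support. *)
pose D := pos_set (A (t1 + eta / 2)).
pose d := A t1 - A (t1 + eta / 2).
have d0 : 0 < d by rewrite subr_gt0; apply: Adec; lra.
have mD : measurable D := measurable_pos_set _.
have [muD _] : resolvent_eq mu (A (t1 + eta / 2)) (expR (t1 + eta / 2)) by apply: hE; lra.
have dD x : D x -> 0 < x /\ d <= x + A t1.
  by move=> [x0 xa]; split => //; rewrite /d; lra.
have coefE := @moment_coefE D t1 kappa k a C C' M L d eta M0 L0 mD muD d0 dD kC NC kb bL eta0
  _ m mC (fun h n => mE h n I).
have {}coefE : forall n, (-1) ^+ n * moment mu D (A t1) n = m n.
  apply: coefE => h' /andP[h1 h2]; split.
    by rewrite subr_ge0 ltW//; apply: Adec; lra.
  have [_ <-] : resolvent_eq mu (A (t1 + h')) (expR (t1 + h')) by apply: hE; lra.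
  have DP : D `<=` pos_set (A (t1 + h')).
    move=> x [x0 xa]; split=> //.
    have : A (t1 + eta / 2) < A (t1 + h') by apply: Adec; lra.
    lra.
  by have [_ ->] := resolvent_full mD DP muD.
have MC n : moment mu D (A t1) n <= C * K1 ^+ n.
  apply: le_trans (ler_norm _) _.
  have -> : `|moment mu D (A t1) n| = `|m n|.
    by rewrite -coefE normrM normrX normrN1 expr1n mul1r.
  apply: le_trans (mC n) _; rewrite ler_wpM2l// lerXn2r ?nnegrE ?(ltW K10)//.
  by rewrite lerDl.
(* The margin [d] depends on [eta]; the growth of the moments replaces it almost surely by
   [(2 * K1)^-1], which does not. *)
have := moment_support mD muD d0 dD K10 MC.
set B := [set x | _]; set D' := D `&` B => muD'.
have mB : measurable B.
  rewrite (_ : B = `[(2 * K1)^-1 - A t1, +oo[%classic)//.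
  by apply/seteqP; split => x; rewrite /B /= in_itv /= andbT lerBlDr.
have mD' : measurable D' by exact: measurableI.
pose d' := (2 * K1)^-1; have d'0 : 0 < d' by rewrite invr_gt0 mulr_gt0.
have dD' x : D' x -> 0 < x /\ d' <= x + A t1 by move=> [[x0 _] Bx].
pose b := A (t1 + h) - A t1.
have Mh : 2 * M * `|h| <= 1.
  rewrite gtr0_norm//; apply: (@le_trans _ _ ((2 * M + 1) * (2 * M + 1)^-1)).
    by apply: ler_pM => //; rewrite ?mulr_ge0// lerDl.
  by rewrite divff// gt_eqF.
have bK : K1 * `|b| <= 4^-1.
  apply: (@le_trans _ _ (K1 * ((L + 1) * (4 * K1 * (L + 1))^-1))).
    rewrite ler_wpM2l ?(ltW K10)//; apply: le_trans (bL h Mh) _; rewrite gtr0_norm//.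
    by apply: ler_pM => //; rewrite lerDl.
  by apply: le_of_eq; field; rewrite !gt_eqF.
have b2 : `|b| <= d' / 2.
  have -> : d' / 2 = 4^-1 / K1 by rewrite /d'; field; rewrite gt_eqF.
  by rewrite ler_pdivlMr// mulrC.
have xb x : D' x -> d' / 2 <= x + A t1 + b.
  by move=> /dD'[_ dx]; move: b2; rewrite ler_norml => /andP[b3 _]; lra.
have DP : D' `<=` pos_set (A (t1 + h)).
  move=> x D'x; split; first by have [] := dD' x D'x.
  have -> : x + A (t1 + h) = x + A t1 + b by rewrite /b; ring.
  by apply: lt_le_trans (xb x D'x); rewrite divr_gt0.
have [mu1 iE] := resolvent_full mD' DP muD'.
split => //; rewrite iE.
pose W := 2 * (1 + `|A t1| / d').
have W0 : 0 <= W by rewrite mulr_ge0// addr_ge0// divr_ge0// ltW.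
apply: (@eq_of_geo R _ _ (W + C)) => n.
have momE k' : moment mu D' (A t1) k' = moment mu D (A t1) k'.
  rewrite /moment -(bRintegral_subset mD mD' _ muD') //; first by move=> x [].
  exact: bmeas_moment dD _.
have Wn := @moment_expansion R mu D' (A t1) d' mD' d'0 dD' b W n W0 _.
rewrite -/b (_ : A t1 + b = A (t1 + h)) in Wn; last by rewrite /b; ring.
have {}Wn : `|\int[mu]_(x in D') (x / (x + A (t1 + h))) -
        \sum_(k < n) m k * b ^+ k| <= W * (d'^-1 * `|b|) ^+ n.
  under [X in _ - X]eq_bigr do rewrite -coefE -momE.
  apply: Wn => x D'x; have [x0 dx] := dD' x D'x; have xbx := xb x D'x.
  have xa0 : 0 < x + A t1 by apply: lt_le_trans dx.
  have xb0 : 0 < x + A t1 + b by apply: lt_le_trans xbx; rewrite divr_gt0.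
  split=> //; apply: (@le_trans _ _ (2 * (x / (x + A t1)))); last first.
    by rewrite /W ler_wpM2l//; exact: resolvent_bound.
  rewrite ler_pdivrMr//; have -> : 2 * (x / (x + A t1)) * (x + A t1 + b) =
     x * (2 * (1 + b / (x + A t1))) by field; rewrite gt_eqF.
  rewrite -[leLHS]mulr1 ler_wpM2l ?(ltW x0)//.
  suff : - 2^-1 <= b / (x + A t1) by lra.
  rewrite ler_pdivlMr//; move: b2; rewrite ler_norml => /andP[b3 _]; lra.
have En := mE h n I hne Mh; rewrite -/b in En.
rewrite mulrDl; apply: le_trans (ler_distD (\sum_(k < n) m k * b ^+ k) _ _) _.
apply: lerD.
  apply: le_trans Wn _; rewrite ler_wpM2l//.
  have di0 : 0 <= d'^-1 by rewrite invr_ge0 ltW.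
  have H : d'^-1 * `|b| <= 2^-1 by rewrite [leLHS]mulrC ler_pdivrMr// mulrC.
  apply: lerXn2r => //; rewrite nnegrE; first exact: mulr_ge0.
  by apply: le_trans H; exact: mulr_ge0.
rewrite distrC; apply: le_trans En _; rewrite ler_wpM2l//.
have H : K * `|b| <= 2^-1.
  apply: (@le_trans _ _ (K1 * `|b|)); first by rewrite ler_wpM2r// lerDl.
  by apply: le_trans bK _; rewrite lef_pV2 ?posrE// ler_nat.
apply: lerXn2r => //; rewrite nnegrE; first exact: mulr_ge0.
by apply: le_trans H; exact: mulr_ge0.
Qed.

End real_step.

(** * Expansions with constants uniform in the centre *)

Section uniform_expansion.
Context {R : realType}.
Implicit Types (I : set R) (f g k : R -> R).
Local Notation gexpR := (gexp (N := fun x : R => `|x|) setT).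
Let absR := absolute_value_norm R.

(** Quantitative real analyticity: one pair of constants for all centres in [I], which is what gives
    continuation steps of constant length. As [gexp] ignores [h = 0], the value at the centre is
    recorded in [a 0]. *)
Definition uexp I f := exists C M, [/\ 0 <= C, 0 <= M & forall t, I t ->
  exists2 a, a 0%N = f t & gexpR (fun h => f (t + h)) a C M].

Lemma uexp_weak I f : uexp I f -> exists C M, [/\ 0 <= C, 0 <= M & forall C' M',
  C <= C' -> M <= M' -> forall t, I t ->
  exists2 a, a 0%N = f t & gexpR (fun h => f (t + h)) a C' M'].
Proof.
move=> [C [M [C0 M0 H]]]; exists C, M; split => // C' M' CC MM t It.
have [a a0 fa] := H t It; exists a => //.
by apply: (gexp_weak absR _ CC fa); rewrite M0.
Qed.

Lemma uexp_cst I c : uexp I (fun=> c).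
Proof.
exists `|c|, 0; split => // t _.
by exists (fun n => if n == 0%N then c else 0) => //; exact: gexp_const.
Qed.

Lemma uexpD I f g : uexp I f -> uexp I g -> uexp I (fun x => f x + g x).
Proof.
move=> /uexp_weak[C [M [C0 M0 H]]] /uexp_weak[C' [M' [C'0 M'0 H']]].
exists (C + C'), (Num.max M M'); split; rewrite ?addr_ge0 ?le_max ?M0// => t It.
have MM : M <= Num.max M M' by rewrite le_max lexx.
have MM' : M' <= Num.max M M' by rewrite le_max lexx orbT.
have [a a0 fa] := H _ _ (lexx C) MM t It.
have [b b0 gb] := H' _ _ (lexx C') MM' t It.
exists (fun n => a n + b n); first by rewrite a0 b0.
exact: gexpD.
Qed.

Lemma uexpM I f g : uexp I f -> uexp I g -> uexp I (fun x => f x * g x).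
Proof.
move=> /uexp_weak[C [M [C0 M0 H]]] /uexp_weak[C' [M' [C'0 M'0 H']]].
pose M1 := Num.max M M'.
have MM : M <= M1 by rewrite le_max lexx.
have M10 : 0 <= M1 by apply: le_trans MM.
have MM' : M' <= 2 * M1.
  by apply: (@le_trans _ _ M1); [rewrite le_max lexx orbT|rewrite ler_peMl// ler1n].
exists (3 * (C * C')), (2 * M1); split; rewrite ?mulr_ge0// => t It.
have [a a0 fa] := H _ _ (lexx C) MM t It.
have [b b0 gb] := H' _ _ (lexx C') MM' t It.
exists (cauchy_prod a b); last exact: gexpM.
by rewrite /cauchy_prod big_ord1 a0 b0.
Qed.

Lemma uexpZ I f c : uexp I f -> uexp I (fun x => c * f x).
Proof. by apply: uexpM; exact: uexp_cst. Qed.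

Lemma uexp_sum I (J : Type) (r : seq J) (F : J -> R -> R) :
  (forall j, uexp I (F j)) -> uexp I (fun x => \sum_(j <- r) F j x).
Proof.
move=> H; elim: r => [|j r IH].
  by under eq_fun do rewrite big_nil; exact: uexp_cst.
by under eq_fun do rewrite big_cons; exact: uexpD.
Qed.

Lemma is_derive_shift f (t h : R) df : is_derive (t + h) 1 f df ->
  is_derive h 1 (fun h => f (t + h)) df.
Proof.
move=> fd.
have sd : is_derive h 1 (fun h : R => t + h) 1.
  have := is_deriveD (is_derive_cst t h 1) (is_derive_id h 1).
  by rewrite add0r.
by have := is_derive1_comp (f := f) (g := fun h : R => t + h); move=> /(_ h _ _ fd sd); rewrite mulr1.
Qed.

Lemma uexp_ode (l u : R) f k : (forall x : R, is_derive x 1 f (k x * f x)) ->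
  uexp `[l, u] k -> uexp `[l, u] f.
Proof.
move=> fd /uexp_weak[C [M [C0 M0 H]]].
have [lu|ul] := leP l u; last first.
  exists 0, 0; split=> // t /=; rewrite in_itv /= => /andP[lt tu].
  by have := le_trans lt tu; rewrite leNgt ul.
have lu1 : l - 1 <= u + 1 by lra.
have fcont : {within `[l - 1, u + 1], continuous (fun x => `|f x|)}.
  apply: continuous_subspaceT => x; apply: continuous_comp; last exact: norm_continuous.
  by apply/differentiable_continuous/derivable1_diffP; case: (fd x).
have [c _ cmax] := EVT_max lu1 fcont.
(* The entry 1 keeps [t + h] within distance 1 of [[l, u]], where [f c] bounds [f]; the entry
   [3 * C] meets the rate condition of [gexp_ode]. *)
pose M1 := Num.max 1 (Num.max M (3 * C)).
have M11 : 1 <= M1 by rewrite le_max lexx.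
have MM : M <= M1 by rewrite !le_max lexx orbT.
have CM : 3 * C <= M1 by rewrite !le_max lexx !orbT.
have M10 : 0 <= M1 by apply: le_trans M11.
exists `|f c|, (2 * M1); split; rewrite ?mulr_ge0// => t It.
have [b b0 kb] := H _ _ (lexx C) MM t It.
have [| | |a [a0 fa]] := @gexp_ode R (fun h => f (t + h)) (fun h => k (t + h)) b `|f c| C M1 M10 _ kb.
- by apply: le_trans CM _; rewrite ler_peMl// ler1n.
- by move=> x _; exact: is_derive_shift.
- move=> x Mx; apply: cmax; move: It; rewrite /= !in_itv /= => /andP[lt tu].
  have : `|x| <= 1.
    apply: le_trans Mx; rewrite ler_peMl//.
    by apply: le_trans M11 _; rewrite ler_peMl// ler1n.
  by rewrite ler_norml => /andP[x1 x2]; lra.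
by exists a => //; rewrite a0 addr0.
Qed.

Lemma uexp_expR (l u c : R) : uexp `[l, u] (fun x => expR (c * x)).
Proof.
have H := @uexp_ode l u (fun x => expR (c * x)) (fun=> c).
apply: H; last exact: uexp_cst.
move=> x; have := is_derive1_comp (f := expR) (g := fun x : R => c * x).
have cd : is_derive x 1 (fun x : R => c * x) c.
  by have := is_deriveZ c (is_derive_id x 1); rewrite /GRing.scale /= mulr1.
by move=> /(_ x _ _ (is_derive_expR _) cd); rewrite mulrC.
Qed.

Lemma uexp_exp (l u : R) : uexp `[l, u] (@expR R).
Proof.
have -> : @expR R = (fun x => expR (1 * x)) by apply/funext => x; rewrite mul1r.
exact: uexp_expR.
Qed.

(** The coefficient [a 0] is the limit of [f] at 0. Applied to a difference quotient, this bounds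
    the derivative from below by the slopes. *)
Lemma gexp_lbound (f : R -> R) a C M (m d : R) : 0 < d -> 0 <= M -> gexpR f a C M ->
  (forall h, h != 0 -> `|h| <= d -> m <= `|f h|) -> m <= `|a 0%N|.
Proof.
move=> d0 M0 fa fm; rewrite leNgt; apply/negP => am.
have C0 := gexp_ge0 absR fa.
pose e := m - `|a 0%N|; have e0 : 0 < e by rewrite subr_gt0.
have M1 : 0 < M + 1 by rewrite ltr_wpDl.
have C1 : 0 < C * M + 1 by rewrite ltr_wpDl// mulr_ge0.
pose h := Num.min d (Num.min (M + 1)^-1 (e / (C * M + 1) / 2)).
have h0 : 0 < h by rewrite !lt_min d0 invr_gt0 M1 !divr_gt0.
have hd : h <= d by rewrite ge_min lexx.
have hM : h <= (M + 1)^-1 by rewrite !ge_min lexx orbT.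
have he : h <= e / (C * M + 1) / 2 by rewrite !ge_min lexx !orbT.
have hne : h != 0 by rewrite gt_eqF.
have Mh : M * `|h| <= 1.
  rewrite gtr0_norm//; apply: (@le_trans _ _ ((M + 1) * (M + 1)^-1)).
    by apply: ler_pM => //; rewrite ?(ltW h0)// lerDl.
  by rewrite divff// gt_eqF.
have hh : `|h| = h by rewrite gtr0_norm.
have := gexp_near0 fa I hne Mh; rewrite hh => fh.
have := fm h hne; rewrite hh => /(_ hd) mf.
have : `|f h| <= `|f h - a 0%N| + `|a 0%N| by rewrite -{1}(subrK (a 0%N) (f h)) ler_normD.
have : C * (M * h) <= e / 2.
  apply: (@le_trans _ _ ((C * M + 1) * (e / (C * M + 1) / 2))).
    by rewrite [leLHS]mulrA; apply: (ler_pM (mulr_ge0 C0 M0) (ltW h0) _ he); rewrite lerDl.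
  by apply: le_of_eq; field; rewrite gt_eqF.
rewrite /e in e0 *; lra.
Qed.

End uniform_expansion.

Section continuation.
Context {R : realType} (mu : probability R R) (A : R -> R) (te : R).
Hypothesis Adec : forall u, u < te -> exists2 m, 0 < m &
  forall x y, x < y -> y <= u -> m * (y - x) <= A x - A y.
Hypothesis Aexp : forall l u, uexp `[l, u] A.
Let absR := absolute_value_norm R.

Lemma resolvent_continuation t0 :
  (forall t, t < t0 -> resolvent_eq mu (A t) (expR t)) ->
  forall t, t < te -> resolvent_eq mu (A t) (expR t).
Proof.
move=> base ts ste.
have [/base//|t0s] := ltP ts t0.
pose u := (ts + te) / 2; have ute : u < te by rewrite /u; lra.
have tsu : ts < u by rewrite /u; lra.
have [m m0 Am] := Adec ute.
have [C0 [M0 [C00 M00 HA]]] := uexp_weak (Aexp (t0 - 1) ts).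
have [C1 [M1 [C10 M10 HE]]] := uexp_weak (uexp_exp (t0 - 1) ts).
pose M2 := 2 * M0 * (1 + C0 * M0 / m).
have M20 : 0 <= M2 by rewrite !mulr_ge0// addr_ge0// divr_ge0 ?mulr_ge0// ltW.
pose M := Num.max M2 (Num.max M1 M0).
have M2M : M2 <= M by rewrite le_max lexx.
have M1M : M1 <= M by rewrite !le_max lexx orbT.
have M0M : M0 <= M by rewrite !le_max lexx !orbT.
have MM0 : 0 <= M by apply: le_trans M2M.
have M2' : M <= 2 * M by rewrite ler_peMl// ler1n.
have m2 : 0 <= 2 / m by rewrite divr_ge0// ltW.
have [de de0 step] := @resolvent_step R mu A C1 (2 / m) M (C0 * M0) C10 m2 MM0 (mulr_ge0 C00 M00).
pose d := Num.min de 1; have d0 : 0 < d by rewrite lt_min de0 ltr01.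
have dde : d <= de by rewrite ge_min lexx.
have d1 : d <= 1 by rewrite ge_min lexx orbT.
suff main n t : t <= ts -> t < t0 + n%:R * (d / 2) -> resolvent_eq mu (A t) (expR t).
  have d20 : 0 < d / 2 by rewrite divr_gt0.
  have q0 : 0 <= (ts - t0 + 1) / (d / 2) by rewrite divr_ge0 ?(ltW d20)//; lra.
  have := archi_boundP q0; rewrite ltr_pdivrMr// => H.
  apply: (main (Num.bound ((ts - t0 + 1) / (d / 2))) ts (lexx ts)).
  by move: H; set X := _%:R * _; lra.
elim: n t => [|n IH] t tts; first by rewrite mul0r addr0; exact: base.
rewrite -natr1 mulrDl mul1r => tlt.
have [/IH|tge] := ltP t (t0 + n%:R * (d / 2)); first exact.
(* The centre lies far enough behind [t] for its neighbourhood of radius [d / 8] to be covered by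
   the induction hypothesis, while [t] stays within the reach [d] of one step. *)
pose t1 := t - 3 / 4 * d.
have nd : 0 <= n%:R * (d / 2) by rewrite mulr_ge0// divr_ge0// ltW.
have It1 : `[t0 - 1, ts]%classic t1 by rewrite /= in_itv /= /t1; apply/andP; split; lra.
have [a a0 Aa] := HA _ _ (lexx C0) (lexx M0) t1 It1.
have [e _ Ee] := HE _ _ (lexx C1) (le_trans M1M M2') t1 It1.
(* The slope bound [m] passes to the leading coefficient of the difference quotient of [A]; its
   inverse, the [kappa] of [resolvent_step], then expands with constants independent of [t1]. *)
have sa := gexp_shift absR M00 Aa.
have ma1 : m <= `|a 1%N|.
  apply: (gexp_lbound (d := u - ts) _ M00 sa); first by rewrite subr_gt0.
  move=> h h0 hu; rewrite a0 normrM normfV ler_pdivlMr ?normr_gt0//.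
  have [hlt|hgt|he] := ltgtP h 0; last by rewrite he eqxx in h0.
  - have := Am (t1 + h) t1; rewrite opprD addrA subrr sub0r gtrDl => /(_ hlt).
    rewrite (ltr0_norm hlt) => H; apply: le_trans (ler_norm _); apply: H.
    by rewrite /t1; lra.
  - have E : t1 + h - t1 = h by ring.
    have := Am t1 (t1 + h); rewrite E ltrDl => /(_ hgt).
    rewrite (gtr0_norm hgt) distrC => H; apply: le_trans (ler_norm _); apply: H.
    by move: hu; rewrite (gtr0_norm hgt) /t1; lra.
have [fm [k kE]] := gexp_inv absR M00 m0 ma1 sa.
have {}kE := gexp_weak absR (M' := M) (C' := 2 / m) _ (lexx _) kE.
have -> : t = t1 + 3 / 4 * d by rewrite /t1 subrK.
apply: (step t1 (fun h => ((A (t1 + h) - a 0%N) / h)^-1) k e (d / 8)) => //.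
- by apply: kE; rewrite M20.
- move=> h h0 Mh; rewrite a0.
  have : m / 2 <= `|(A (t1 + h) - a 0%N) / h|.
    apply: fm => //; apply: le_trans Mh; rewrite ler_wpM2r//.
    exact: le_trans M2M M2'.
  rewrite a0; have [->|b0 _] := eqVneq (A (t1 + h) - A t1) 0.
    by rewrite mul0r normr0 leNgt divr_gt0.
  by field; rewrite b0 h0.
- move=> h Mh; have [->|h0] := eqVneq h 0.
    by rewrite addr0 subrr normr0 mulr0.
  rewrite -a0 -mulrA; apply: (gexp_near0 Aa) => //.
  apply: le_trans Mh; rewrite ler_wpM2r//; exact: le_trans M0M M2'.
- by rewrite divr_gt0.
- by move=> t' /andP[t1' t2']; apply: IH; rewrite /t1 in t1' t2'; lra.
- move=> x y x1 xy y1; have : m * (y - x) <= A x - A y.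
    by apply: Am => //; rewrite /t1 in y1; lra.
  have : 0 < m * (y - x) by rewrite mulr_gt0// subr_gt0.
  lra.
- by apply/andP; split; lra.
Qed.

End continuation.

Local Open Scope complex_scope.

(** * S-transforms and the real limit *)

Section full_measure.
Context {d : measure_display} {T : measurableType d} {R : realType} (P : probability T R).

Lemma Rintegral_full (D : set T) (f : T -> R) : measurable D -> P D = 1%E ->
  measurable_fun setT f -> \int[P]_(x in D) f x = \int[P]_x f x.
Proof.
move=> mD PD mf; rewrite Rintegral_mkcond; congr fine.
apply: (@ae_eq_integral _ _ _ P) => //.
- apply/measurable_EFinP; apply: (proj1 (measurable_restrictT f mD)).
  exact: measurable_funTS.
- exact/measurable_EFinP.
exists (~` D); split => [||x /= /not_implyP[_] H].
- exact: measurableC.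
- by rewrite [LHS]probability_setC//; transitivity (1 - 1 : \bar R)%E; [congr (_ - _)%E|rewrite subee].
by move=> Dx; apply: H; rewrite patchE mem_set.
Qed.

End full_measure.

Section transforms.
Context {R : realType}.
Implicit Types mu nu rho sigma : probability R R.

Lemma eta_realE mu (w : R) :
  eta_transform mu w%:C = (1 - w / (\int[mu]_x (w^-1 - x)^-1))%:C.
Proof.
have E (x : R) : ((w%:C)^-1 - x%:C)^-1 = ((w^-1 - x)^-1)%:C.
  by rewrite -fmorphV -rmorphB -fmorphV.
have G : cauchy_transform mu (w%:C)^-1 = (\int[mu]_x (w^-1 - x)^-1)%:C.
  rewrite /cauchy_transform; congr (_ +i* _).
    by apply: eq_Rintegral => x _; rewrite E.
  by under eq_Rintegral do rewrite E /=; rewrite Rintegral_cst// mul0r.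
by rewrite /eta_transform /F_transform G -fmorphV -rmorphM -(rmorph1 (real_complex R)) -rmorphB.
Qed.

(** A positive value of [S_transform] excludes the default value 0 of [eta_inv], so [w] truly solves
    the equation for [eta], and unfolding [eta] gives the resolvent at [w^-1]. *)
Lemma S_transform_resolvent mu (u : R) : -1 < u < 0 -> 0 < S_transform mu u ->
  let w := u / (1 + u) * S_transform mu u in
  \int[mu]_x (w^-1 - x)^-1 = w * (1 + u).
Proof.
move=> /andP[u1 u0] S0 w; have u10 : 0 < 1 + u by lra.
have z0 : u / (1 + u) != 0 by rewrite mulf_neq0 ?invr_eq0 ?(lt_eqF u0) ?(gt_eqF u10).
have wE : eta_inv mu (u / (1 + u)) = w.
  by rewrite /w /S_transform /Sigma_transform [RHS]mulrC divfK.
have w0 : w != 0 by rewrite mulf_neq0 ?(gt_eqF S0).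
have [_] : w < 0 /\ eta_transform mu w%:C = (u / (1 + u))%:C.
  set S := [set w : R | w < 0 /\ eta_transform mu w%:C = (u / (1 + u))%:C].
  change (S w); rewrite -wE; have [ex|nex] := pselect (exists y, S y).
    exact: xgetPex.
  move: w0; rewrite -wE /eta_inv xgetPN ?eqxx// => y Sy.
  by apply: nex; exists y.
rewrite eta_realE => /complexI H.
set g := \int[mu]_x _ in H *.
have E : w / g = (1 + u)^-1.
  have -> : w / g = 1 - (1 - w / g) by ring.
  by rewrite H; field; rewrite gt_eqF.
have g0 : g != 0.
  apply/eqP => g0; move: E; rewrite g0 invr0 mulr0 => /esym/eqP.
  by rewrite invr_eq0 gt_eqF.
have -> : 1 + u = g / w by rewrite -[LHS]invrK -E; field; rewrite g0 w0.
by field.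
Qed.

Lemma S_transform_dirac1 rho (z : R) : -1 < z < 0 ->
  (forall A, measurable A -> rho A = \d_(1 : R) A) -> S_transform rho z = 1.
Proof.
move=> /andP[z1 z0] rhoE; have z10 : 0 < 1 + z by lra.
have x0 : z / (1 + z) < 0 by rewrite pmulr_llt0// invr_gt0.
have eE (w : R) : w < 0 -> eta_transform rho w%:C = w%:C.
  move=> w0; rewrite eta_realE; congr (_%:C).
  have -> : \int[rho]_x (w^-1 - x)^-1 = (w^-1 - 1)^-1.
    have mf : measurable_fun setT (fun x : R => (w^-1 - x)^-1).
      by apply: measurable_fun_inv; apply: measurable_funB.
    rewrite /Rintegral (@eq_measure_integral _ _ _ _ (\d_(1 : R))); last by move=> A mA _; exact: rhoE.
    rewrite integral_dirac//; last exact/measurable_EFinP.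
    by rewrite diracT mul1e.
  have w1 : w^-1 - 1 != 0 by rewrite lt_eqF// subr_lt0 (@lt_trans _ _ 0)// invr_lt0.
  by rewrite invrK mulrBr mulfV ?lt_eqF// mulr1 opprB addrC subrK.
rewrite /S_transform /Sigma_transform.
suff -> : eta_inv rho (z / (1 + z)) = z / (1 + z) by rewrite divff// lt_eqF.
apply: xget_unique => [|y [y0]]; first by split => //; exact: eE.
by rewrite eE// => /complexI.
Qed.

Lemma S_boxtimes_seq (s : seq (probability R R)) rho : is_boxtimes_seq s rho ->
  exists2 e : R, 0 < e & forall z : R, - e < z < 0 ->
    S_transform rho z = \prod_(mu <- s) S_transform mu z.
Proof.
elim: s rho => [|mu s IH] rho /=.
  move=> rhoE; exists 1; rewrite ?ltr01// => z zI.
  by rewrite big_nil; exact: S_transform_dirac1.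
move=> [sigma /IH[e e0 H]] [_ _ _ [e' e'0 H']].
exists (Num.min e e'); first by rewrite lt_min e0.
move=> z /andP[z1 z0]; rewrite big_cons -H ?H'//.
  by rewrite z0 andbT; apply: le_lt_trans z1; rewrite lerN2 ge_min lexx orbT.
by rewrite z0 andbT; apply: le_lt_trans z1; rewrite lerN2 ge_min lexx.
Qed.

End transforms.

Section base.
Context {R : realType} (mu : probability R R).
Context {J : Type} (r : seq J) (c b : J -> R).

(** To be read as the logarithm of an S-transform at [- expR t]. *)
Definition weight (t : R) := \sum_(j <- r) c j * expR (b j * t).
(** With [psi z = E (z X / (1 - z X))] and [S z = psi^-1 z * (1 + z) / z], this is
    [- 1 / psi^-1 (- expR t)], the value [a] for which [E (X / (X + a)) = expR t]. The formula makes
    sense for all real [t]. *)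
Definition inv_psi (t : R) := (expR (- t) - 1) * expR (- weight t).

Lemma resolvent_base (t0 : R) : t0 <= 0 -> positive_law mu ->
  (forall t, t < t0 -> S_transform mu (- expR t) = expR (weight t)) ->
  forall t, t < t0 -> resolvent_eq mu (inv_psi t) (expR t).
Proof.
move=> t00 mupos HS t tt0; have t0' : t < 0 by apply: lt_le_trans t00.
have q1 : expR t < 1 by rewrite -expR0 ltr_expR.
have q0 := expR_gt0 t.
have := @S_transform_resolvent _ mu (- expR t) _ _; rewrite HS// expR_gt0 => /(_ _ isT).
have -> : -1 < - expR t < 0 by apply/andP; split; lra.
move=> /(_ isT) /=; set w := _ / _ * _.
have a0 : 0 < inv_psi t.
  by rewrite /inv_psi mulr_gt0 ?expR_gt0// subr_gt0 -expR0 ltr_expR oppr_gt0.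
have wE : w^-1 = - inv_psi t.
  rewrite /w /inv_psi !expRN; field.
  rewrite !gt_eqF ?expR_gt0//; lra.
have PE : pos_set (inv_psi t) = `]0, +oo[%classic.
  apply/seteqP; split => x; rewrite /= in_itv /= andbT; first by case.
  by move=> x0; split => //; rewrite addr_gt0.
have muP : mu (pos_set (inv_psi t)) = 1%E by rewrite PE.
have mP := measurable_pos_set (inv_psi t).
move=> H; split => //.
have mf : measurable_fun setT (fun x : R => (x + inv_psi t)^-1).
  by apply: measurable_fun_inv; apply: measurable_funD.
have bf : bmeas (pos_set (inv_psi t)) (fun x : R => (x + inv_psi t)^-1).
  apply: (bmeas_inv a0); first by apply: measurable_funD.
  by move=> x [x0 xa]; rewrite ger0_norm ?(ltW xa)// lerDr ltW.
have HI : \int[mu]_(x in pos_set (inv_psi t)) (x + inv_psi t)^-1 = (1 - expR t) / inv_psi t.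
  have mw : measurable_fun setT (fun x : R => (w^-1 - x)^-1).
    by apply: measurable_fun_inv; apply: measurable_funB.
  move: H; rewrite -(Rintegral_full mP muP mw).
  have -> : \int[mu]_(x in pos_set (inv_psi t)) (w^-1 - x)^-1 =
     \int[mu]_(x in pos_set (inv_psi t)) (-1 * (x + inv_psi t)^-1).
    apply: eq_Rintegral => x _; rewrite wE -opprD invrN mulN1r.
    by rewrite addrC.
  rewrite bRintegral_Z// mulN1r => /eqP; rewrite eqr_oppLR => /eqP ->.
  by rewrite -[w]invrK wE; field; rewrite gt_eqF.
transitivity (\int[mu]_(x in pos_set (inv_psi t)) (1 - inv_psi t * (x + inv_psi t)^-1)).
  apply: eq_Rintegral => x; rewrite inE => -[x0 xa].
  by field; rewrite gt_eqF.
rewrite bRintegral_B//; [|exact: bmeas_cst|exact: bmeasZ].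
rewrite bRintegral_cst// bRintegral_Z// HI; field; by rewrite gt_eqF.
Qed.

Lemma weight_ge0 (t : R) : (forall j, 0 <= c j) -> 0 <= weight t.
Proof. by move=> c0; apply: sumr_ge0 => j _; rewrite mulr_ge0// expR_ge0. Qed.

End base.

Section inv_psi_theory.
Context {R : realType} {J : Type} (r : seq J) (c b : J -> R).
Local Notation G := (weight r c b).
Local Notation G' := (weight r (fun j => c j * b j) b).
Local Notation A := (inv_psi r c b).

Lemma is_derive_expRZ (a x : R) : is_derive x 1 (fun x : R => expR (a * x)) (a * expR (a * x)).
Proof.
have cd : is_derive x 1 (fun x : R => a * x) a.
  by have := is_deriveZ a (is_derive_id x 1); rewrite /GRing.scale /= mulr1.
have := is_derive1_comp (f := expR) (g := fun x : R => a * x).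
by move=> /(_ x _ _ (is_derive_expR _) cd); rewrite mulrC.
Qed.

Lemma is_derive_weight (x : R) : is_derive x 1 G (G' x).
Proof.
rewrite /weight; elim: r => [|j s IH].
  rewrite big_nil; under eq_fun do rewrite big_nil; exact: is_derive_cst.
rewrite big_cons; under eq_fun do rewrite big_cons.
apply: is_deriveD.
have := is_deriveZ (c j) (is_derive_expRZ (b j) x).
by rewrite /GRing.scale /= mulrA.
Qed.

Lemma is_derive_exp_weight (x : R) :
  is_derive x 1 (fun x => expR (- G x)) (- G' x * expR (- G x)).
Proof.
have := is_derive1_comp (f := expR) (g := fun x : R => - G x).
have Nd := is_deriveN (is_derive_weight x).
by move=> /(_ x _ _ (is_derive_expR _) Nd); rewrite mulrC.
Qed.

Lemma uexp_weight' (l u : R) : uexp `[l, u] G'.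
Proof.
apply: uexp_sum => j; apply: uexpZ; exact: uexp_expR.
Qed.

Lemma uexp_inv_psi (l u : R) : uexp `[l, u] A.
Proof.
have -> : A = (fun x => (expR (- 1 * x) + -1) * expR (- G x)).
  by apply/funext => x; rewrite /inv_psi mulN1r.
apply: uexpM.
  by apply: uexpD; [exact: uexp_expR|exact: uexp_cst].
have H := @uexp_ode R l u (fun x => expR (- G x)) (fun x => - G' x).
apply: H; first exact: is_derive_exp_weight.
have -> : (fun x => - G' x) = (fun x => -1 * G' x).
  by apply/funext => x; rewrite mulN1r.
exact: uexpZ (uexp_weight' l u).
Qed.

Lemma is_derive_inv_psi (x : R) :
  is_derive x 1 A (- (expR (- x) * expR (- G x) * (1 + (1 - expR x) * G' x))).
Proof.
have d1 : is_derive x 1 (fun x : R => expR (- 1 * x) + -1) (- 1 * expR (- 1 * x) + 0).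
  by apply: is_deriveD; exact: is_derive_expRZ.
have := is_deriveM d1 (is_derive_exp_weight x).
have -> : (fun x : R => expR (- 1 * x) + -1) * (fun x => expR (- G x)) = A.
  by apply/funext => y; rewrite mulrfctE /inv_psi mulN1r.
move=> H; apply: is_derive_eq; rewrite /GRing.scale /= !mulN1r.
have : expR (- x) * expR x = 1 by rewrite -expRD addNr expR0.
set e := expR (- x); set e' := expR x; set E := expR _; set g := G' x => ee.
have -> : e * E * (1 + (1 - e') * g) = e * E + e * E * g - (e * e') * E * g by ring.
by rewrite ee; ring.
Qed.

Hypothesis c0 : forall j, 0 <= c j.
Hypothesis b0 : forall j, 0 <= b j.

Lemma weight_mono (c' : J -> R) (x y : R) : (forall j, 0 <= c' j) -> x <= y ->
  weight r c' b x <= weight r c' b y.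
Proof.
move=> c'0 xy; apply: ler_sum => j _; rewrite ler_wpM2l// ler_expR ler_wpM2l//.
Qed.

(** By [is_derive_inv_psi], [A] decreases where [(expR x - 1) * G' x < 1]. The product [expR * G']
    is nondecreasing, so the bound at [te] holds to its left, and on [x <= u < te] with the margin
    [1 - rho]. *)
Lemma inv_psi_decr (te u : R) : expR te * G' te <= 1 -> u < te ->
  exists2 m, 0 < m & forall x y, x < y -> y <= u -> m * (y - x) <= A x - A y.
Proof.
move=> te1 ute.
have cb0 j : 0 <= c j * b j by rewrite mulr_ge0.
have G'0 x : 0 <= G' x by exact: weight_ge0.
pose rho := expR u * G' u.
have rho1 : rho < 1.
  apply: (@le_lt_trans _ _ (expR (u - te) * (expR te * G' te))).
    by rewrite mulrA -expRD subrK ler_wpM2l ?expR_ge0// weight_mono// ltW.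
  apply: (@le_lt_trans _ _ (expR (u - te))); first by rewrite ler_piMr// expR_ge0.
  by rewrite -expR0 ltr_expR subr_lt0.
pose m := expR (- u) * expR (- G u) * (1 - rho).
exists m; first by rewrite !mulr_gt0 ?expR_gt0// subr_gt0.
move=> x y xy yu.
have [z|z|z] := @MVT R A (fun x => - (expR (- x) * expR (- G x) * (1 + (1 - expR x) * G' x))) x y xy.
- by move=> _; exact: is_derive_inv_psi.
- apply: derivable_within_continuous => w _.
  by case: (is_derive_inv_psi w).
rewrite in_itv /= => /andP[xz zy] E.
rewrite -[A x - A y]opprB E -mulNr opprK ler_wpM2r ?subr_ge0 ?(ltW xy)//.
have zu : z <= u by apply: le_trans yu; exact: ltW.
apply: ler_pM.
- by rewrite mulr_ge0// expR_ge0.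
- by rewrite subr_ge0 ltW.
- by apply: ler_pM; rewrite ?expR_ge0// ler_expR lerN2// weight_mono.
have : expR z * G' z <= rho.
  by apply: ler_pM; rewrite ?expR_ge0 ?ler_expR// weight_mono.
have := G'0 z; rewrite mulrDl mul1r mulNr; lra.
Qed.

Lemma resolvent_inv_psi (mu : probability R R) (t0 te : R) : t0 <= 0 -> positive_law mu ->
  (forall t, t < t0 -> S_transform mu (- expR t) = expR (G t)) ->
  expR te * G' te <= 1 ->
  forall t, t < te -> resolvent_eq mu (A t) (expR t).
Proof.
move=> t00 mup HS te1 t tte.
apply: (@resolvent_continuation R mu A te _ _ t0 _ t tte).
- by move=> u; exact: inv_psi_decr.
- exact: uexp_inv_psi.
- exact: resolvent_base.
Qed.

End inv_psi_theory.

Section log_bounds.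
Context {R : realType}.

Lemma ln_le_subr1 (y : R) : 0 < y -> ln y <= y - 1.
Proof.
move=> y0; have := expR_ge1Dx (ln y); rewrite lnK ?posrE// => H; lra.
Qed.

Lemma ln1B_bounds (x : R) : 0 <= x <= 2^-1 -> x <= - ln (1 - x) <= x + 2 * x ^+ 2.
Proof.
move=> /andP[x0 x1]; have x10 : 0 < 1 - x by lra.
apply/andP; split; first by have := ln_le_subr1 x10; lra.
rewrite -lnV ?posrE//.
have := @ln_le_subr1 (1 - x)^-1; rewrite invr_gt0 => /(_ x10) H; apply: le_trans H _.
have -> : (1 - x)^-1 - 1 = x / (1 - x) by field; lra.
by rewrite ler_pdivrMr//; nra.
Qed.

(** The kernel of the multiplicative problem is within 1 of the additive resolvent [z^-1]; after
    multiplication by the scale [e] the discrepancy is at most [e]. *)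
Lemma inv_1Bexp (z : R) : 0 < z -> z^-1 <= (1 - expR (- z))^-1 <= z^-1 + 1.
Proof.
move=> z0; have e1 : 1 - z <= expR (- z) by exact: expR_ge1Dx.
have e2 : 1 + z <= expR z by exact: expR_ge1Dx.
have ee : expR (- z) * expR z = 1 by rewrite -expRD addNr expR0.
have e3 := expR_gt0 (- z).
have d0 : 0 < 1 - expR (- z) by rewrite subr_gt0 -expR0 ltr_expR oppr_lt0.
rewrite lef_pV2 ?posrE//; apply/andP; split; first by lra.
have -> : z^-1 + 1 = (1 + z) / z by field; rewrite gt_eqF.
rewrite ler_pdivlMr// mulrC ler_pdivrMr//.
have : expR (- z) * (1 + z) <= expR (- z) * expR z by rewrite ler_pM2l.
rewrite ee; nra.
Qed.

End log_bounds.

Lemma cvg_sumr {R : realType} {T I : Type} (F : set_system T) {FF : Filter F}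
    (r : seq I) (f : I -> T -> R) (l : I -> R) :
  (forall i, f i t @[t --> F] --> l i) ->
  \sum_(i <- r) f i t @[t --> F] --> \sum_(i <- r) l i.
Proof.
move=> H; elim: r => [|i r IH].
  by rewrite big_nil; under eq_fun do rewrite big_nil; exact: cvg_cst.
by rewrite big_cons; under eq_fun do rewrite big_cons; exact: cvgD.
Qed.

(** * Rescaling and the limit of the shift *)

Section asymptotics.
Context {R : realType} {k : nat} (alpha p : 'I_k.+1 -> R).
Hypothesis halpha : forall i, 1 < alpha i <= 2.
Hypothesis halpha_decr : forall i j : 'I_k.+1, (i < j)%N -> alpha j < alpha i.
Hypothesis hp : forall i, 0 < p i.
Local Notation a0 := (alpha ord0).
Local Notation idx := (index_enum 'I_k.+1).

Definition coef (e : R) (i : 'I_k.+1) := p i / p ord0 * e `^ a0.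
Definition expo (i : 'I_k.+1) := alpha i - 1.
(** At [s = - ln (e * u)] the resolvent has its pole at [X = expR (- (e * shift e u))]; in the
    variable [Y = ln X / e] the pole is [- shift e u]. *)
Definition shift (e u : R) := (- ln (1 - e * u) + weight idx (coef e) expo (- ln (e * u))) / e.
(** Formally, [- limshift u] is the value at [- u] of the inverse F-transform of the free stable
    law. *)
Definition limshift (u : R) := u + u `^ (1 - a0).

Lemma expo_gt0 i : 0 < expo i.
Proof. by rewrite subr_gt0; case/andP: (halpha i). Qed.

Lemma alpha_lt i : i != ord0 -> alpha i < a0.
Proof.
move=> i0; apply: halpha_decr; rewrite lt0n; apply: contra i0 => /eqP H.
by apply/eqP/val_inj.
Qed.

Lemma alpha_le i : alpha i <= a0.
Proof. by have [->//|/alpha_lt/ltW] := eqVneq i ord0. Qed.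

Lemma coef_ge0 e i : 0 <= coef e i.
Proof. by rewrite mulr_ge0 ?powR_ge0// divr_ge0// ltW. Qed.

Lemma expR_ln_powR (x b : R) : 0 < x -> expR (b * - ln x) = x `^ (- b).
Proof. by move=> x0; rewrite mulrN -mulNr mulrC expRM lnK. Qed.

Lemma weight_coefE (e u : R) : 0 < e -> 0 < u ->
  weight idx (coef e) expo (- ln (e * u)) / e =
  \sum_i p i / p ord0 * e `^ (a0 - alpha i) * u `^ (1 - alpha i).
Proof.
move=> e0 u0; rewrite /weight mulr_suml; apply: eq_bigr => i _.
rewrite expR_ln_powR ?mulr_gt0// powRM ?(ltW e0) ?(ltW u0)// /coef /expo.
have -> : a0 - alpha i = a0 + - (alpha i - 1) + -1 by ring.
have ene : e != 0 by rewrite gt_eqF.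
rewrite !(@powRD _ e) ?ene ?implybT// powR_inv1 ?(ltW e0)// opprB.
by ring.
Qed.

Lemma shift_cvg (u : R) : 0 < u -> shift e u @[e --> 0^'+] --> limshift u.
Proof.
move=> u0.
have H1 : - ln (1 - e * u) / e @[e --> 0^'+] --> u.
  apply/cvgrPdist_le => /= d d0; near=> e.
  have e0 : 0 < e by near: e; exact: nbhs_right_gt.
  have e1 : e <= (2 * u)^-1.
    by near: e; apply: nbhs_right_le; rewrite invr_gt0 mulr_gt0.
  have e2 : e <= d / (2 * u ^+ 2).
    by near: e; apply: nbhs_right_le; rewrite divr_gt0// mulr_gt0// exprn_gt0.
  have eu : 0 <= e * u <= 2^-1.
    rewrite mulr_ge0 ?(ltW e0) ?(ltW u0)//=.
    by move: e1; rewrite invfM ler_pdivlMr.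
  have /andP[l1 l2] := ln1B_bounds eu.
  have -> : u - - ln (1 - e * u) / e = - ((- ln (1 - e * u) - e * u) / e).
    by field; rewrite gt_eqF.
  rewrite normrN ger0_norm; last by rewrite divr_ge0 ?(ltW e0)// subr_ge0.
  rewrite ler_pdivrMr//; move: e2; rewrite ler_pdivlMr; last first.
    by rewrite mulr_gt0// exprn_gt0.
  rewrite lerBlDl => H; apply: le_trans l2 _; rewrite lerD2l.
  have -> : 2 * (e * u) ^+ 2 = (e * (2 * u ^+ 2)) * e by ring.
  by rewrite ler_wpM2r// ltW.
pose f (i : 'I_k.+1) (e : R) := p i / p ord0 * e `^ (a0 - alpha i) * u `^ (1 - alpha i).
pose l (i : 'I_k.+1) : R := if i == ord0 then u `^ (1 - a0) else 0.
have H2' i : f i e @[e --> 0^'+] --> l i.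
  rewrite /f /l.
  have [->|i0] := eqVneq i ord0.
    under eq_fun do rewrite subrr powRr0 mulr1 divff ?mul1r ?(gt_eqF (hp _))//.
    exact: cvg_cst.
  have ai : 0 < a0 - alpha i by rewrite subr_gt0 alpha_lt.
  have := cvgM (cvgM (cvg_cst (p i / p ord0)) (powR_cvg0 ai)) (cvg_cst (u `^ (1 - alpha i))).
  by rewrite mulr0 mul0r; apply.
have H2 := cvg_sumr (r := idx) H2'.
rewrite /limshift -[u `^ (1 - a0)](_ : \sum_i l i = _); last first.
  by rewrite -big_mkcond big_pred1_eq.
have FFr : Filter (0^'+ : set_system R) by exact: _.
have H := cvgD H1 (H2 FFr).
move: H => /(_ FFr) H.
move/cvgrPdist_le: H => H; apply/cvgrPdist_le => d d0; near=> e.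
have e0 : 0 < e by near: e; exact: nbhs_right_gt.
rewrite /shift mulrDl weight_coefE//.
by near: e; exact: H.
Unshelve. all: by end_near. Qed.

(* Chosen so that [inv_psi], with the weights [coef e], decreases on
   [s < ln (crit / e)]. *)
Definition crit : R := (1 + \sum_i p i * expo i / p ord0)^-1.

Lemma crit_gt0 : 0 < crit.
Proof.
rewrite invr_gt0 ltr_wpDr// sumr_ge0// => i _.
by rewrite divr_ge0 ?mulr_ge0 ?(ltW (expo_gt0 _))// ltW.
Qed.

Lemma crit_le1 : crit <= 1.
Proof.
rewrite invf_le1; first rewrite lerDl sumr_ge0// => i _.
  by rewrite divr_ge0 ?mulr_ge0 ?(ltW (expo_gt0 _))// ltW.
by have := crit_gt0; rewrite invr_gt0.
Qed.

(** The i-th term is [p_i * expo_i / p_0] times [crit]^ alpha_i * e [^ (alpha_0 - alpha_i)]. The two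
    powers are at most [crit] and 1, so [crit] can be the same for all [e], and [- ln (e * u)] lies
    in the allowed range as soon as [u > crit^-1]. *)
Lemma crit_bound (e : R) : 0 < e <= 1 ->
  expR (ln (crit / e)) * weight idx (fun i => coef e i * expo i) expo (ln (crit / e)) <= 1.
Proof.
move=> /andP[e0 e1]; have c0 := crit_gt0; have c1 := crit_le1.
have ce0 : 0 < crit / e by rewrite divr_gt0.
rewrite lnK ?posrE// /weight mulr_sumr.
apply: (@le_trans _ _ (\sum_i crit * (p i * expo i / p ord0))).
  apply: ler_sum => i _.
  have -> : expR (expo i * ln (crit / e)) = (crit / e) `^ (alpha i - 1).
    by rewrite mulrC expRM lnK ?posrE.
  have -> : crit / e * (coef e i * expo i * (crit / e) `^ (alpha i - 1)) =
    p i * expo i / p ord0 * (e `^ a0 * (crit / e) `^ alpha i).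
    have -> : alpha i = 1 + (alpha i - 1) by ring.
    rewrite [in RHS]powRD; last by apply/implyP => _; rewrite gt_eqF.
    rewrite powRr1 ?(ltW ce0)// /coef.
    have -> : 1 + (alpha i - 1) - 1 = alpha i - 1 by ring.
    by ring.
  rewrite [leRHS]mulrC ler_wpM2l//.
    by rewrite divr_ge0 ?mulr_ge0 ?(ltW (expo_gt0 _))// ltW.
  rewrite powRM ?(ltW c0)// ?invr_ge0 ?(ltW e0)//.
  rewrite -(powR_inv1 (ltW e0)) -powRrM mulN1r mulrCA -powRD; last first.
    by apply/implyP => _; rewrite gt_eqF.
  apply: (@le_trans _ _ (crit `^ 1 * 1)); last by rewrite mulr1 powRr1// ltW.
  apply: ler_pM; rewrite ?powR_ge0//.
    have /andP[a1 _] := halpha i.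
    by apply: ger_powR; rewrite ?c0 ?c1// ltW.
  rewrite -(powRr0 e); apply: ger_powR; rewrite ?e0 ?e1//.
  by rewrite subr_ge0 alpha_le.
rewrite -mulr_sumr -[leRHS](mulVf (x := 1 + \sum_i p i * expo i / p ord0)).
  by rewrite ler_wpM2l ?(ltW c0)// lerDr.
by have := crit_gt0; rewrite invr_gt0 => /gt_eqF ->.
Qed.

Lemma inv_psi_shift (e u : R) : 0 < e -> 0 < u -> e * u < 1 ->
  inv_psi idx (coef e) expo (- ln (e * u)) = - expR (- (e * shift e u)).
Proof.
move=> e0 u0 eu; have eu0 : 0 < e * u by rewrite mulr_gt0.
rewrite /inv_psi opprK lnK ?posrE// /shift.
have -> : - (e * ((- ln (1 - e * u) + weight idx (coef e) expo (- ln (e * u))) / e)) =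
  ln (1 - e * u) + - weight idx (coef e) expo (- ln (e * u)) by field; rewrite gt_eqF.
by rewrite expRD lnK ?posrE ?subr_gt0//; ring.
Qed.

Lemma shift_ge (e u : R) : 0 < e -> 0 < u -> e * u < 1 -> u <= shift e u.
Proof.
move=> e0 u0 eu; rewrite /shift ler_pdivlMr//.
have eu1 : 0 < 1 - e * u by rewrite subr_gt0.
have := ln_le_subr1 eu1.
have := weight_ge0 idx expo (- ln (e * u)) (coef_ge0 e).
lra.
Qed.

(** For [x = expR (e * y)] the kernel [x / (x + A)] equals [(1 - expR (- (e * (y + S))))^-1], to
    which [inv_1Bexp] applies; on the right-hand side [e * expR (- ln (e * u))] is [u^-1]. *)
Lemma resolvent_kernel (mu : probability R R) (e u c : R) (Om : set R) :
  0 < e -> 0 < u -> e * u < 1 -> measurable Om -> mu Om = 1%E ->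
  (forall x, Om x -> 0 < x /\ - c <= ln x / e) -> c + 1 <= shift e u ->
  resolvent_eq mu (inv_psi idx (coef e) expo (- ln (e * u))) (expR (- ln (e * u))) ->
  `|\int[mu]_(x in Om) (ln x / e + shift e u)^-1 - u^-1| <= e.
Proof.
move=> e0 u0 eu mOm muOm OmE cS [_ H].
set S := shift e u in cS *; set A := inv_psi _ _ _ _ in H.
have AE : A = - expR (- (e * S)) by exact: inv_psi_shift.
have xE x : Om x -> [/\ 0 < x + A, 1 <= ln x / e + S &
    x / (x + A) = (1 - expR (- (e * (ln x / e + S))))^-1].
  move=> Ox; have [x0 xc] := OmE x Ox; have y1 : 1 <= ln x / e + S by lra.
  have xe : expR (e * (ln x / e)) = x.
    by rewrite mulrC divfK ?lnK ?posrE// gt_eqF.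
  have E : x + A = x * (1 - expR (- (e * (ln x / e + S)))).
    rewrite mulrBr mulr1 AE; congr (_ - _).
    by rewrite -{1}xe -expRD; congr expR; ring.
  have d0 : 0 < 1 - expR (- (e * (ln x / e + S))).
    by rewrite subr_gt0 -expR0 ltr_expR oppr_lt0 mulr_gt0// (lt_le_trans ltr01).
  split => //; first by rewrite E mulr_gt0.
  by rewrite E; field; rewrite !gt_eqF.
have kE x : Om x -> (ln x / e + S)^-1 <= e * (x / (x + A)) <= (ln x / e + S)^-1 + e.
  move=> Ox; have [xA y1 ->] := xE x Ox.
  have y0 : 0 < ln x / e + S by apply: lt_le_trans y1.
  have /andP[k1 k2] := inv_1Bexp (mulr_gt0 e0 y0).
  have -> : (ln x / e + S)^-1 = e * (e * (ln x / e + S))^-1.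
    by rewrite invfM mulrA divff ?mul1r// gt_eqF.
  rewrite ler_pM2l// k1 /=; set w := (e * _)^-1 in k2 *.
  by rewrite (_ : e * w + e = e * (w + 1)); [rewrite ler_pM2l|ring].
have OmA : Om `<=` pos_set A.
  by move=> x Ox; have [? _ _] := xE x Ox; have [] := OmE x Ox.
have [_ HE] := resolvent_full mOm OmA muOm.
have b1 : bmeas Om (fun x => (ln x / e + S)^-1).
  apply: (bmeas_inv ltr01).
    apply: measurable_funD => //; apply: measurable_funM => //.
    by apply: measurable_funTS; exact: measurable_ln.
  by move=> x Ox; have [_ y1 _] := xE x Ox; apply: le_trans y1 (ler_norm _).
have b2 : bmeas Om (fun x => e * (x / (x + A))).
  split; first by apply: measurable_funM => //; exact: measurable_resolvent.
  exists (1 + e) => x Ox; have /andP[k1 k2] := kE x Ox; have [_ y1 _] := xE x Ox.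
  have y0 : 0 < ln x / e + S by apply: lt_le_trans y1.
  rewrite ger0_norm; last by apply: le_trans k1; rewrite invr_ge0 ltW.
  by apply: le_trans k2 _; rewrite lerD2r invf_le1.
have IE : \int[mu]_(x in Om) (e * (x / (x + A))) = u^-1.
  have b3 : bmeas Om (fun x => x / (x + A)).
    have -> : (fun x => x / (x + A)) = (fun x => e^-1 * (e * (x / (x + A)))).
      by apply/funext => x; rewrite mulKf// gt_eqF.
    exact: bmeasZ.
  rewrite bRintegral_Z// -HE H expRN lnK ?posrE ?mulr_gt0// invfM mulrA divff ?mul1r//.
  by rewrite gt_eqF.
rewrite -IE -bRintegral_B//.
apply: bRintegral_norm => //; first exact: ltW.
  by have [] := bmeasB b1 b2.
move=> x Ox; have /andP[k1 k2] := kE x Ox.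
rewrite ler_norml; apply/andP; split; lra.
Qed.

End asymptotics.

Section scaled_ln.
Context {R : realType}.
Definition scaled_ln (e x : R) : R := ln x / e.

Lemma measurable_scaled_ln e : measurable_fun setT (scaled_ln e).
Proof. by apply: measurable_funM => //; exact: measurable_ln. Qed.

HB.instance Definition _ (e : R) :=
  isMeasurableFun.Build _ _ R R (scaled_ln e) (measurable_scaled_ln e).
End scaled_ln.

Section real_limit.
Context {R : realType} {k : nat} (alpha p : 'I_k.+1 -> R).
Hypothesis halpha : forall i, 1 < alpha i <= 2.
Hypothesis halpha_decr : forall i j : 'I_k.+1, (i < j)%N -> alpha j < alpha i.
Hypothesis hp : forall i, 0 < p i.
Context {T : Type} {F : set_system T} {FF : Filter F}.
Variables (mu_ : T -> probability R R) (e_ : T -> R).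
Hypothesis e_cvg : e_ t @[t --> F] --> 0^'+.
Hypothesis mu_pos : \forall t \near F, positive_law (mu_ t).
Hypothesis mu_S : \forall t \near F, exists2 t0, t0 <= 0 & forall s, s < t0 ->
  S_transform (mu_ t) (- expR s) = expR (weight (index_enum 'I_k.+1) (coef alpha p (e_ t)) (expo alpha) s).
Local Notation idx := (index_enum 'I_k.+1).
Local Notation lam t := (distribution (mu_ t) (scaled_ln (e_ t))).

Lemma real_limit : exists2 c, 0 < c &
  (\forall t \near F, lam t `[- c, +oo[%classic = 1%E) /\
  forall rho d, c + 2 <= rho -> 0 < d -> \forall t \near F,
    `|\int[lam t]_(y in `[- c, +oo[) (y + limshift alpha rho)^-1 - rho^-1| < d.
Proof.
(* Any [u > (crit alpha p)^-1] is admissible; the factor 2 makes the inequality strict. *)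
pose u1 := 2 / crit alpha p; have cr0 := crit_gt0 halpha hp; have cr1 := crit_le1 halpha hp.
have u10 : 0 < u1 by rewrite divr_gt0.
(* The support clause of [resolvent_eq] at [u1] says [ln x / e > - shift e u1], and [shift e u1] is
   eventually below [limshift u1 + 1]. *)
pose c := limshift alpha u1 + 1.
have cu : u1 + 1 <= c by rewrite lerD2r lerDl powR_ge0.
have c0 : 0 < c by lra.
have near_e Q : (\forall e \near 0^'+, Q e) -> \forall t \near F, Q (e_ t).
  exact: e_cvg.
have main u : u1 <= u -> \forall t \near F, [/\ 0 < e_ t, e_ t <= 1, e_ t * u < 1 &
   resolvent_eq (mu_ t) (inv_psi idx (coef alpha p (e_ t)) (expo alpha) (- ln (e_ t * u)))
     (expR (- ln (e_ t * u)))].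
  move=> u1u; have u0 : 0 < u by apply: lt_le_trans u1u.
  near=> t.
  have e0 : 0 < e_ t by near: t; apply: (near_e (fun e => 0 < e)); exact: nbhs_right_gt.
  have e1 : e_ t <= 1 by near: t; apply: (near_e (fun e => e <= 1)); exact: nbhs_right_le.
  have e2 : e_ t * u < 1.
    rewrite -ltr_pdivlMr// div1r; near: t; apply: (near_e (fun e => e < u^-1)); apply: nbhs_right_lt.
    by rewrite invr_gt0.
  split => //.
  have [t0 t00 HS] : exists2 t0, t0 <= 0 & forall s, s < t0 ->
    S_transform (mu_ t) (- expR s) = expR (weight idx (coef alpha p (e_ t)) (expo alpha) s).
    by near: t.
  have mup : positive_law (mu_ t) by near: t.
  have e01 : 0 < e_ t <= 1 by rewrite e0.
  apply: (resolvent_inv_psi (coef_ge0 alpha hp (e_ t)) (fun i => ltW (expo_gt0 halpha i)) t00 mup HS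
    (crit_bound halpha halpha_decr hp e01)).
  rewrite -lnV ?posrE ?mulr_gt0// ltr_ln ?posrE ?invr_gt0 ?divr_gt0 ?mulr_gt0//.
  rewrite invfM mulrC ltr_pM2r ?invr_gt0//.
  rewrite invf_plt ?posrE//; apply: lt_le_trans u1u.
  have ci : 0 < (crit alpha p)^-1 by rewrite invr_gt0.
  rewrite /u1; lra.
pose Om t := (scaled_ln (e_ t)) @^-1` `[- c, +oo[%classic `&` [set x : R | 0 < x].
have mpre t : measurable (scaled_ln (e_ t) @^-1` `[- c, +oo[%classic).
  by rewrite -[X in measurable X]setTI; exact: measurable_scaled_ln.
have mOm t : measurable (Om t).
  apply: measurableI => //; rewrite (_ : [set x | _] = `]0, +oo[%classic)//.
  by apply/seteqP; split => x; rewrite /= in_itv /= andbT.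
have OmE t x : Om t x -> 0 < x /\ - c <= ln x / e_ t.
  by move=> []; rewrite /scaled_ln /= in_itv /= andbT.
have muOm : \forall t \near F, mu_ t (Om t) = 1%E.
  near=> t.
  have [e0 e1 e2 [mu1 _]] : [/\ 0 < e_ t, e_ t <= 1, e_ t * u1 < 1 &
    resolvent_eq (mu_ t) (inv_psi idx (coef alpha p (e_ t)) (expo alpha) (- ln (e_ t * u1)))
     (expR (- ln (e_ t * u1)))] by near: t; exact: main.
  have Sc : shift alpha p (e_ t) u1 < c.
    have : `|limshift alpha u1 - shift alpha p (e_ t) u1| < 1.
      near: t; apply: (near_e (fun e => `|limshift alpha u1 - shift alpha p e u1| < 1)).
      by have /cvgrPdist_lt /(_ _ ltr01) := shift_cvg halpha_decr hp u10.
    by rewrite ltr_norml => /andP[? _]; rewrite /c; lra.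
  apply/eqP; rewrite eq_le probability_le1//= -mu1 le_measure ?inE//.
    exact: measurable_pos_set.
  move=> x [x0]; rewrite inv_psi_shift// subr_gt0 => xS; split => //.
  rewrite /scaled_ln /= in_itv /= andbT ler_pdivlMr//.
  have : - (e_ t * shift alpha p (e_ t) u1) < ln x by rewrite -ltr_expR lnK ?posrE.
  have : e_ t * shift alpha p (e_ t) u1 < e_ t * c by rewrite ltr_pM2l.
  lra.
exists c => //; split.
  near=> t; have mu1 : mu_ t (Om t) = 1%E by near: t.
  apply/eqP; rewrite eq_le probability_le1//= -mu1.
  have H : (mu_ t (Om t) <= mu_ t (scaled_ln (e_ t) @^-1` `[(- c)%R, +oo[%classic))%E.
    by rewrite le_measure ?inE// => x [].
  exact: H.
move=> rho d rhoc d0; have rho0 : 0 < rho by lra.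
near=> t.
have mu1 : mu_ t (Om t) = 1%E by near: t.
have [e0 e1 e2 Hr] : [/\ 0 < e_ t, e_ t <= 1, e_ t * rho < 1 &
    resolvent_eq (mu_ t) (inv_psi idx (coef alpha p (e_ t)) (expo alpha) (- ln (e_ t * rho)))
     (expR (- ln (e_ t * rho)))] by near: t; apply: main; lra.
have Sr := shift_ge alpha hp e0 rho0 e2.
have Hk := resolvent_kernel e0 rho0 e2 (mOm t) mu1 (@OmE t) _ Hr.
have cr : c + 1 <= rho by lra.
have {}Hk := Hk (le_trans cr Sr).
have ed : e_ t <= d / 4.
  by near: t; apply: (near_e (fun e => e <= d / 4)); apply: nbhs_right_le; rewrite divr_gt0.
have Sd : `|limshift alpha rho - shift alpha p (e_ t) rho| <= d / 4.
  near: t; apply: (near_e (fun e => `|limshift alpha rho - shift alpha p e rho| <= d / 4)).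
  have d4 : 0 < d / 4 by rewrite divr_gt0.
  by have /cvgrPdist_le /(_ _ d4) := shift_cvg halpha_decr hp rho0.
set S := shift _ _ _ _ in Sr Hk Sd; set L := limshift _ _ in Sd *.
have Lr : rho <= L by rewrite lerDl powR_ge0.
have b1 : bmeas (Om t) (fun x => (ln x / e_ t + S)^-1).
  apply: (bmeas_inv ltr01).
    apply: measurable_funD => //; apply: measurable_funM => //.
    by apply: measurable_funTS; exact: measurable_ln.
  by move=> x /OmE[_ y1]; apply: le_trans (ler_norm _); lra.
have b2 : bmeas (scaled_ln (e_ t) @^-1` `[- c, +oo[%classic) (fun x => (scaled_ln (e_ t) x + L)^-1).
  apply: (bmeas_inv ltr01).
    apply: measurable_funD => //; apply: measurable_funTS; exact: measurable_scaled_ln.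
  move=> x; rewrite /= in_itv /= andbT => y1; apply: le_trans (ler_norm _); lra.
have -> : \int[lam t]_(y in `[- c, +oo[) (y + L)^-1 =
   \int[mu_ t]_(x in Om t) (scaled_ln (e_ t) x + L)^-1.
  rewrite -(bRintegral_subset (mpre t) (mOm t) _ mu1 b2); last by move=> x [].
  congr fine; rewrite ge0_integral_pushforward//.
    apply/measurable_EFinP; apply: measurable_fun_inv; exact: measurable_funD.
  move=> y; rewrite inE /= in_itv /= andbT => y1; rewrite lee_fin invr_ge0; lra.
have b2' : bmeas (Om t) (fun x => (scaled_ln (e_ t) x + L)^-1).
  by apply: bmeas_sub b2 => // x [].
have Hd : `|\int[mu_ t]_(x in Om t) (scaled_ln (e_ t) x + L)^-1 -
   \int[mu_ t]_(x in Om t) (ln x / e_ t + S)^-1| <= d / 4.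
  rewrite -bRintegral_B//; apply: bRintegral_norm => //; first by rewrite divr_ge0// ltW.
    by have [] := bmeasB b2' b1.
  move=> x /OmE[x0 y1]; rewrite /scaled_ln; set y := ln x / e_ t in y1 *.
  have yL : 1 <= y + L by lra.
  have yS : 1 <= y + S by lra.
  have -> : (y + L)^-1 - (y + S)^-1 = (S - L) * ((y + L)^-1 * (y + S)^-1).
    by field; rewrite !gt_eqF//; lra.
  rewrite normrM distrC -[leRHS]mulr1; apply: ler_pM => //.
  rewrite ger0_norm; last by rewrite mulr_ge0// invr_ge0; lra.
  by rewrite mulr_ile1 ?invr_ge0 ?invf_le1//; lra.
have := ler_distD (\int[mu_ t]_(x in Om t) (ln x / e_ t + S)^-1)
  (\int[mu_ t]_(x in Om t) (scaled_ln (e_ t) x + L)^-1) rho^-1.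
lra.
Unshelve. all: by end_near. Qed.

End real_limit.

(** * Continuation along a complex arc *)

Section complex_integral.
Context {R : realType}.
Implicit Types (mu : probability R R) (D : set R) (f g : R -> R[i]) (z w : R[i]).
Local Notation Re := complex.Re.
Local Notation Im := complex.Im.
Local Notation normc := (@Normc.normc R).
Let absC := absolute_value_normc R.

Lemma complex_ReD z w : Re (z + w) = Re z + Re w. Proof. by case: z; case: w. Qed.
Lemma complex_ImD z w : Im (z + w) = Im z + Im w. Proof. by case: z; case: w. Qed.
Lemma complex_ReM z w : Re (z * w) = Re z * Re w - Im z * Im w. Proof. by case: z; case: w. Qed.
Lemma complex_ImM z w : Im (z * w) = Re z * Im w + Im z * Re w. Proof. by case: z; case: w. Qed.

Lemma normc_ReIm z : normc z = Num.sqrt (Re z ^+ 2 + Im z ^+ 2).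
Proof. by case: z. Qed.

Lemma normc_ge_absRe z : `|Re z| <= normc z.
Proof. by rewrite normc_ReIm -sqrtr_sqr ler_wsqrtr// lerDl sqr_ge0. Qed.

Lemma normc_ge_absIm z : `|Im z| <= normc z.
Proof. by rewrite normc_ReIm -sqrtr_sqr ler_wsqrtr// lerDr sqr_ge0. Qed.

Lemma normc_real (x : R) : normc x%:C = `|x|.
Proof. by rewrite normc_ReIm /= expr0n addr0 sqrtr_sqr. Qed.

Lemma normc_imag (x : R) : normc (0 +i* x) = `|x|.
Proof. by rewrite normc_ReIm /= expr0n add0r sqrtr_sqr. Qed.

Lemma normc_le z : normc z <= `|Re z| + `|Im z|.
Proof.
have -> : z = (Re z)%:C + (0 +i* Im z) by case: z => a b; rewrite /= /real_complex_def; simpc.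
apply: le_trans (le_normcD _ _) _; rewrite normc_real normc_imag.
by rewrite !complex_ReD !complex_ImD /= addr0 add0r.
Qed.

Definition cint mu D f : R[i] :=
  (\int[mu]_(x in D) Re (f x)) +i* (\int[mu]_(x in D) Im (f x)).

Definition cbm D f := bmeas D (fun x => Re (f x)) /\ bmeas D (fun x => Im (f x)).

Lemma cbm_cst D z : cbm D (fun=> z).
Proof. by split; exact: bmeas_cst. Qed.

Lemma cbmD D f g : cbm D f -> cbm D g -> cbm D (fun x => f x + g x).
Proof.
move=> [f1 f2] [g1 g2]; split.
  by under eq_fun do rewrite complex_ReD; exact: bmeasD.
by under eq_fun do rewrite complex_ImD; exact: bmeasD.
Qed.

Lemma cbmM D f g : cbm D f -> cbm D g -> cbm D (fun x => f x * g x).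
Proof.
move=> [f1 f2] [g1 g2]; split.
  by under eq_fun do rewrite complex_ReM; apply: bmeasB; exact: bmeasM.
by under eq_fun do rewrite complex_ImM; apply: bmeasD; exact: bmeasM.
Qed.

Lemma cbmZ D z f : cbm D f -> cbm D (fun x => z * f x).
Proof. by apply: cbmM; exact: cbm_cst. Qed.

Lemma cbmN D f : cbm D f -> cbm D (fun x => - f x).
Proof. by move=> bf; under eq_fun do rewrite -mulN1r; exact: cbmZ. Qed.

Lemma cbmX D f n : cbm D f -> cbm D (fun x => f x ^+ n).
Proof.
move=> bf; elim: n => [|n IH]; first exact: cbm_cst.
by under eq_fun do rewrite exprS; exact: cbmM.
Qed.

Lemma cbm_sum D n (F : nat -> R -> R[i]) : (forall k, cbm D (F k)) ->
  cbm D (fun x => \sum_(k < n) F k x).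
Proof.
move=> bF; elim: n => [|n IH].
  by under eq_fun do rewrite big_ord0; exact: cbm_cst.
by under eq_fun do rewrite big_ord_recr /=; exact: cbmD.
Qed.

Lemma cbm_resolvent D z (c : R) : 0 < c -> (forall y, D y -> c <= normc (y%:C + z)) ->
  cbm D (fun y => (y%:C + z)^-1).
Proof.
move=> c0 Dc.
have bound y : D y -> normc ((y%:C + z)^-1) <= c^-1.
  move=> Dy; rewrite (abvV absC) lef_pV2 ?posrE//; first exact: Dc.
  exact: lt_le_trans (Dc y Dy).
have mD (a b : R) : measurable_fun D (fun y => ((y + a) ^+ 2 + b ^+ 2)^-1).
  apply: measurable_fun_inv; apply: measurable_funD => //.
  by apply: measurable_funX; exact: measurable_funD.
case: z Dc bound => a b Dc bound.
have E y : (y%:C + (a +i* b))^-1 = ((y + a) / ((y + a) ^+ 2 + b ^+ 2)) +i*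
    (- (b / ((y + a) ^+ 2 + b ^+ 2))).
  by rewrite /GRing.inv /= add0r.
split; split.
- under eq_fun do rewrite E /=; apply: measurable_funM => //; exact: measurable_funD.
- by exists c^-1 => y Dy; apply: le_trans (normc_ge_absRe _) (bound y Dy).
- under eq_fun do rewrite E /=; apply: measurable_funN; exact: measurable_funM.
- by exists c^-1 => y Dy; apply: le_trans (normc_ge_absIm _) (bound y Dy).
Qed.

Lemma cintD mu D f g : measurable D -> cbm D f -> cbm D g ->
  cint mu D (fun x => f x + g x) = cint mu D f + cint mu D g.
Proof.
move=> mD [f1 f2] [g1 g2]; rewrite /cint.
under eq_Rintegral do rewrite complex_ReD; under [X in _ +i* X]eq_Rintegral do rewrite complex_ImD.
by rewrite !bRintegral_D//; simpc.
Qed.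

Lemma cintZ mu D z f : measurable D -> cbm D f ->
  cint mu D (fun x => z * f x) = z * cint mu D f.
Proof.
move=> mD [f1 f2]; rewrite /cint.
under eq_Rintegral do rewrite complex_ReM; under [X in _ +i* X]eq_Rintegral do rewrite complex_ImM.
rewrite bRintegral_B//; try exact: bmeasZ.
rewrite bRintegral_D//; try exact: bmeasZ.
by rewrite !bRintegral_Z//; case: z => a b; simpc.
Qed.

Lemma cintN mu D f : measurable D -> cbm D f ->
  cint mu D (fun x => - f x) = - cint mu D f.
Proof.
move=> mD bf; rewrite -mulN1r -cintZ//; congr cint; apply/funext => x.
by rewrite mulN1r.
Qed.

Lemma cint_sum mu D n (F : nat -> R -> R[i]) : measurable D -> (forall k, cbm D (F k)) ->
  cint mu D (fun x => \sum_(k < n) F k x) = \sum_(k < n) cint mu D (F k).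
Proof.
move=> mD bF; elim: n => [|n IH].
  rewrite big_ord0 /cint; under eq_Rintegral do rewrite big_ord0 /=.
  under [X in _ +i* X]eq_Rintegral do rewrite big_ord0 /=.
  by rewrite !Rintegral_cst// !mul0r.
rewrite big_ord_recr /= -IH -cintD//; last exact: cbm_sum.
by congr cint; apply/funext => x; rewrite big_ord_recr.
Qed.

(** Real and imaginary parts are bounded separately, whence the factor 2; it only enters
    constants. *)
Lemma cint_norm mu D f (M : R) : measurable D -> 0 <= M -> cbm D f ->
  (forall x, D x -> normc (f x) <= M) -> normc (cint mu D f) <= 2 * M.
Proof.
move=> mD M0 [[f1 _] [f2 _]] fM; apply: le_trans (normc_le _) _.
have -> : 2 * M = M + M by ring.
apply: lerD; apply: bRintegral_norm => // x Dx; apply: le_trans (fM x Dx).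
  exact: normc_ge_absRe.
exact: normc_ge_absIm.
Qed.

Lemma cint_expansion mu D z b (d : R) n : measurable D -> 0 < d ->
  (forall y, D y -> d <= normc (y%:C + z)) -> normc b <= d / 2 ->
  normc (cint mu D (fun y => (y%:C + (z + b))^-1) -
     \sum_(k < n) ((-1) ^+ k * cint mu D (fun y => (y%:C + z)^-1 ^+ k.+1)) * b ^+ k) <=
  4 / d * (d^-1 * normc b) ^+ n.
Proof.
move=> mD d0 Dd bd.
have d20 : 0 < d / 2 by rewrite divr_gt0.
have di0 : 0 <= d^-1 by rewrite invr_ge0 ltW.
have nb0 w : 0 <= normc w by exact: (abv_ge0 absC).
have zb y : D y -> d / 2 <= normc (y%:C + (z + b)).
  move=> Dy; have := Dd y Dy.
  have : normc (y%:C + z) <= normc (y%:C + (z + b)) + normc b.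
    have := le_normcD (y%:C + (z + b)) (- b); rewrite normcN.
    by rewrite (_ : y%:C + (z + b) + - b = y%:C + z); last by ring.
  lra.
have bt := cbm_resolvent d0 Dd; have bb := cbm_resolvent d20 zb.
have btn k : cbm D (fun y => (- b) ^+ k * (y%:C + z)^-1 ^+ k.+1).
  by apply: cbmZ; exact: cbmX.
have -> : \sum_(k < n) ((-1) ^+ k * cint mu D (fun y => (y%:C + z)^-1 ^+ k.+1)) * b ^+ k =
   cint mu D (fun y => \sum_(k < n) (- b) ^+ k * (y%:C + z)^-1 ^+ k.+1).
  rewrite (@cint_sum mu D n (fun (k : nat) (y : R) => (- b) ^+ k * (y%:C + z)^-1 ^+ k.+1))//.
  apply: eq_bigr => k _; rewrite cintZ//; last exact: cbmX.
  by rewrite [in RHS]exprNn; ring.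
rewrite -cintN//; last exact: (@cbm_sum D n (fun (k : nat) (y : R) => (- b) ^+ k * (y%:C + z)^-1 ^+ k.+1)).
rewrite -cintD//; last first.
  by apply: cbmN; exact: (@cbm_sum D n (fun (k : nat) (y : R) => (- b) ^+ k * (y%:C + z)^-1 ^+ k.+1)).
have -> : 4 / d * (d^-1 * normc b) ^+ n = 2 * ((d / 2)^-1 * (d^-1 * normc b) ^+ n).
  by field; rewrite gt_eqF.
apply: cint_norm => //.
- by apply: mulr_ge0; rewrite ?exprn_ge0 ?mulr_ge0// invr_ge0 ltW.
- apply: cbmD => //; apply: cbmN.
  exact: (@cbm_sum D n (fun (k : nat) (y : R) => (- b) ^+ k * (y%:C + z)^-1 ^+ k.+1)).
move=> y Dy; have z0 : y%:C + z != 0.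
  by rewrite -(abv_gt0 absC) (lt_le_trans d0)// Dd.
have zb0 : y%:C + z + b != 0.
  by rewrite -addrA -(abv_gt0 absC) (lt_le_trans d20)// zb.
under eq_bigr do rewrite exprVn.
rewrite addrA geo_resolvent// -addrA (abvM absC) (abvX absC) (abvM absC) (abvN absC) !(abvV absC).
apply: ler_pM; rewrite ?exprn_ge0 ?mulr_ge0 ?invr_ge0//.
  have zb1 := zb y Dy; have zb2 : 0 < normc (y%:C + (z + b)) by apply: lt_le_trans zb1.
  by rewrite lef_pV2 ?posrE.
apply: lerXn2r; rewrite ?nnegrE ?mulr_ge0 ?invr_ge0 ?(ltW d0)//.
have zd := Dd y Dy; have z1 : 0 < normc (y%:C + z) by apply: lt_le_trans zd.
by rewrite mulrC ler_wpM2r// lef_pV2 ?posrE.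
Qed.

End complex_integral.

Lemma gexp_comp_scale {R : realType} {K : fieldType} {N : K -> R} (absN : absolute_value N)
    (D : set K) (f : K -> K) (a : nat -> K) (C M : R) (c : K) :
  0 <= M -> c != 0 -> N c <= 1 -> (forall h, D h -> D (c * h)) ->
  gexp (N := N) D f a C M ->
  gexp (N := N) D (fun h => f (c * h)) (fun n => a n * c ^+ n) C M.
Proof.
move=> M0 c0 c1 Dc fa; have C0 := gexp_ge0 absN fa; case: fa => aC fC.
have N0 := abv_ge0 absN.
split=> [n|h n Dh h0 Mh].
  rewrite (abvM absN) (abvX absN) -[leRHS]mulr1; apply: ler_pM => //.
    exact: exprn_ge0.
  exact: exprn_ile1.
have ch : N (c * h) <= N h by rewrite (abvM absN) ler_piMl.
have Mch : M * N (c * h) <= 1 by apply: le_trans Mh; rewrite ler_wpM2l.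
under eq_bigr do rewrite -mulrA -exprMn.
apply: le_trans (fC _ n (Dc h Dh) _ Mch) _; first by rewrite mulf_neq0.
by rewrite ler_wpM2l// lerXn2r ?nnegrE ?mulr_ge0// ler_wpM2l.
Qed.

Section mean_value.
Context {R : realType}.

Lemma mean_value_bound (g dg : R -> R) (x B : R) :
  (forall y : R, `|y| <= `|x| -> is_derive y 1 g (dg y)) ->
  (forall y : R, `|y| <= `|x| -> `|dg y| <= B) ->
  `|g x - g 0| <= B * `|x|.
Proof.
move=> gd gB.
have main (y z : R) : y < z -> (forall w, y <= w <= z -> `|w| <= `|x|) ->
   `|g z - g y| <= B * (z - y).
  move=> yz yzx.
  have [||w] := @MVT R g dg y z yz.
  - by move=> w; rewrite in_itv /= => /andP[yw wz]; apply: gd; apply: yzx; rewrite (ltW yw) (ltW wz).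
  - apply: derivable_within_continuous => w; rewrite in_itv /= => yw.
    by have := gd w (yzx w yw); case.
  rewrite in_itv /= => /andP[yw wz] ->; have zy : 0 <= z - y by rewrite subr_ge0 ltW.
  rewrite normrM [X in _ * X]ger0_norm// ler_wpM2r//; apply: gB.
  by apply: yzx; rewrite (ltW yw) (ltW wz).
have [xlt|xgt|->] := ltgtP x 0; last by rewrite subrr !normr0 mulr0.
- have := main x 0 xlt; rewrite distrC sub0r ltr0_norm//; apply.
  by move=> w /andP[xw w0]; rewrite !ler0_norm ?lerN2// ltW.
- have := main 0 x xgt; rewrite subr0 [`|x|]gtr0_norm//; apply.
  by move=> w /andP[w0 wx]; rewrite ger0_norm.
Qed.

End mean_value.

(** * The complex exponential and its expansion along the axes *)

Section complex_exponential.
Context {R : realType}.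
Local Notation Re := complex.Re.
Local Notation Im := complex.Im.
Local Notation normc := (@Normc.normc R).
Let absC := absolute_value_normc R.

Definition cis (t : R) : R[i] := cos t +i* sin t.
Definition cexp (z : R[i]) : R[i] := (expR (Re z))%:C * cis (Im z).

Lemma normc_cis t : normc (cis t) = 1.
Proof. by rewrite normc_ReIm /= cos2Dsin2 sqrtr1. Qed.

Lemma cisD s t : cis (s + t) = cis s * cis t.
Proof. rewrite /cis cosD sinD; simpc; congr (_ +i* _); ring. Qed.

Lemma normc_cexp z : normc (cexp z) = expR (Re z).
Proof. by rewrite (abvM absC) normc_cis mulr1 normc_real ger0_norm// expR_ge0. Qed.

Lemma cexpD z w : cexp (z + w) = cexp z * cexp w.
Proof. rewrite /cexp complex_ReD complex_ImD expRD cisD rmorphM; ring. Qed.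

Lemma cexp_real (x : R) : cexp x%:C = (expR x)%:C.
Proof. by rewrite /cexp /cis /= cos0 sin0 complexr0 mulr1. Qed.

Lemma cexp0 : cexp 0 = 1.
Proof. by have := cexp_real 0; rewrite expR0. Qed.

Lemma cexpN z : cexp (- z) = (cexp z)^-1.
Proof.
have z0 : cexp z != 0 by rewrite -(abv_eq0 absC) normc_cexp gt_eqF// expR_gt0.
by apply: (mulfI z0); rewrite -cexpD subrr cexp0 divff.
Qed.

Lemma cexp_imag (t : R) : cexp (0 +i* t) = cis t.
Proof. by rewrite /cexp /= expR0 mul1r. Qed.

(* The expansion of [cexp] is only needed along the coordinate axes, where it
   is that of the real functions [expR], [cos] and [sin]. *)
Definition axes : set R[i] := [set z | Re z = 0 \/ Im z = 0].

Lemma expR_remainder n (x : R) : `|x| <= 1 ->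
  `|expR x - \sum_(k < n) (k`!%:R)^-1 * x ^+ k| <= expR 1 * `|x| ^+ n.
Proof.
elim: n x => [|n IH] x x1.
  rewrite big_ord0 subr0 expr0 mulr1 ger0_norm ?expR_ge0// ler_expR.
  exact: le_trans (ler_norm _) x1.
pose g (y : R) := expR y - \sum_(k < n.+1) (k`!%:R)^-1 * y ^+ k.
pose dg (y : R) := expR y - \sum_(k < n) (k`!%:R)^-1 * y ^+ k.
have g0 : g 0 = 0.
  rewrite /g expR0 big_ord_recl expr0 mulr1 fact0 invr1 big1 ?addr0 ?subrr// => i _.
  by rewrite expr0n mulr0.
have gd (y : R) : `|y| <= `|x| -> is_derive y 1 g (dg y).
  move=> _; have py := is_derive_poly_shift (fun k => (k`!%:R)^-1) n y.
  have := is_deriveB (is_derive_expR y) py.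
  congr (is_derive _ _ _ (_ - _)); apply: eq_bigr => i _.
  by rewrite factS natrM invfM mulrA divff ?mul1r// pnatr_eq0.
have := mean_value_bound (B := expR 1 * `|x| ^+ n) gd _; rewrite g0 subr0 -mulrA -exprSr.
apply=> y yx; apply: le_trans (IH y (le_trans yx x1)) _.
by rewrite ler_wpM2l ?expR_ge0// lerXn2r ?nnegrE.
Qed.

Local Notation rei k := (Re ('i ^+ k : R[i])).
Local Notation imi k := (Im ('i ^+ k : R[i])).

(** The two inductions are coupled, since each function is up to sign the derivative of the other.
    With coefficients taken from powers of ['i] the two sums combine into the expansion of [cexp] on
    the imaginary axis. *)
Lemma trigo_remainder n (x : R) :
  `|cos x - \sum_(k < n) rei k * (k`!%:R)^-1 * x ^+ k| <= `|x| ^+ n /\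
  `|sin x - \sum_(k < n) imi k * (k`!%:R)^-1 * x ^+ k| <= `|x| ^+ n.
Proof.
elim: n x => [|n IH] x.
  by rewrite !big_ord0 !subr0 expr0 cos_max sin_max.
pose g (y : R) := cos y - \sum_(k < n.+1) rei k * (k`!%:R)^-1 * y ^+ k.
pose dg (y : R) := - (sin y - \sum_(k < n) imi k * (k`!%:R)^-1 * y ^+ k).
pose f (y : R) := sin y - \sum_(k < n.+1) imi k * (k`!%:R)^-1 * y ^+ k.
pose df (y : R) := cos y - \sum_(k < n) rei k * (k`!%:R)^-1 * y ^+ k.
have iS i : rei i.+1 = - imi i /\ imi i.+1 = rei i.
  by rewrite exprS complex_ReM complex_ImM /= !mul0r !mul1r sub0r add0r.
have fS i : (i.+1%:R : R) * (i.+1`!%:R)^-1 = (i`!%:R)^-1.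
  by rewrite factS natrM invfM mulrA divff ?mul1r// pnatr_eq0.
have g0 : g 0 = 0.
  rewrite /g cos0 big_ord_recl !expr0 fact0 invr1 !mulr1 big1 ?addr0 ?subrr// => i _.
  by rewrite expr0n mulr0.
have f0 : f 0 = 0.
  rewrite /f sin0 big_ord_recl !expr0 fact0 invr1 !mulr1 big1 ?addr0 ?subrr// => i _.
  by rewrite expr0n mulr0.
have gd (y : R) : `|y| <= `|x| -> is_derive y 1 g (dg y).
  move=> _; have py := is_derive_poly_shift (fun k => rei k * (k`!%:R)^-1) n y.
  have := is_deriveB (is_derive_cos y) py.
  congr (is_derive _ _ _ _); rewrite /dg opprB addrC; congr (_ + _).
  rewrite -sumrN; apply: eq_bigr => i _; have [-> _] := iS i.
  by rewrite mulrCA fS; ring.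
have fd (y : R) : `|y| <= `|x| -> is_derive y 1 f (df y).
  move=> _; have py := is_derive_poly_shift (fun k => imi k * (k`!%:R)^-1) n y.
  have := is_deriveB (is_derive_sin y) py.
  congr (is_derive _ _ _ (_ - _)); apply: eq_bigr => i _; have [_ ->] := iS i.
  by rewrite mulrCA fS.
split.
  have := mean_value_bound (B := `|x| ^+ n) gd _; rewrite g0 subr0 -exprSr; apply=> y yx.
  rewrite /dg normrN; have [_ H] := IH y; apply: le_trans H _.
  by rewrite lerXn2r ?nnegrE.
have := mean_value_bound (B := `|x| ^+ n) fd _; rewrite f0 subr0 -exprSr; apply=> y yx.
have [H _] := IH y; apply: le_trans H _.
by rewrite lerXn2r ?nnegrE.
Qed.

(** In the constant, [expR 1] comes from the real axis and 2 from the imaginary one, where the real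
    and imaginary parts each contribute 1. *)
Lemma cexp_gexp : gexp (N := normc) axes cexp (fun k => (k`!%:R^-1)%:C) (2 + expR 1) 1.
Proof.
have e0 := expR_ge0 (1 : R).
split=> [n|h n axh h0 /=].
  rewrite expr1n mulr1 normc_real ger0_norm ?invr_ge0//.
  apply: (@le_trans _ _ 1); last by lra.
  by rewrite invf_le1 ?ltr0n ?fact_gt0// ler1n fact_gt0.
rewrite mul1r; case: axh => [hr|hi].
  have -> : h = 0 +i* Im h by case: h hr {h0} => a b /= ->.
  set b := Im h; rewrite cexp_imag normc_imag => b1; have [H1 H2] := trigo_remainder n b.
  have -> : \sum_(k < n) (k`!%:R^-1)%:C * (0 +i* b) ^+ k =
    (\sum_(k < n) rei k * k`!%:R^-1 * b ^+ k) +i* (\sum_(k < n) imi k * k`!%:R^-1 * b ^+ k).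
    elim: (n) => [|m IHm]; first by rewrite !big_ord0.
    rewrite !big_ord_recr /= IHm.
    have -> : (0 +i* b) = 'i * b%:C by simpc.
    rewrite exprMn -rmorphXn; move: ('i ^+ m : R[i]) => w.
    have E (c d : R) : c%:C * (w * d%:C) = (Re w * c * d) +i* (Im w * c * d).
      apply/eqP; rewrite eq_complex; apply/andP.
      by split; apply/eqP; rewrite !(complex_ReM, complex_ImM) /=; ring.
    by rewrite E; simpc.
  apply: le_trans (normc_le _) _; rewrite /cis; simpc => /=.
  rewrite mulrDl; apply: (@le_trans _ _ (`|b| ^+ n + `|b| ^+ n)); first exact: lerD.
  have : 0 <= expR 1 * `|b| ^+ n by rewrite mulr_ge0// exprn_ge0.
  set X := `|b| ^+ n; lra.
have -> : h = (Re h)%:C by case: h hi {h0} => a b /= ->.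
set a := Re h; rewrite cexp_real normc_real => a1; have H := expR_remainder n a1.
have -> : \sum_(k < n) (k`!%:R^-1)%:C * a%:C ^+ k = (\sum_(k < n) k`!%:R^-1 * a ^+ k)%:C.
  by rewrite rmorph_sum; apply: eq_bigr => i _; rewrite rmorphM rmorphXn.
rewrite -rmorphB normc_real; apply: le_trans H _.
by rewrite ler_wpM2r ?exprn_ge0// lerDr.
Qed.

End complex_exponential.

Section arc.
Context {R : realType}.
Local Notation Re := complex.Re.
Local Notation Im := complex.Im.
Local Notation normc := (@Normc.normc R).
Let absC := absolute_value_normc R.
Context {alpha : R} (a12 : 1 < alpha <= 2).

(* [zmap (ln u) = u + u `^ (1 - alpha)], continued to complex [u]. *)
Definition zmap (z : R[i]) : R[i] := cexp z + cexp ((1 - alpha)%:C * z).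
(** The logarithm of [rho * exp (- i phi)]. In this coordinate the real half-line and the arc are
    parallel to the axes, so all the increments needed lie in [axes]. *)
Definition polar (rho phi : R) : R[i] := ln rho +i* (- phi).

Lemma expR_mul_ln (x a : R) : 0 < x -> expR (a * ln x) = x `^ a.
Proof. by move=> x0; rewrite /powR gt_eqF. Qed.

Lemma cexp_polar rho phi : 0 < rho -> cexp (polar rho phi) = rho%:C * cis (- phi).
Proof. by move=> r0; rewrite /cexp /polar /= lnK. Qed.

Lemma cexp_polar_scaled rho phi : 0 < rho ->
  cexp ((1 - alpha)%:C * polar rho phi) = (rho `^ (1 - alpha))%:C * cis ((alpha - 1) * phi).
Proof.
move=> r0; rewrite /cexp complex_ReM complex_ImM /polar /=.
rewrite !mul0r subr0 addr0 expR_mul_ln//; congr (_ * cis _); ring.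
Qed.

Lemma powR_1alpha_le1 rho : 1 <= rho -> 0 < rho `^ (1 - alpha) <= 1.
Proof.
move=> r1; have r0 : 0 < rho by lra.
rewrite powR_gt0//=; apply: (@le_trans _ _ (rho `^ 0)); last by rewrite powRr0.
by apply: ler_powR => //; case/andP: a12 => *; lra.
Qed.

(** This keeps the poles off the support along the whole arc. If [cos phi >= 1 / 2] the real part
    suffices, thanks to [y >= - c]; otherwise [sin phi >= 1 / 2] and the imaginary part does. The
    bound [2 * c + 6] serves both cases. *)
Lemma zmap_lower (c rho phi y : R) : 0 < c -> 2 * c + 6 <= rho -> 0 <= phi <= pi / 2 ->
  - c <= y -> 2 <= normc (y%:C + zmap (polar rho phi)).
Proof.
move=> c0 rc /andP[p0 p1] yc; have r1 : 1 <= rho by lra.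
have r0 : 0 < rho by lra.
have /andP[q0 q1] := powR_1alpha_le1 r1.
have /andP[a1 a2] := a12.
have ap0 : 0 <= (alpha - 1) * phi by rewrite mulr_ge0// subr_ge0 ltW.
have ap1 : (alpha - 1) * phi <= pi / 2.
  by apply: le_trans p1; rewrite ler_piMl//; lra.
have pi0 := pi_gt0 R.
have cos1 : 0 <= cos phi by apply: cos_ge0_pihalf; apply/andP; split; lra.
have cos2 : 0 <= cos ((alpha - 1) * phi) by apply: cos_ge0_pihalf; apply/andP; split; lra.
have sin1 : 0 <= sin phi by apply: sin_ge0_pi; apply/andP; split; lra.
have sin2 : sin ((alpha - 1) * phi) <= 1 by exact: sin_le1.
rewrite /zmap cexp_polar// cexp_polar_scaled//.
have [ch|ch] := leP 2^-1 (cos phi).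
  apply: le_trans (normc_ge_absRe _); apply: le_trans (ler_norm _).
  rewrite !complex_ReD !complex_ReM /= cosN !mul0r !subr0.
  have : 0 <= rho `^ (1 - alpha) * cos ((alpha - 1) * phi) by rewrite mulr_ge0// ltW.
  nra.
apply: le_trans (normc_ge_absIm _); rewrite -normrN; apply: le_trans (ler_norm _).
rewrite !complex_ImD !complex_ImM /= sinN !mul0r !addr0 add0r.
have : rho `^ (1 - alpha) * sin ((alpha - 1) * phi) <= 1.
  by apply: le_trans q1; rewrite ler_piMr// ltW.
have := cos2Dsin2 phi => cs.
have sh : 2^-1 <= sin phi by nra.
nra.
Qed.

Context {T : Type} {F : set_system T} {FF : Filter F} (lam : T -> probability R R).
Context {c : R} (c0 : 0 < c).
Local Notation D := (`[- c, +oo[%classic : set R).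
Hypothesis real_limit : forall rho d, c + 2 <= rho -> 0 < d -> \forall t \near F,
  `|\int[lam t]_(y in D) (y + (rho + rho `^ (1 - alpha)))^-1 - rho^-1| < d.

Definition resolvent_limit (z : R[i]) := forall d, 0 < d -> \forall t \near F,
  normc (cint (lam t) D (fun y => (y%:C + zmap z)^-1) - cexp (- z)) < d.

Lemma resolvent_limit_real rho : c + 2 <= rho -> resolvent_limit (polar rho 0).
Proof.
move=> rc d d0; have r0 : 0 < rho by apply: lt_le_trans rc; rewrite addr_gt0.
have -> : polar rho 0 = (ln rho)%:C by rewrite /polar oppr0.
have -> : zmap (ln rho)%:C = (rho + rho `^ (1 - alpha))%:C.
  rewrite /zmap -rmorphM !cexp_real lnK ?posrE// expR_mul_ln//.
  by rewrite -rmorphD.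
rewrite cexpN cexp_real lnK ?posrE//.
apply: filterS (real_limit rc d0) => t.
rewrite -fmorphV; set s := rho + _.
have -> : cint (lam t) D (fun y => (y%:C + s%:C)^-1) = (\int[lam t]_(y in D) (y + s)^-1)%:C.
  have E (y : R) : (y%:C + s%:C)^-1 = ((y + s)^-1)%:C by rewrite -rmorphD -fmorphV.
  rewrite /cint; congr (_ +i* _); first by apply: eq_Rintegral => y _; rewrite E.
  by under eq_Rintegral do rewrite E /=; rewrite Rintegral_cst// mul0r.
by rewrite -rmorphB normc_real.
Qed.

Lemma axesZ (x : R) h : axes h -> axes (x%:C * h).
Proof.
by rewrite /axes /= complex_ReM complex_ImM /= !mul0r subr0 addr0 => -[->|->]; [left|right]; rewrite mulr0.
Qed.

(** The radius [r] depends on [rho] but not on [phi], so finitely many steps cover the arc. As on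
    the real line, both sides are expanded in powers of the increment of [zmap]; [zmap_lower]
    already bounds the kernel, so [vitali_val] takes the place of the support argument. *)
Lemma arc_step rho : 2 * c + 6 <= rho -> exists2 r, 0 < r & forall phi, 0 <= phi <= pi / 2 ->
  (forall d, 0 < d -> exists h, [/\ axes h, h != 0, normc h < d & resolvent_limit (polar rho phi + h)]) ->
  forall h, axes h -> h != 0 -> normc h <= r -> resolvent_limit (polar rho phi + h).
Proof.
have cpos := c0; move=> rc; have r1 : 1 <= rho by lra.
have r0 : 0 < rho by lra.
have /andP[q0 q1] := powR_1alpha_le1 r1.
have /andP[a1 a2] := a12.
pose Ce : R := 2 + expR 1; have Ce0 : 0 < Ce by rewrite addr_gt0// expR_gt0.
(* The two exponentials in [zmap] have modulus [rho] and at most 1, whence [Cz]; [M2] is the rate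
   that [gexp_inv] returns for the lower bound 1 on the derivative, and [K] the one that
   [gexp_reparam] returns. *)
pose Cz := Ce * (rho + 1); have Cz0 : 0 < Cz by rewrite mulr_gt0// addr_gt0.
pose M2 := 2 * 1 * (1 + Cz * 1 / 1).
have M20 : 0 < M2 by rewrite /M2; lra.
pose K := 3 * (2 / 1) * (2 * M2).
have K0 : 0 < K by rewrite /K; lra.
pose M' := K + 1; have M'0 : 0 < M' by rewrite /M'; lra.
have M2p : 0 < 2 * M2 by apply: mulr_gt0.
have M'p : 0 < 2 * M' * Cz by apply: mulr_gt0 => //; exact: mulr_gt0.
exists (Num.min (2 * M2)^-1 (2 * M' * Cz)^-1).
  by rewrite lt_min !invr_gt0 M2p.
move=> phi phi01 acc h axh hne; rewrite le_min => /andP[hr1 hr2].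
have nb0 w : 0 <= normc w by exact: (abv_ge0 absC).
set z0 := polar rho phi.
have nz0 : normc (cexp z0) = rho.
  by rewrite /z0 cexp_polar// (abvM absC) normc_cis mulr1 normc_real ger0_norm// ltW.
have nz1 : normc (cexp ((1 - alpha)%:C * z0)) = rho `^ (1 - alpha).
  by rewrite /z0 cexp_polar_scaled// (abvM absC) normc_cis mulr1 normc_real ger0_norm// ltW.
pose ek k : R[i] := (k`!%:R^-1)%:C.
pose b k := cexp z0 * ek k + cexp ((1 - alpha)%:C * z0) * (ek k * (1 - alpha)%:C ^+ k).
have zE h' : zmap (z0 + h') = cexp z0 * cexp h' + cexp ((1 - alpha)%:C * z0) * cexp ((1 - alpha)%:C * h').
  by rewrite /zmap cexpD mulrDr cexpD.
have b0E : b 0%N = zmap z0 by rewrite /b /ek fact0 invr1 rmorph1 expr0 !mulr1.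
have ane : (1 - alpha)%:C != 0 by rewrite eq_complex /= eqxx andbT; apply/negP => /eqP; lra.
have an1 : normc (1 - alpha)%:C <= 1 by rewrite normc_real ler_norml; lra.
have zexp : gexp (N := normc) axes (fun h' => zmap (z0 + h')) b Cz 1.
  have H := gexpD absC (gexpZ absC (cexp z0) (cexp_gexp (R := R)))
    (gexpZ absC (cexp ((1 - alpha)%:C * z0)) (gexp_comp_scale absC ler01 ane an1 (fun h' => @axesZ _ h') (cexp_gexp (R := R)))).
  have {}H := gexp_weak absC (M' := 1) (C' := Cz) _ _ H.
  apply: (@gexp_eq _ _ _ _ _ _ _ _ _ _ (H _ _)) => [h' _ _ _||]; first by rewrite zE.
    by rewrite ler01 lexx.
  have : rho `^ (1 - alpha) * Ce <= Ce by rewrite ler_piMl// ltW.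
  rewrite nz0 nz1 -/Ce /Cz; lra.
pose beta h' := zmap (z0 + h') - zmap z0.
have sexp : gexp (N := normc) axes (fun h' => beta h' / h') (fun n => b n.+1) (Cz * 1) 1.
  by have := gexp_shift absC ler01 zexp; rewrite b0E.
(* The derivative of [zmap] is at least [rho - 1] in modulus, because [|1 - alpha| <= 1]. *)
have b1 : 1 <= normc (b 1%N).
  have -> : b 1%N = cexp z0 + (1 - alpha)%:C * cexp ((1 - alpha)%:C * z0).
    by rewrite /b /ek (_ : 1`! = 1)%N// invr1 rmorph1 expr1; ring.
  set w := _ * _; have : normc (cexp z0) <= normc (cexp z0 + w) + normc w.
    by rewrite -{1}(addrK w (cexp z0)); apply: abvB absC _ _.
  have : normc w <= 1.
    by rewrite /w (abvM absC) nz1 mulr_ile1// ltW.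
  rewrite nz0; lra.
have [blow [kk kexp]] := gexp_inv absC ler01 ltr01 b1 sexp.
have {}blow h' : axes h' -> h' != 0 -> 2 * M2 * normc h' <= 1 -> beta h' != 0.
  move=> axh' h'0 Mh'; apply/eqP => bh0.
  have := blow h' axh' h'0 _; rewrite bh0 mul0r (abv0 absC) => H.
  suff : 1 / 2 <= 0 :> R by lra.
  apply: H; apply: le_trans Mh'; rewrite ler_wpM2r// -/M2; lra.
have kb h' : axes h' -> h' != 0 -> 2 * M2 * normc h' <= 1 -> (beta h' / h')^-1 * beta h' = h'.
  move=> axh' h'0 Mh'; have bh0 := blow h' axh' h'0 Mh'.
  by field; rewrite h'0 bh0.
pose N0 h' := cexp (- (z0 + h')).
have m1ne : (-1)%:C != 0 :> R[i] by rewrite eq_complex /= oppr_eq0 oner_eq0.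
have m1n : normc (-1)%:C <= 1 by rewrite normc_real normrN1.
have [nn Nexp] : exists nn, gexp (N := normc) axes N0 nn Ce (2 * M2).
  have H := gexpZ absC (cexp (- z0)) (gexp_comp_scale absC ler01 m1ne m1n (fun h' => @axesZ _ h') (cexp_gexp (R := R))).
  eexists; have {}H := gexp_weak absC (M' := 2 * M2) (C' := Ce) _ _ H.
  apply: (@gexp_eq _ _ _ _ _ _ _ _ _ _ (H _ _)) => [h' _ _ _||].
  - by rewrite /N0 -cexpD rmorphN rmorph1 mulN1r opprD.
  - rewrite ler01 /=; rewrite /M2; lra.
  - by rewrite cexpN (abvV absC) nz0 ler_piMl ?(ltW Ce0)// invf_le1.
have [m [mC mE]] := gexp_reparam absC (ltW M20) kb kexp Nexp.
rewrite -/K in mC mE.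
pose Dh := [set h' : R[i] | [/\ axes h', h' != 0 & 2 * M2 * normc h' <= 1]].
pose a (t : T) n := (-1) ^+ n * cint (lam t) D (fun y => (y%:C + zmap z0)^-1 ^+ n.+1) - m n.
pose f (t : T) h' := cint (lam t) D (fun y => (y%:C + zmap (z0 + h'))^-1) - cexp (- (z0 + h')).
have mD : measurable D by exact: measurable_itv.
have Dd y : D y -> 2 <= normc (y%:C + zmap z0).
  by rewrite /= in_itv /= andbT => yc; apply: zmap_lower phi01 yc.
have bCz h' : axes h' -> h' != 0 -> normc h' <= 1 -> normc (beta h') <= Cz * normc h'.
  move=> axh' h'0 h'1; have := gexp_near0 zexp axh' h'0; rewrite mul1r b0E; exact.
have M21 : 1 <= 2 * M2 by rewrite /M2; lra.
have small h' : 2 * M2 * normc h' <= 1 -> normc h' <= 1.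
  by apply: le_trans; rewrite ler_peMl.
have Mh : 2 * M2 * normc h <= 1.
  by move: hr1; rewrite -[(2 * M2)^-1]div1r ler_pdivlMr// mulrC.
move=> d d0.
apply: (@vitali_val R R[i] normc absC T R[i] F _ beta a f Dh (2 + Ce) M' (ltW M'0)) => //.
- by rewrite addr_ge0// ltW.
- apply: nearW => t h' n [axh' h'0 Mh'] Mb.
  have b11 : normc (beta h') <= 1.
    apply: le_trans Mb; rewrite ler_peMl// /M'; lra.
  have -> : f t h' - \sum_(k < n) a t k * beta h' ^+ k =
    (cint (lam t) D (fun y => (y%:C + (zmap z0 + beta h'))^-1) -
      \sum_(k < n) ((-1) ^+ k * cint (lam t) D (fun y => (y%:C + zmap z0)^-1 ^+ k.+1)) * beta h' ^+ k) -
    (N0 h' - \sum_(k < n) m k * beta h' ^+ k).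
    rewrite /f /a /N0; under eq_bigr do rewrite mulrBl.
    have -> : zmap z0 + beta h' = zmap (z0 + h') by rewrite /beta; ring.
    by rewrite sumrB; ring.
  apply: le_trans (abvB absC _ _) _; rewrite mulrDl; apply: lerD.
    have H := @cint_expansion R (lam t) D (zmap z0) (beta h') 2 n mD _ Dd _.
    apply: le_trans (H _ _) _ => //; first by rewrite divff.
    have -> : 4 / 2 = 2 :> R by field.
    have HH : 2^-1 * normc (beta h') <= M' * normc (beta h').
      by rewrite ler_wpM2r// /M'; lra.
    rewrite ler_wpM2l//; apply: lerXn2r => //; rewrite nnegrE mulr_ge0//.
    exact: ltW.
  apply: le_trans (mE h' n axh' h'0 Mh') _.
  have HH : K * normc (beta h') <= M' * normc (beta h').
    by rewrite ler_wpM2r// /M' lerDl.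
  rewrite ler_wpM2l ?(ltW Ce0)//; apply: lerXn2r => //; rewrite nnegrE mulr_ge0//.
    exact: ltW.
  exact: ltW.
- move=> d' d'0.
  have e0 : 0 < Num.min (2 * M2)^-1 (d' / Cz).
    by rewrite lt_min invr_gt0 M2p divr_gt0.
  have [h' [axh' h'0]] := acc _ e0; rewrite lt_min => /andP[h'1 h'2] lim.
  have Mh' : 2 * M2 * normc h' <= 1.
    by move/ltW: h'1; rewrite -[(2 * M2)^-1]div1r ler_pdivlMr// mulrC.
  exists h'; split => //; first exact: blow.
  apply: le_lt_trans (bCz _ axh' h'0 (small _ Mh')) _.
  by rewrite mulrC -ltr_pdivlMr.
- apply: (@le_trans _ _ (M' * (Cz * normc h))).
    by rewrite ler_wpM2l ?(ltW M'0)//; apply: bCz => //; exact: small.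
  move: hr2; rewrite -[(2 * M' * Cz)^-1]div1r ler_pdivlMr// => H.
  by rewrite -(@ler_pM2l _ 2)// divff//; apply: le_trans H; apply: le_of_eq; ring.
Qed.

(** Each step needs known limits accumulating at its centre. For the first step they come from the
    real half-line by enlarging the radius, afterwards from the part of the arc already covered. *)
Lemma arc_limit rho phi : 2 * c + 6 <= rho -> 0 <= phi <= pi / 2 ->
  resolvent_limit (polar rho phi).
Proof.
have cpos := c0; move=> rc phi01; have r0 : 0 < rho by lra.
have [r rgt step] := arc_step rc.
have r0' : 0 <= phi / r by rewrite divr_ge0 ?(ltW rgt)//; case/andP: phi01.
have := archi_boundP r0'; rewrite ltr_pdivrMr// => /ltW.
move: (Num.bound _) => n; move: phi phi01 {r0'}.
elim: n => [|n IH] phi /andP[p0 p1].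
  rewrite mul0r => p2; have -> : phi = 0 by apply/eqP; rewrite eq_le p0 p2.
  by apply: resolvent_limit_real; lra.
rewrite -natr1 mulrDl mul1r => p2.
have [p3|p3] := leP phi (n%:R * r); first by apply: IH; rewrite ?p0.
have nr0 : 0 <= n%:R * r by rewrite mulr_ge0// ltW.
have pgt : 0 < phi by apply: le_lt_trans p3.
have polarE (a b : R) : polar rho (a - b) = polar rho a + (0 +i* b).
  apply/eqP; rewrite eq_complex /polar complex_ReD complex_ImD /=.
  by apply/andP; split; apply/eqP; ring.
have [pr|pr] := leP phi r.
  have -> : polar rho phi = polar rho 0 + (0 +i* (- phi)).
    by rewrite -polarE sub0r opprK.
  apply: step.
  - by rewrite lexx divr_ge0// pi_ge0.
  - move=> d d0; exists (d / 2)%:C; split.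
    + by right.
    + by rewrite eq_complex /= eqxx andbT gt_eqF// divr_gt0.
    + by rewrite normc_real gtr0_norm ?divr_gt0// ltr_pdivrMr// ltr_pMr// ltr1n.
    have -> : polar rho 0 + (d / 2)%:C = polar (rho * expR (d / 2)) 0.
      rewrite /polar lnM ?posrE ?expR_gt0// expRK /real_complex_def; simpc.
      by [].
    apply: resolvent_limit_real; have : 1 <= expR (d / 2) by rewrite -expR0 ler_expR divr_ge0// ltW.
    nra.
  - by left.
  - by rewrite eq_complex /= eqxx /= oppr_eq0 gt_eqF.
  - by rewrite normc_imag normrN gtr0_norm.
have -> : polar rho phi = polar rho (phi - r) + (0 +i* (- r)).
  by rewrite -polarE; congr polar; ring.
apply: step.
- by apply/andP; split; lra.
- move=> d d0; pose e := Num.min (d / 2) (phi - r).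
  have e0 : 0 < e by rewrite lt_min divr_gt0// subr_gt0.
  have e1 : e <= d / 2 by rewrite ge_min lexx.
  have e2 : e <= phi - r by rewrite ge_min lexx orbT.
  exists (0 +i* e); split.
  + by left.
  + by rewrite eq_complex /= eqxx /= gt_eqF.
  + by rewrite normc_imag gtr0_norm//; lra.
  by rewrite -polarE; apply: IH; [apply/andP; split|]; lra.
- by left.
- by rewrite eq_complex /= eqxx /= oppr_eq0 gt_eqF.
- by rewrite normc_imag normrN gtr0_norm.
Qed.

End arc.

(** * The resolvent of the free stable law near the imaginary axis *)

Section free_stable.
Context {R : realType} {alpha : R} (a12 : 1 < alpha <= 2) (sigma : probability R R).
Local Notation Re := complex.Re.
Local Notation Im := complex.Im.
Local Notation normc := (@Normc.normc R).
Let absC := absolute_value_normc R.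
Hypothesis sigmaE : is_free_stable alpha sigma.
Local Notation zmap := (@zmap R alpha).

(** The aperture [a] of the cone is not under control, so the neighbourhood of [pi / 2] has to
    depend on it: [cos psi < a * sin psi] is the condition for [- rho * exp (- i psi)] to lie in the
    cone. *)
Lemma near_pihalf (a : R) : 0 < a -> exists2 phi, 0 <= phi < pi / 2 &
  forall psi, phi <= psi <= pi / 2 -> [/\ 0 <= cos psi, cos psi < a * sin psi & 2^-1 < sin psi].
Proof.
move=> a0; have pi0 := pi_gt0 R; pose x := (pi / 2 : R).
have x0 : 0 < x by rewrite divr_gt0.
pose e := Num.min 2^-1 (a / 2); have e0 : 0 < e by rewrite lt_min divr_gt0// andbT invr_gt0.
have e1 : e <= 2^-1 by rewrite ge_min lexx.
have e2 : e <= a / 2 by rewrite ge_min lexx orbT.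
have /cvgrPdist_lt /(_ e e0) [d1 /= d10 H1] := @continuous_cos R x.
have /cvgrPdist_lt /(_ e e0) [d2 /= d20 H2] := @continuous_sin R x.
pose d := Num.min x (Num.min d1 d2); have d0 : 0 < d by rewrite !lt_min x0 d10.
have dx : d <= x by rewrite ge_min lexx.
have dd1 : d <= d1 by rewrite !ge_min lexx orbT.
have dd2 : d <= d2 by rewrite !ge_min lexx !orbT.
exists (x - d / 2); first by apply/andP; split; rewrite -/x; lra.
move=> psi /andP[p1 p2]; rewrite -/x in p2.
have px : `|x - psi| < d by rewrite ger0_norm ?subr_ge0//; lra.
have := H1 psi (lt_le_trans px dd1); rewrite /x cos_pihalf sub0r normrN => c1.
have := H2 psi (lt_le_trans px dd2); rewrite /x sin_pihalf ltr_norml => /andP[_ s1].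
have c2 := le_lt_trans (ler_norm _) c1.
have c3 : 0 <= cos psi by apply: cos_ge0_pihalf; rewrite -/x; apply/andP; split; lra.
split => //; last by lra.
have : 2^-1 < sin psi by lra.
nra.
Qed.

(** As [sin phi > 0], the point [u] lies in the open lower half-plane and its principal argument is
    [- phi], so the power in [zmap] is the principal one. *)
Lemma zmap_free (rho phi : R) : 0 < rho -> 0 <= phi <= pi / 2 -> 0 < sin phi ->
  let u := rho%:C * cis (- phi) in
  zmap (polar rho phi) = u + principal_pow u (1 - alpha).
Proof.
move=> r0 /andP[p0 p1] s0 u; have pi0 := pi_gt0 R.
rewrite /zmap cexp_polar// cexp_polar_scaled//; congr (_ + _).
have un : normc u = rho by rewrite (abvM absC) normc_cis mulr1 normc_real gtr0_norm.
have uR : Re u = rho * cos phi by rewrite complex_ReM /= cosN mul0r subr0.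
have uI : Im u = - (rho * sin phi) by rewrite complex_ImM /= sinN mul0r addr0 mulrN.
have ua : principal_arg u = - phi.
  rewrite /principal_arg un uR uI oppr_ge0 leNgt mulr_gt0//=.
  rewrite mulrAC divff ?mul1r ?gt_eqF// cosK//.
  by rewrite in_itv /= p0 /=; lra.
rewrite /principal_pow un ua /cis mulrN -mulNr opprB.
apply/eqP; rewrite eq_complex complex_ReM complex_ImM /=.
by apply/andP; split; apply/eqP; ring.
Qed.

Lemma zmap_Im (rho phi : R) : 6 <= rho -> 2^-1 < sin phi ->
  complex.Im (zmap (polar rho phi)) <= - 2.
Proof.
move=> r6 s1; have r0 : 0 < rho by lra.
have r1 : 1 <= rho by lra.
have /andP[q0 q1] := powR_1alpha_le1 a12 r1.
rewrite /zmap cexp_polar// cexp_polar_scaled//.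
rewrite !complex_ImD !complex_ImM /= sinN !mul0r !addr0.
have : rho `^ (1 - alpha) * sin ((alpha - 1) * phi) <= 1.
  by apply: le_trans q1; rewrite ler_piMr ?(ltW q0)// sin_le1.
nra.
Qed.

Lemma zmap_lower_Im (rho phi y : R) : 6 <= rho -> 2^-1 < sin phi ->
  2 <= normc (y%:C + zmap (polar rho phi)).
Proof.
move=> r6 s1; apply: le_trans (normc_ge_absIm _); rewrite -normrN; apply: le_trans (ler_norm _).
by rewrite complex_ImD /= add0r lerNr zmap_Im.
Qed.

(** The Voiculescu transform is read at [- u] with [u = rho * exp (- i phi)]. The preimage of [- u]
    under the F-transform is [- u - u^(1 - alpha)], that is [- zmap], and there the Cauchy transform
    is [- u^-1]. *)
Lemma free_resolvent : exists2 phi1, 0 <= phi1 < pi / 2 & exists rho1, forall rho phi,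
  rho1 <= rho -> phi1 <= phi <= pi / 2 -> [/\ 2^-1 < sin phi, 0 <= cos phi &
  cint sigma setT (fun y => (y%:C + zmap (polar rho phi))^-1) = cexp (- polar rho phi)].
Proof.
case: sigmaE => a [b] [a'] [b'] [[a0 b0 _ _] _ H].
have [phi1 phi10 phiE] := near_pihalf a0; exists phi1 => //.
exists (b + 6) => rho phi rb phi12; have [c1 c2 s1] := phiE phi phi12.
have r0 : 0 < rho by lra.
have r6 : 6 <= rho by lra.
have s0 : 0 < sin phi by apply: lt_trans s1; rewrite invr_gt0.
have phi01 : 0 <= phi <= pi / 2.
  by case/andP: phi12 => p1 ->; rewrite andbT; apply: le_trans p1; case/andP: phi10.
split => //.
set u := rho%:C * cis (- phi).
have un : normc u = rho by rewrite (abvM absC) normc_cis mulr1 normc_real gtr0_norm.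
have uR : Re u = rho * cos phi by rewrite complex_ReM /= cosN mul0r subr0.
have uI : Im u = - (rho * sin phi) by rewrite complex_ImM /= sinN mul0r addr0 mulrN.
have cone : truncated_cone a b (- u).
  split.
  - have -> : Im (- u) = - Im u by case: (u).
    by rewrite uI opprK mulr_gt0.
  - have -> : Im (- u) = - Im u by case: (u).
    have -> : Re (- u) = - Re u by case: (u).
    rewrite uI opprK uR normrN ger0_norm ?mulr_ge0 ?(ltW r0)//.
    by rewrite mulrCA ltr_pM2l.
  - by rewrite (abvN absC) un; lra.
have [w [_ Fw]] := H _ cone; rewrite opprK => wE.
have zE : zmap (polar rho phi) = - w.
  by rewrite zmap_free// -/u -[principal_pow _ _]opprK wE; ring.
have G : cauchy_transform sigma w = - u^-1.
  by rewrite -[LHS]invrK -/(F_transform sigma w) Fw invrN.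
rewrite cexpN cexp_polar// -/u -[RHS]opprK -G.
have E : cauchy_transform sigma w = cint sigma setT (fun y => (w - y%:C)^-1) by [].
have bnd : cbm setT (fun y : R => (y%:C + zmap (polar rho phi))^-1).
  apply: (@cbm_resolvent R setT _ 2) => // y _; exact: zmap_lower_Im.
rewrite E; have -> : (fun y : R => (w - y%:C)^-1) = fun y => - (y%:C + zmap (polar rho phi))^-1.
  by apply/funext => y; rewrite zE -invrN opprB.
by rewrite cintN// opprK.
Qed.

End free_stable.

(** * Convergence of the moments of the resolvent *)

Section moments.
Context {R : realType} {alpha : R} (a12 : 1 < alpha <= 2) {sigma : probability R R}.
Local Notation Re := complex.Re.
Local Notation Im := complex.Im.
Local Notation normc := (@Normc.normc R).
Let absC := absolute_value_normc R.
Local Notation zmap := (@zmap R alpha).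

Lemma cexp_near1 : {C | 0 < C & forall h : R[i], axes h -> normc h <= 1 ->
  normc (cexp h - 1) <= C * normc h}.
Proof.
exists (2 + expR 1) => [|h axh h1]; first by rewrite addr_gt0// expR_gt0.
have [->|h0] := eqVneq h 0; first by rewrite cexp0 subrr (abv0 absC) mulr0.
have := gexp_near0 (cexp_gexp (R := R)) axh h0.
by rewrite (_ : 0`! = 1)%N// invr1 rmorph1 mul1r; exact.
Qed.

Lemma zmap_near (rho phi : R) : 1 <= rho -> {C | 0 < C & forall s, 0 <= s <= 1 ->
  normc (zmap (polar rho (phi + s)) - zmap (polar rho phi)) <= C * s}.
Proof.
move=> r1; have [C C0 HC] := cexp_near1.
have r0 : 0 < rho by lra.
have /andP[q0 q1] := powR_1alpha_le1 a12 r1.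
have /andP[a1 a2] := a12.
exists (C * (rho + 1)) => [|s /andP[s0 s1]]; first by apply: mulr_gt0 => //; lra.
set h : R[i] := 0 +i* (- s).
have axh : axes h by left.
have axh' : axes ((1 - alpha)%:C * h) by exact: axesZ.
have nh : normc h = s by rewrite normc_imag normrN ger0_norm.
have nh' : normc ((1 - alpha)%:C * h) <= s.
  rewrite (abvM absC) nh normc_real ler_piMl// ler_norml; lra.
have -> : polar rho (phi + s) = polar rho phi + h.
  apply/eqP; rewrite eq_complex /polar complex_ReD complex_ImD /=.
  by apply/andP; split; apply/eqP; ring.
have -> : zmap (polar rho phi + h) - zmap (polar rho phi) =
    cexp (polar rho phi) * (cexp h - 1) +
    cexp ((1 - alpha)%:C * polar rho phi) * (cexp ((1 - alpha)%:C * h) - 1).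
  by rewrite /zmap mulrDr !cexpD; ring.
have h1 : normc (cexp h - 1) <= C * s.
  by apply: le_trans (HC _ axh _) _; rewrite nh.
have h2 : normc (cexp ((1 - alpha)%:C * h) - 1) <= C * s.
  apply: le_trans (HC _ axh' (le_trans nh' s1)) _; rewrite ler_wpM2l//; exact: ltW.
apply: le_trans (abvD absC _ _) _; rewrite cexp_polar// cexp_polar_scaled//.
rewrite !(abvM absC) !normc_cis !mulr1 !normc_real (gtr0_norm r0) (gtr0_norm q0).
have -> : C * (rho + 1) * s = rho * (C * s) + 1 * (C * s) by ring.
apply: lerD; first by rewrite ler_wpM2l// ltW.
apply: ler_pM => //; [exact: ltW|exact: (abv_ge0 absC)].
Qed.

Context {T : Type} {F : set_system T} {FF : Filter F} {lam : T -> probability R R}.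
Context {c : R} (c0 : 0 < c).
Local Notation D := (`[- c, +oo[%classic : set R).
Hypothesis real_limit : forall rho d, c + 2 <= rho -> 0 < d -> \forall t \near F,
  `|\int[lam t]_(y in D) (y + (rho + rho `^ (1 - alpha)))^-1 - rho^-1| < d.
Hypothesis lamD : \forall t \near F, lam t D = 1%E.
Context {phi1 rho : R} (phi10 : 0 <= phi1 < pi / 2) (rc : 2 * c + 6 <= rho).
Hypothesis sigma_resolvent : forall phi, phi1 <= phi <= pi / 2 ->
  [/\ 2^-1 < sin phi, 0 <= cos phi &
  cint sigma setT (fun y => (y%:C + zmap (polar rho phi))^-1) = cexp (- polar rho phi)].

Definition cint_cvg (f : R -> R[i]) := cbm setT f /\ forall e, 0 < e ->
  \forall t \near F, normc (cint (lam t) setT f - cint sigma setT f) < e.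

Lemma cint_cvg_cst z : cint_cvg (fun=> z).
Proof.
split; first exact: cbm_cst.
move=> e e0; apply: nearW => t; rewrite /cint !bRintegral_cst ?probability_setT//.
by rewrite subrr (abv0 absC).
Qed.

Lemma cint_cvgD f g : cint_cvg f -> cint_cvg g -> cint_cvg (fun x => f x + g x).
Proof.
move=> [bf Hf] [bg Hg]; split; first exact: cbmD.
move=> e e0; have e2 : 0 < e / 2 by rewrite divr_gt0.
apply: filterS2 (Hf _ e2) (Hg _ e2) => t ft gt.
rewrite !cintD//.
have -> : forall a b c d : R[i], a + b - (c + d) = (a - c) + (b - d) by move=> *; ring.
apply: le_lt_trans (abvD absC _ _) _; lra.
Qed.

Lemma cint_cvgZ z f : cint_cvg f -> cint_cvg (fun x => z * f x).
Proof.
move=> [bf Hf]; split; first exact: cbmZ.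
move=> e e0; have nz : 0 < normc z + 1 by rewrite ltr_wpDl//; exact: (abv_ge0 absC).
apply: filterS (Hf _ (divr_gt0 e0 nz)) => t.
rewrite !cintZ// -mulrBr (abvM absC) ltr_pdivlMr// mulrC; apply: le_lt_trans.
by rewrite ler_wpM2r ?lerDl//; exact: (abv_ge0 absC).
Qed.

Lemma cint_cvg_Im f : cint_cvg f -> cint_cvg (fun x => (Im (f x))%:C).
Proof.
move=> [[b1 b2] Hf]; split; first by split => //=; exact: bmeas_cst.
move=> e e0; apply: filterS (Hf _ e0) => t; apply: le_lt_trans.
have E mu : cint mu setT (fun x => (Im (f x))%:C) = (Im (cint mu setT f))%:C.
  rewrite /cint /=; congr (_ +i* _).
  by rewrite Rintegral_cst// mul0r.
rewrite !E -rmorphB normc_real; apply: le_trans (normc_ge_absIm _).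
by rewrite complex_ImD; case: (cint sigma _ _).
Qed.

(** For [phi] slightly above [phi1] the resolvents of [lam t] converge to that of [sigma]. The
    difference of the two resolvents is expanded at [phi1], and [vitali_coef] turns these limits
    into convergence of the coefficients, which are the moments up to sign. *)
Lemma cint_cvg_resolventX n :
  cint_cvg (fun y => (y%:C + zmap (polar rho phi1))^-1 ^+ n.+1).
Proof.
have [c0' rc' /andP[p0 p1]] := And3 c0 rc phi10.
have r6 : 6 <= rho by lra.
have r1 : 1 <= rho by lra.
have r0 : 0 < rho by lra.
have [s1 c1 sE] := @sigma_resolvent phi1 (ltac:(rewrite lexx ltW//)).
set z1 := zmap (polar rho phi1).
have low y : 2 <= normc (y%:C + z1) by exact: zmap_lower_Im.
have bT : cbm setT (fun y : R => (y%:C + z1)^-1) by apply: (@cbm_resolvent R setT z1 2).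
split=> [|e e0]; first exact: cbmX.
have [C C0 HC] := zmap_near phi1 r1.
pose beta phi := zmap (polar rho phi) - z1.
pose f t phi := cint (lam t) setT (fun y => (y%:C + zmap (polar rho phi))^-1) -
  cint sigma setT (fun y => (y%:C + zmap (polar rho phi))^-1).
pose a t k := (-1) ^+ k * cint (lam t) setT (fun y => (y%:C + z1)^-1 ^+ k.+1) -
  (-1) ^+ k * cint sigma setT (fun y => (y%:C + z1)^-1 ^+ k.+1).
suff : \forall t \near F, normc (a t n) < e.
  apply: filterS => t; rewrite /a -mulrBr (abvM absC) (abvX absC) (abvN absC) (abv1 absC).
  by rewrite expr1n mul1r.
move: n e e0; apply: (@vitali_coef R R[i] normc absC T R F FF beta a f [set phi | phi1 <= phi <= pi / 2] 4 1) => //.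
  apply: nearW => t phi n /= phiI; rewrite mul1r => b1.
  have -> : f t phi - \sum_(k < n) a t k * beta phi ^+ k =
    (cint (lam t) setT (fun y => (y%:C + (z1 + beta phi))^-1) -
      \sum_(k < n) ((-1) ^+ k * cint (lam t) setT (fun y => (y%:C + z1)^-1 ^+ k.+1)) * beta phi ^+ k) -
    (cint sigma setT (fun y => (y%:C + (z1 + beta phi))^-1) -
      \sum_(k < n) ((-1) ^+ k * cint sigma setT (fun y => (y%:C + z1)^-1 ^+ k.+1)) * beta phi ^+ k).
    rewrite /f /a; under eq_bigr do rewrite mulrBl.
    have -> : z1 + beta phi = zmap (polar rho phi) by rewrite /beta; ring.
    by rewrite sumrB; ring.
  have E mu : normc (cint mu setT (fun y => (y%:C + (z1 + beta phi))^-1) -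
      \sum_(k < n) ((-1) ^+ k * cint mu setT (fun y => (y%:C + z1)^-1 ^+ k.+1)) * beta phi ^+ k) <=
      2 * normc (beta phi) ^+ n.
    have H := @cint_expansion R mu setT z1 (beta phi) 2 n measurableT _ (fun y _ => low y) _.
    apply: le_trans (H _ _) _ => //; first by rewrite divff.
    have -> : 4 / 2 = 2 :> R by field.
    have nb := abv_ge0 absC (beta phi).
    rewrite ler_wpM2l//; apply: lerXn2r => //; rewrite ?nnegrE; lra.
  apply: le_trans (abvB absC _ _) _.
  have -> : 4 * normc (beta phi) ^+ n = 2 * normc (beta phi) ^+ n + 2 * normc (beta phi) ^+ n by ring.
  by apply: lerD; exact: E.
move=> d d0.
pose s := Num.min (Num.min 1 (pi / 2 - phi1)) (d / (2 * C)).
have s0 : 0 < s by rewrite !lt_min subr_gt0 p1 ltr01 divr_gt0// mulr_gt0.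
have ss1 : s <= 1 by rewrite !ge_min lexx.
have s2 : s <= pi / 2 - phi1 by rewrite !ge_min lexx orbT.
have s3 : s <= d / (2 * C) by rewrite !ge_min lexx orbT.
have phiI : phi1 <= phi1 + s <= pi / 2 by apply/andP; split; lra.
have [t1 u1 vE] := sigma_resolvent phiI.
exists (phi1 + s); split => //.
(* That [zmap] takes different values at the two angles is read off [sigma_resolvent]: equal values
   would give equal [cexp (- polar)], hence equal cosines on [[0, pi]]. *)
- apply/eqP => /eqP; rewrite subr_eq0 => /eqP bE.
  have : cos (phi1 + s) = cos phi1.
    have : cexp (- polar rho (phi1 + s)) = cexp (- polar rho phi1) by rewrite -vE bE -sE.
    have rC : rho%:C != 0 by rewrite eq_complex /= gt_eqF.
    rewrite !cexpN => /invr_inj; rewrite !cexp_polar// => /(mulfI rC).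
    by move/(congr1 (fun w : R[i] => Re w)); rewrite /= !cosN.
  have pi0 := pi_gt0 R.
  move/cos_inj; rewrite !in_itv /=.
  move=> /(_ (ltac:(apply/andP; split; lra)) (ltac:(apply/andP; split; lra))); lra.
- have := HC s; rewrite (ltW s0) ss1 => /(_ isT) H; apply: le_lt_trans H _.
  have C2 : 0 < 2 * C by rewrite mulr_gt0.
  move: s3; rewrite ler_pdivlMr// => s3; nra.
move=> e e0.
have phi01 : 0 <= phi1 + s <= pi / 2 by apply/andP; split; lra.
have H := @arc_limit R alpha a12 T F FF lam c c0 real_limit rho (phi1 + s) rc phi01 e e0.
apply: filterS2 lamD H => t Dt; rewrite /f vE.
have [b1 b2] : cbm setT (fun y : R => (y%:C + zmap (polar rho (phi1 + s)))^-1).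
  by apply: (@cbm_resolvent R setT _ 2) => // y _; exact: zmap_lower_Im.
have mD : measurable D by exact: measurable_itv.
by rewrite /cint -!(Rintegral_full mD Dt)//; [case: b2|case: b1].
Qed.

(* With [V = |th|^2] and [b = Im z], the moments of [V ^+ j * th ^+ n] follow by
   induction from [V = - Im th / b] and [- 2 i b V th = th ^+ 2 - V]. *)
Lemma sqr_resolvent_cvg j n :
  cint_cvg (fun y => (((y + Re (zmap (polar rho phi1))) ^+ 2 +
    Im (zmap (polar rho phi1)) ^+ 2)^-1)%:C ^+ j * (y%:C + zmap (polar rho phi1))^-1 ^+ n).
Proof.
have [c0' rc' /andP[p0 p1]] := And3 c0 rc phi10.
have r6 : 6 <= rho by lra.
have [s1 c1 _] := @sigma_resolvent phi1 (ltac:(rewrite lexx ltW//)).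
have low y : 2 <= normc (y%:C + zmap (polar rho phi1)) by exact: zmap_lower_Im.
have b2 := zmap_Im a12 r6 s1.
have Hr := cint_cvg_resolventX.
move: low b2 Hr; case: (zmap _) => x b low b2 Hr; have {}b2 : b <= - 2 := b2.
have bne : b != 0 by apply/eqP => b0; lra.
set V := fun y => ((y + x) ^+ 2 + b ^+ 2)^-1.
set th := fun y : R => (y%:C + (x +i* b))^-1.
change (cint_cvg (fun y => (V y)%:C ^+ j * th y ^+ n)).
have wne y : y%:C + (x +i* b) != 0.
  by apply/eqP => w0; have := low y; rewrite w0 (abv0 absC); lra.
pose ib : R[i] := 0 +i* b.
have ibne : ib != 0 by rewrite eq_complex /= eqxx.
have w'ne y : y%:C + (x +i* b) - 2 * ib != 0.
  apply/eqP => /(congr1 (fun w : R[i] => Im w)).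
  rewrite !complex_ImD -mulNr complex_ImM /=; lra.
have VE y : (V y)%:C = ((y%:C + (x +i* b)) * (y%:C + (x +i* b) - 2 * ib))^-1.
  rewrite /V fmorphV; congr (_^-1).
  apply/eqP; rewrite eq_complex -mulNr !(complex_ReM, complex_ImM, complex_ReD, complex_ImD) /=.
  by apply/andP; split; apply/eqP; ring.
have key y : (V y)%:C * th y = (- 2 * ib)^-1 * (th y ^+ 2 - (V y)%:C).
  rewrite VE /th; field; rewrite wne ibne andbT /=.
  by rewrite andbT w'ne.
have ImV y : (V y)%:C = (- b^-1)%:C * (Im (th y))%:C.
  have Im_inv (w : R[i]) : Im w^-1 = - (Im w / (Re w ^+ 2 + Im w ^+ 2)) by case: w.
  rewrite -rmorphM; congr (_%:C); rewrite /th Im_inv complex_ImD complex_ReD /= add0r -/(V y).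
  by rewrite mulrNN mulrA mulVf ?mul1r.
elim: j n => [|j IH] n.
  case: n => [|n]; last by under eq_fun do rewrite mul1r; exact: Hr.
  by under eq_fun do rewrite mul1r; exact: cint_cvg_cst.
elim: n => [|n IHn].
  have -> : (fun y => (V y)%:C ^+ j.+1 * th y ^+ 0) =
      fun y => (- b^-1)%:C * (Im ((V y)%:C ^+ j * th y ^+ 1))%:C.
    apply/funext => y; rewrite expr0 mulr1 expr1 exprSr {2}ImV mulrCA; congr (_ * _).
    by rewrite -rmorphXn complex_ImM /= mul0r addr0 -rmorphM.
  exact/cint_cvgZ/cint_cvg_Im.
have -> : (fun y => (V y)%:C ^+ j.+1 * th y ^+ n.+1) =
   fun y => (- 2 * ib)^-1 * ((V y)%:C ^+ j * th y ^+ n.+2 + -1 * ((V y)%:C ^+ j.+1 * th y ^+ n)).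
  apply/funext => y.
  have -> : (V y)%:C ^+ j.+1 * th y ^+ n.+1 = (V y)%:C ^+ j * th y ^+ n * ((V y)%:C * th y).
    by rewrite !exprS; ring.
  by rewrite key !exprS; ring.
by apply: cint_cvgZ; apply: cint_cvgD => //; exact: cint_cvgZ.
Qed.

Lemma sqr_resolvent_moment n e : 0 < e ->
  let V y := ((y + Re (zmap (polar rho phi1))) ^+ 2 + Im (zmap (polar rho phi1)) ^+ 2)^-1 in
  \forall t \near F, `|\int[lam t]_y V y ^+ n - \int[sigma]_y V y ^+ n| < e.
Proof.
move=> e0 V; have [_ /(_ e e0)] := sqr_resolvent_cvg n 0.
apply: filterS => t; apply: le_lt_trans.
have E mu : Re (cint mu setT (fun y => (V y)%:C ^+ n * (y%:C + zmap (polar rho phi1))^-1 ^+ 0)) =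
    \int[mu]_y V y ^+ n.
  by apply: eq_Rintegral => y _; rewrite expr0 mulr1 -rmorphXn.
rewrite -!E; apply: le_trans (normc_ge_absRe _).
by rewrite complex_ReD; case: (cint sigma _ _).
Qed.

End moments.

(** * Bernstein polynomials and weak convergence *)

Section bernstein.
Context {R : realType}.
Implicit Types (g h : nat -> R) (x a : R).

(** The expectation of [g] at a binomial variable, obtained by conditioning on one trial; this
    recursion spares the binomial coefficients. *)
Fixpoint bernstein n g x : R :=
  if n is m.+1 then x * bernstein m (g \o succn) x + (1 - x) * bernstein m g x else g 0%N.

Lemma bernsteinD n g h x :
  bernstein n (fun k => g k + h k) x = bernstein n g x + bernstein n h x.
Proof.
elim: n g h => //= n IH g h.
have E : bernstein n ((fun k => g k + h k) \o succn) x = _ := IH (g \o succn) (h \o succn).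
by rewrite E IH; ring.
Qed.

Lemma bernsteinZ n a g x : bernstein n (fun k => a * g k) x = a * bernstein n g x.
Proof.
elim: n g => //= n IH g.
have E : bernstein n ((fun k => a * g k) \o succn) x = _ := IH (g \o succn).
by rewrite E IH; ring.
Qed.

Lemma bernstein_cst n a x : bernstein n (fun=> a) x = a.
Proof.
by elim: n => //= n IH; rewrite (_ : (fun=> a) \o succn = (fun=> a))// IH; ring.
Qed.

Lemma bernstein_le n g h x : 0 <= x <= 1 -> (forall k, g k <= h k) ->
  bernstein n g x <= bernstein n h x.
Proof.
move=> /andP[x0 x1]; elim: n g h => //= n IH g h gh.
by apply: lerD; rewrite ler_wpM2l ?subr_ge0//; apply: IH => // k; exact: gh.
Qed.

(** Variance plus squared bias of a binomial variable. An arbitrary [a] is what makes the induction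
    work, since a success shifts [a] by one. *)
Lemma bernstein_sqr n a x :
  bernstein n (fun k => (k%:R - a) ^+ 2) x = n%:R * (x * (1 - x)) + (n%:R * x - a) ^+ 2.
Proof.
elim: n a => [|n IH] a /=; first by ring.
have -> : (fun k => (k%:R - a) ^+ 2) \o succn = (fun k => (k%:R - (a - 1)) ^+ 2).
  by apply/funext => k /=; rewrite -natr1; ring.
by rewrite !IH -natr1; ring.
Qed.

(** A quadratic majorant of [|f x - f y|] replaces the usual splitting into near and far points: by
    positivity only the binomial variance enters. *)
Lemma bernstein_approx n (f : R -> R) x (e K : R) : 0 <= x <= 1 -> 0 <= K ->
  (forall y, `|f x - f y| <= e + K * (x - y) ^+ 2) ->
  `|f x - bernstein n.+1 (fun k => f (k%:R / n.+1%:R)) x| <= e + K / n.+1%:R.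
Proof.
move=> x01 K0 fK; set N := n.+1%:R; have N0 : 0 < N by rewrite ltr0n.
have E : bernstein n.+1 (fun k => K / N ^+ 2 * (k%:R - N * x) ^+ 2) x <= K / N.
  rewrite bernsteinZ bernstein_sqr -/N subrr expr0n addr0.
  have -> : K / N ^+ 2 * (N * (x * (1 - x))) = K / N * (x * (1 - x)) by field; rewrite gt_eqF.
  by rewrite ler_piMr ?divr_ge0 ?(ltW N0)//; case/andP: x01 => *; nra.
have bnd (k : nat) : `|f x - f (k%:R / N)| <= e + K / N ^+ 2 * (k%:R - N * x) ^+ 2.
  apply: le_trans (fK _) _; rewrite lerD2l; apply: le_of_eq; field.
  by rewrite gt_eqF.
have low := @bernstein_le n.+1 (fun k => f x + -1 * (e + K / N ^+ 2 * (k%:R - N * x) ^+ 2))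
  (fun k => f (k%:R / N)) x x01.
have upp := @bernstein_le n.+1 (fun k => f (k%:R / N))
  (fun k => f x + (e + K / N ^+ 2 * (k%:R - N * x) ^+ 2)) x x01.
rewrite bernsteinD bernsteinZ !bernsteinD !bernstein_cst in low.
rewrite !bernsteinD !bernstein_cst in upp.
move: E low upp; set A := bernstein _ (fun k => K / _ * _) _; set B := bernstein _ _ _.
move=> E low upp.
have {}low : f x + -1 * (e + A) <= B.
  by apply: low => k; have := bnd k; rewrite ler_norml; move: (K / _ * _) => w /andP[? ?]; lra.
have {}upp : B <= f x + (e + A).
  by apply: upp => k; have := bnd k; rewrite ler_norml; move: (K / _ * _) => w /andP[? ?]; lra.
by rewrite ler_norml; move: (K / N) E => w E; apply/andP; split; lra.
Qed.

(** Compactness gives a uniform radius for near points, even though [y] may leave [[0, 1]]; for far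
    points [K] is so large that the quadratic term exceeds [2 * B]. *)
Lemma continuous_modulus (f : R -> R) (e B : R) : continuous f -> 0 < e ->
  (forall x, `|f x| <= B) ->
  exists2 K, 0 <= K & forall x y, 0 <= x <= 1 -> `|f x - f y| <= e + K * (x - y) ^+ 2.
Proof.
move=> cf e0 fB; have B0 : 0 <= B by apply: le_trans (fB 0).
have /compact_near_coveringP := @segment_compact R 0 1.
pose P (d x : R) := forall y, `|x - y| < d -> `|f x - f y| < e.
move=> /(_ _ (0 : R)^'+ P _) /=.
case.
  move=> x x01; have e2 : 0 < e / 2 by rewrite divr_gt0.
  have /cvgrPdist_lt /(_ _ e2) [d /= d0 H] := cf x.
  exists (ball x (d / 2), [set s | 0 < s < d / 2]) => /=.
    split; first by apply: nbhsx_ballx; rewrite divr_gt0.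
    exists (d / 2); first by rewrite /= divr_gt0.
    by move=> s /=; rewrite sub0r normrN => sd s0; rewrite s0 (le_lt_trans (ler_norm _) sd).
  move=> [x' s] /= [xx' /andP[s0 sd]] y xy.
  have h1 : `|x - x'| < d by apply: lt_trans xx' _; rewrite ltr_pdivrMr// ltr_pMr// ltr1n.
  have h2 : `|x - y| < d.
    have -> : x - y = (x - x') + (x' - y) by ring.
    have xx'2 : `|x - x'| < d / 2 := xx'.
    apply: le_lt_trans (ler_normD _ _) _; lra.
  have := H _ h1; have := H _ h2.
  have -> : f x' - f y = (f x - f y) - (f x - f x') by ring.
  move=> ? ?; apply: le_lt_trans (ler_normB _ _) _; lra.
move=> d /= d0 H.
have d20 : 0 < d / 2 by rewrite divr_gt0.
have Pd : `[0, 1] `<=` P (d / 2).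
  by apply: H => //=; rewrite sub0r normrN gtr0_norm// ltr_pdivrMr// ltr_pMr// ltr1n.
exists (2 * B / (d / 2) ^+ 2); first by rewrite !mulr_ge0// invr_ge0 exprn_ge0// ltW.
move=> x y x01; have [xy|xy] := ltP `|x - y| (d / 2).
  have := Pd x; rewrite /= in_itv /= => /(_ x01 y xy) /ltW /le_trans; apply.
  by rewrite lerDl mulr_ge0 ?sqr_ge0// !mulr_ge0// invr_ge0 exprn_ge0// ltW.
apply: (@le_trans _ _ (2 * B)).
  by apply: le_trans (ler_normB _ _) _; have := fB x; have := fB y; lra.
apply: ler_wpDl; first exact: ltW.
rewrite mulrAC ler_pdivlMr ?exprn_gt0//; apply: ler_wpM2l; first by rewrite mulr_ge0.
by rewrite -[leRHS]real_normK ?num_real// lerXn2r// nnegrE ltW.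
Qed.

Context {T : Type} {F : set_system T} {FF : Filter F}.
Context {lam : T -> probability R R} {sigma : probability R R}.

Definition int_cvg (f : R -> R) := bmeas setT f /\ forall e, 0 < e ->
  \forall t \near F, `|\int[lam t]_y f y - \int[sigma]_y f y| < e.

Lemma int_cvgD (f g : R -> R) : int_cvg f -> int_cvg g -> int_cvg (fun x => f x + g x).
Proof.
move=> [bf Hf] [bg Hg]; split; first exact: bmeasD.
move=> e e0; have e2 : 0 < e / 2 by rewrite divr_gt0.
apply: filterS2 (Hf _ e2) (Hg _ e2) => t ft gt.
rewrite !bRintegral_D//.
have -> : forall a b c d : R, a + b - (c + d) = (a - c) + (b - d) by move=> *; ring.
apply: le_lt_trans (ler_normD _ _) _; lra.
Qed.

Lemma int_cvgZ z f : int_cvg f -> int_cvg (fun x => z * f x).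
Proof.
move=> [bf Hf]; split; first exact: bmeasZ.
move=> e e0; have nz : 0 < `|z| + 1 by rewrite ltr_wpDl.
apply: filterS (Hf _ (divr_gt0 e0 nz)) => t.
rewrite !bRintegral_Z// -mulrBr normrM ltr_pdivlMr// mulrC; apply: le_lt_trans.
by rewrite ler_wpM2r ?lerDl.
Qed.

Lemma int_cvg_comp (V f : R -> R) (B : R) : (forall y, 0 <= V y <= 1) ->
  (forall n, int_cvg (fun y => V y ^+ n)) ->
  continuous f -> (forall x, `|f x| <= B) -> int_cvg (f \o V).
Proof.
move=> V01 HV cf fB; have B0 : 0 <= B by apply: le_trans (fB 0).
have mV : measurable_fun setT V by have [[]] := HV 1%N.
have bfV : bmeas setT (f \o V).
  split; first by apply: measurableT_comp => //; exact: continuous_measurable_fun.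
  by exists B => x _; exact: fB.
split => // e e0.
have bern n g j : int_cvg (fun y => V y ^+ j * bernstein n g (V y)).
  elim: n g j => [|n IH] g j /=; first by under eq_fun do rewrite mulrC; exact: int_cvgZ.
  have -> : (fun y => V y ^+ j * (V y * bernstein n (g \o succn) (V y) + (1 - V y) * bernstein n g (V y))) =
     fun y => V y ^+ j.+1 * bernstein n (g \o succn) (V y) +
       (V y ^+ j * bernstein n g (V y) + -1 * (V y ^+ j.+1 * bernstein n g (V y))).
    by apply/funext => y; rewrite !exprS; ring.
  by apply: int_cvgD => //; apply: int_cvgD => //; exact: int_cvgZ.
have e6 : 0 < e / 6 by rewrite divr_gt0.
have [K K0 HK] := continuous_modulus cf e6 fB.
pose n := Num.bound (K / (e / 6)).
have Kn : K / n.+1%:R <= e / 6.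
  rewrite ler_pdivrMr// mulrC -ler_pdivrMr//; apply: ltW.
  apply: (lt_le_trans (archi_boundP _)); first by rewrite divr_ge0// ltW.
  by rewrite ler_nat.
pose p y := bernstein n.+1 (fun k => f (k%:R / n.+1%:R)) (V y).
have [bp Hp] : int_cvg p by have := bern n.+1 (fun k => f (k%:R / n.+1%:R)) 0%N; under eq_fun do rewrite mul1r.
have fp y : `|f (V y) - p y| <= e / 3.
  apply: le_trans (bernstein_approx n (V01 y) K0 (HK (V y) ^~ (V01 y))) _; move: Kn; move: (K / _) => w; lra.
have E (mu : probability R R) : `|\int[mu]_y (f \o V) y - \int[mu]_y p y| <= e / 3.
  rewrite -bRintegral_B//; apply: bRintegral_norm => //; first by rewrite divr_ge0// ltW.
  by have [] := bmeasB bfV bp.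
  by move=> y _; exact: fp.
have e3 : 0 < e / 3 by rewrite divr_gt0.
apply: filterS (Hp _ e3) => t.
have -> : \int[lam t]_y (f \o V) y - \int[sigma]_y (f \o V) y =
  (\int[lam t]_y (f \o V) y - \int[lam t]_y p y) + (\int[lam t]_y p y - \int[sigma]_y p y)
  - (\int[sigma]_y (f \o V) y - \int[sigma]_y p y) by ring.
move=> H; apply: le_lt_trans (ler_normB _ _) _.
have := ler_normD (\int[lam t]_y (f \o V) y - \int[lam t]_y p y) (\int[lam t]_y p y - \int[sigma]_y p y).
have := E (lam t); have := E sigma; lra.
Qed.

End bernstein.

Section weak.
Context {R : realType}.

Lemma probability_tight (sigma : probability R R) (d : R) : 0 < d ->
  exists2 L, 0 < L & fine (sigma (~` `[- L, L]%classic)) < d.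
Proof.
move=> d0; pose A (n : nat) : set R := ~` `[- n%:R, n%:R]%classic.
have mA n : measurable (A n) by apply: measurableC.
have A0 : \bigcap_n A n = set0.
  apply/seteqP; split => // y /(_ (Num.bound `|y|) I); rewrite /A /= in_itv /= -ler_norml; apply.
  by rewrite ltW// archi_boundP.
have : sigma (A n) @[n --> \oo] --> sigma (\bigcap_n A n).
  apply: nonincreasing_cvg_mu => //.
  - by rewrite -ge0_fin_numE// fin_num_measure.
  - by rewrite A0.
  move=> m n mn; apply/subsetPset; apply: subsetC => y /=.
  rewrite !in_itv /= => /andP[y1 y2]; have mn' : m%:R <= n%:R :> R by rewrite ler_nat.
  by apply/andP; split; lra.
rewrite A0 measure0 => /fine_cvg /cvgrPdist_lt /(_ d d0) [n _ /(_ n.+1 (leqnSn n))] /=.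
rewrite sub0r normrN => /(le_lt_trans (ler_norm _)); exists n.+1%:R => //.
Qed.

Context {T : Type} {F : set_system T} {FF : Filter F}.
Context {lam : T -> probability R R} {sigma : probability R R} {c : R}.
Hypothesis lam_ge : \forall t \near F, lam t `[- c, +oo[%classic = 1%E.
Hypothesis moments : forall L : R, exists x b : R, [/\ L <= x, b <= - 2 & forall n (e : R), 0 < e ->
  \forall t \near F, `|\int[lam t]_y ((y + x) ^+ 2 + b ^+ 2)^-1 ^+ n -
    \int[sigma]_y ((y + x) ^+ 2 + b ^+ 2)^-1 ^+ n| < e].

(* On [y >= - x] the function [g] is [phi] of [V = ((y + x)^2 + b^2)^-1], up to
   the cutoff [chi], which makes [phi] continuous at [0] and is [1] on [-L, L]. *)
Lemma int_cvg_continuous (g : R -> R) (M : R) : continuous g ->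
  (forall y, `|g y| <= M) -> int_cvg (F := F) (lam := lam) (sigma := sigma) g.
Proof.
move=> cg gM.
have M0 : 0 <= M by apply: le_trans (gM 0).
have bg : bmeas setT g by split; [exact: continuous_measurable_fun|exists M => y _].
split=> // e e0.
(* The cutoff will cost [2 * M * d] under each of [sigma] and [lam t], together at most [e / 2]. *)
pose d := e / (8 * (M + 1)).
have M1 : 0 < 8 * (M + 1) by lra.
have d0 : 0 < d by rewrite divr_gt0.
have dM : 8 * (M + 1) * d = e by rewrite /d mulrC divfK ?gt_eqF.
have [L L0 Ld] := probability_tight sigma d0.
(* [L <= x] puts [[-L, L]] inside the half-line [y >= - x] where [V] determines [y]; [c <= x] does
   the same for the support of [lam t]. *)
have [x [b [Lx b2 Hm]]] := moments (Num.max L c).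
move: Lx; rewrite ge_max => /andP[Lx cx].
pose q y := (y + x) ^+ 2 + b ^+ 2.
pose V y := (q y)^-1.
have b4 : 4 <= b ^+ 2 by nra.
have q4 y : 4 <= q y by rewrite /q; have := sqr_ge0 (y + x); lra.
have q0 y : 0 < q y by have := q4 y; lra.
have V01 y : 0 <= V y <= 1.
  rewrite /V invr_ge0 (ltW (q0 y)) /= invf_le1//; have := q4 y; lra.
have bV : bmeas setT V.
  apply: (@bmeas_inv _ R R setT q 4) => //.
    by apply: measurable_funD => //; apply: measurable_funX; exact: measurable_funD.
  by move=> y _; rewrite ger0_norm// ltW.
have VX n : int_cvg (F := F) (lam := lam) (sigma := sigma) (fun y => V y ^+ n).
  by split; [exact: bmeasX|move=> e' e'0; exact: Hm].
(* The largest value of [q] on [[-L, L]], so that [K * V y >= 1] there and the cutoff equals 1. *)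
pose K := (L + x) ^+ 2 + b ^+ 2; have K0 : 0 < K by rewrite /K; have := sqr_ge0 (L + x); lra.
pose chi (v : R) := Num.min 1 (K * `|v|).
have chi01 v : 0 <= chi v <= 1 by rewrite le_min ler01 mulr_ge0 ?(ltW K0)//= ge_min lexx.
have chiK v : chi v <= K * `|v| by rewrite ge_min lexx orbT.
have cchi : continuous chi.
  move=> v; have c1 : {for v, continuous (fun w : R => K * `|w|)}.
    by apply: cvgM; [exact: cvg_cst|exact: norm_continuous].
  exact: (@continuous_min _ R (cst 1) (fun w : R => K * `|w|) v (cvg_cst _) c1).
have chiV y : `|y| <= L -> chi (V y) = 1.
  rewrite ler_norml => /andP[y1 y2]; apply/min_idPl.
  rewrite ger0_norm; last by case/andP: (V01 y).
  by rewrite /V ler_pdivlMr// mul1r /q /K; nra.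
pose phi (v : R) := g (- x + Num.sqrt (v^-1 - b ^+ 2)) * chi v.
have phiV y : - x <= y -> phi (V y) = g y * chi (V y).
  move=> yx; rewrite /phi /V invrK /q addrK sqrtr_sqr ger0_norm; last lra.
  by congr (g _ * _); ring.
have phiM v : `|phi v| <= M * (K * `|v|).
  rewrite normrM ler_pM//; case/andP: (chi01 v) => c1 _; rewrite ger0_norm//.
have phi_bound v : `|phi v| <= M.
  rewrite normrM -[leRHS]mulr1 ler_pM//; case/andP: (chi01 v) => c1 c2.
  by rewrite ger0_norm.
have cphi : continuous phi.
  move=> v; have [->|v0] := eqVneq v 0.
    apply/cvgrPdist_lt => r r0; have MK : 0 < M * K + 1 by rewrite ltr_wpDl// mulr_ge0// ltW.
    have -> : phi 0 = 0 by rewrite /phi /chi normr0 mulr0 min_r ?mulr0.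
    exists (r / (M * K + 1)); first by rewrite /= divr_gt0.
    move=> w /=; rewrite !sub0r !normrN ltr_pdivlMr// => wr.
    apply: le_lt_trans (phiM w) _; apply: le_lt_trans wr.
    by have := normr_ge0 w; nra.
  have c1 : (w^-1 - b ^+ 2) @[w --> v] --> v^-1 - b ^+ 2.
    by apply: cvgB; [exact: cvgV|exact: cvg_cst].
  have c2 := cvg_comp _ _ c1 (@sqrt_continuous R (v^-1 - b ^+ 2)).
  have c3 : (- x + Num.sqrt (w^-1 - b ^+ 2)) @[w --> v] --> - x + Num.sqrt (v^-1 - b ^+ 2).
    by apply: cvgD; [exact: cvg_cst|exact: c2].
  have c4 := cvg_comp _ _ c3 (cg _).
  have c5 : (g (- x + Num.sqrt (w^-1 - b ^+ 2)) * chi w) @[w --> v] -->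
      g (- x + Num.sqrt (v^-1 - b ^+ 2)) * chi v.
    by apply: cvgM; [exact: c4|exact: cchi].
  exact: c5.
have [bphi Hphi] := int_cvg_comp V01 VX cphi phi_bound.
have chi_bound v : `|chi v| <= 1.
  by case/andP: (chi01 v) => c1 c2; rewrite ger0_norm.
have [bchi Hchi] := int_cvg_comp V01 VX cchi chi_bound.
pose A : set R := ~` `[- L, L]%classic.
have mA : measurable A by apply: measurableC.
have bA : bmeas setT (\1_A : R -> R).
  split; first exact: measurable_indic.
  by exists 1 => y _; rewrite /indic; case: (_ \in _); rewrite ?normr1// normr0.
have intA : \int[sigma]_y (\1_A y) < d.
  by rewrite /Rintegral integral_indic// setIT.
have AE y : `|y| <= L \/ \1_A y = 1 :> R.
  have [yL|yL] := leP `|y| L; [by left|right].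
  rewrite indicE mem_set// /A /= in_itv /= -ler_norml; apply/negP.
  by rewrite -ltNge.
have A0 y : 0 <= \1_A y :> R by rewrite indicE.
have bchi' : bmeas setT (fun y => 1 - chi (V y)) by apply: bmeasB => //; exact: bmeas_cst.
have sigma_chi : \int[sigma]_y (1 - chi (V y)) <= d.
  apply: le_trans (ltW intA); apply: bRintegral_le => // y _.
  have [yL|->] := AE y; first by rewrite chiV// subrr.
  by case/andP: (chi01 (V y)) => ? ?; lra.
have sigma_phi : `|\int[sigma]_y g y - \int[sigma]_y phi (V y)| <= 2 * M * d.
  rewrite -bRintegral_B//.
  have H y : `|g y - phi (V y)| <= 2 * M * \1_A y.
    have [yL|->] := AE y.
      rewrite phiV ?chiV// ?mulr1 ?subrr ?normr0 ?mulr_ge0//.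
      by move: yL; rewrite ler_norml => /andP[y1 y2]; lra.
    apply: le_trans (ler_normB _ _) _; have := gM y; have := phi_bound (V y); lra.
  have bd : bmeas setT (fun y => g y - phi (V y)) by exact: bmeasB.
  have bA2 : bmeas setT (fun y => 2 * M * \1_A y : R) by exact: bmeasZ.
  have up := @bRintegral_le _ _ R sigma setT _ _ measurableT bd bA2 (fun y _ => le_trans (ler_norm _) (H y)).
  have lo := @bRintegral_le _ _ R sigma setT _ _ measurableT (bmeasN bA2) bd (fun y _ => lerNnormlW (H y)).
  have E : \int[sigma]_y (- (2 * M * \1_A y)) = - (2 * M * \int[sigma]_y \1_A y).
    transitivity (\int[sigma]_y (- (2 * M) * \1_A y)).
      by apply: eq_Rintegral => y _; rewrite mulNr.
    by rewrite bRintegral_Z// mulNr.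
  rewrite E bRintegral_Z// in lo up.
  have : 2 * M * \int[sigma]_y \1_A y <= 2 * M * d by rewrite ler_wpM2l ?mulr_ge0// ltW.
  by move=> h; rewrite ler_norml; apply/andP; split; lra.
have e4 : 0 < e / 4 by rewrite divr_gt0.
apply: filterS3 lam_ge (Hphi _ e4) (Hchi _ d0) => t lamD Ht Ct.
(* Tightness of [lam t] is inherited from [sigma]: the cutoff is a continuous function of [V], so
   its integrals converge. *)
have lam_chi : \int[lam t]_y (1 - chi (V y)) <= 2 * d.
  move: sigma_chi Ct; rewrite !bRintegral_B//; try exact: bmeas_cst.
  rewrite !bRintegral_cst ?probability_setT// ltr_norml /= => ? /andP[? ?]; lra.
pose D : set R := `[- c, +oo[%classic.
have mD : measurable D by exact: measurable_itv.
have sD (f : R -> R) : bmeas setT f -> bmeas D f by apply: bmeas_sub.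
have lam_phi : `|\int[lam t]_y g y - \int[lam t]_y phi (V y)| <= M * (2 * d).
  rewrite -bRintegral_B//.
  have bd : bmeas setT (fun y => g y - phi (V y)) by exact: bmeasB.
  rewrite -(Rintegral_full mD lamD); last by case: bd.
  have H y : D y -> `|g y - phi (V y)| <= M * (1 - chi (V y)).
    rewrite /D /= in_itv /= andbT => yD; rewrite phiV; last lra.
    have -> : g y - g y * chi (V y) = g y * (1 - chi (V y)) by ring.
    case/andP: (chi01 (V y)) => ? ?.
    by rewrite normrM (ger0_norm (_ : 0 <= 1 - _)) ?subr_ge0// ler_wpM2r// subr_ge0.
  have bA2 : bmeas D (fun y => M * (1 - chi (V y))) by apply: sD; exact: bmeasZ.
  have up := @bRintegral_le _ _ R (lam t) D _ _ mD (sD _ bd) bA2 (fun y Dy => le_trans (ler_norm _) (H y Dy)).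
  have lo := @bRintegral_le _ _ R (lam t) D _ _ mD (bmeasN bA2) (sD _ bd) (fun y Dy => lerNnormlW (H y Dy)).
  have E : \int[lam t]_(y in D) (- (M * (1 - chi (V y)))) = - (M * \int[lam t]_y (1 - chi (V y))).
    transitivity (\int[lam t]_(y in D) (- M * (1 - chi (V y)))).
      by apply: eq_Rintegral => y _; rewrite mulNr.
    rewrite bRintegral_Z//; last exact: sD.
    rewrite (Rintegral_full mD lamD); last by case: bchi'.
    by rewrite mulNr.
  have E2 : \int[lam t]_(y in D) (M * (1 - chi (V y))) = M * \int[lam t]_y (1 - chi (V y)).
    rewrite bRintegral_Z//; last exact: sD.
    by rewrite (Rintegral_full mD lamD)//; case: bchi'.
  rewrite E E2 in lo up.
  have : M * \int[lam t]_y (1 - chi (V y)) <= M * (2 * d) by rewrite ler_wpM2l.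
  by move=> h; rewrite ler_norml; apply/andP; split; lra.
have -> : \int[lam t]_y g y - \int[sigma]_y g y =
  (\int[lam t]_y g y - \int[lam t]_y phi (V y)) +
  (\int[lam t]_y phi (V y) - \int[sigma]_y phi (V y)) -
  (\int[sigma]_y g y - \int[sigma]_y phi (V y)) by ring.
apply: le_lt_trans (ler_normB _ _) _.
apply: (@le_lt_trans _ _ ((M * (2 * d) + e / 4) + 2 * M * d)); last first.
  have : M * (2 * d) + 2 * M * d <= e / 2.
    rewrite -dM; have : 0 <= M * d by rewrite mulr_ge0// ltW.
    lra.
  lra.
apply: lerD => //; apply: le_trans (ler_normD _ _) _; apply: lerD => //; exact: ltW.
Qed.

End weak.

Lemma Rintegral_distribution {d d'} {T : measurableType d} {T' : measurableType d'}
    {R : realType} (P : probability T R) (X : {mfun T >-> T'}) (f : T' -> R) :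
  bmeas setT f -> \int[distribution P X]_y f y = \int[P]_x f (X x).
Proof.
move=> [mf [M fM]]; congr fine; rewrite integral_distribution//.
  exact/measurable_EFinP.
apply: (@bmeas_integrable _ _ _ P setT (f \o X)) => //; split; first exact: measurableT_comp.
by exists M => x _; exact: fM.
Qed.

Lemma zmap_Re {R : realType} (alpha rho phi : R) : 1 < alpha <= 2 -> 0 < rho ->
  0 <= phi <= pi / 2 -> rho * cos phi <= complex.Re (zmap (alpha := alpha) (polar rho phi)).
Proof.
move=> /andP[a1 a2] r0 /andP[p0 p1]; have pi0 := pi_gt0 R.
rewrite /zmap cexp_polar// cexp_polar_scaled// complex_ReD !complex_ReM /= cosN !mul0r !subr0.
rewrite lerDl mulr_ge0 ?powR_ge0//; apply: cos_ge0_pihalf.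
have h1 : 0 <= (alpha - 1) * phi by rewrite mulr_ge0// subr_ge0 ltW.
have h2 : (alpha - 1) * phi <= pi / 2 by apply: le_trans p1; rewrite ler_piMl//; lra.
by apply/andP; split; lra.
Qed.

Lemma powR_cvg_at_right0 {R : realType} (p a : R) : 0 < p -> 0 < a ->
  (p * t) `^ a^-1 @[t --> 0^'+] --> 0^'+.
Proof.
move=> p0 a0 Q [d /= d0 H].
exists (d `^ a / p); first by rewrite /= divr_gt0// powR_gt0.
move=> t /=; rewrite sub0r normrN => td t0; rewrite gtr0_norm// in td.
have pt : 0 < p * t by rewrite mulr_gt0.
have e0 : 0 < (p * t) `^ a^-1 by rewrite powR_gt0.
apply: H => //=; rewrite sub0r normrN gtr0_norm//.
have -> : d = (d `^ a) `^ a^-1 by rewrite -powRrM divff ?gt_eqF// powRr1// ltW.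
rewrite gt0_ltr_powR ?invr_gt0// ?nnegrE ?powR_ge0// ?(ltW pt)//.
by move: td; rewrite ltr_pdivlMr// mulrC.
Qed.

(** * Weak convergence of the rescaled logarithm *)

Section scaled_ln_weak.
Context {R : realType} {k : nat} {alpha p : 'I_k.+1 -> R}.
Hypothesis halpha : forall i, 1 < alpha i <= 2.
Hypothesis halpha_decr : forall i j : 'I_k.+1, (i < j)%N -> alpha j < alpha i.
Hypothesis hp : forall i, 0 < p i.
Context {T : Type} {F : set_system T} {FF : Filter F}.
Context {mu_ : T -> probability R R} {e_ : T -> R} {sigma : probability R R}.
Hypothesis e_cvg : e_ t @[t --> F] --> 0^'+.
Hypothesis mu_pos : \forall t \near F, positive_law (mu_ t).
Hypothesis mu_S : \forall t \near F, exists2 t0, t0 <= 0 & forall s, s < t0 ->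
  S_transform (mu_ t) (- expR s) =
  expR (weight (index_enum 'I_k.+1) (coef alpha p (e_ t)) (expo alpha) s).
Hypothesis sigmaE : is_free_stable (alpha ord0) sigma.

Lemma scaled_ln_weak (g : R -> R) (M : R) : continuous g -> (forall y, `|g y| <= M) ->
  int_cvg (F := F) (lam := fun t => distribution (mu_ t) (scaled_ln (e_ t))) (sigma := sigma) g.
Proof.
have a12 := halpha ord0.
have [c c0 [lamD lim]] := real_limit halpha halpha_decr hp e_cvg mu_pos mu_S.
have [phi1 phi10 [rho1 Hs]] := free_resolvent a12 sigmaE.
have pi0 := pi_gt0 R; have /andP[p0 p1] := phi10.
have cphi : 0 < cos phi1 by apply: cos_gt0_pihalf; apply/andP; split; lra.
have phi1I : phi1 <= phi1 <= pi / 2 by rewrite lexx ltW.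
apply: (int_cvg_continuous lamD) => L.
(* The angle [phi1] is fixed first and has a positive cosine, so a large [rho] brings the real part
   of [zmap], at least [rho * cos phi1], above any [L]. *)
pose rho := Num.max (2 * c + 6) (Num.max rho1 (L / cos phi1)).
have r1 : 2 * c + 6 <= rho by rewrite le_max lexx.
have r2 : rho1 <= rho by rewrite !le_max lexx orbT.
have r3 : L <= rho * cos phi1 by rewrite -ler_pdivrMr// !le_max lexx !orbT.
have r0 : 0 < rho by lra.
have r6 : 6 <= rho by lra.
have sE phi := Hs rho phi r2.
have [s1 _ _] := sE phi1 phi1I.
exists (complex.Re (zmap (alpha := alpha ord0) (polar rho phi1))).
exists (complex.Im (zmap (alpha := alpha ord0) (polar rho phi1))); split.
- by apply: le_trans r3 _; apply: zmap_Re => //; rewrite p0 ltW.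
- exact: zmap_Im.
move=> n e e0.
have lim' : forall rho d, c + 2 <= rho -> 0 < d -> \forall t \near F,
  `|\int[distribution (mu_ t) (scaled_ln (e_ t))]_(y in `[- c, +oo[)
    (y + (rho + rho `^ (1 - alpha ord0)))^-1 - rho^-1| < d := lim.
exact: (sqr_resolvent_moment a12 c0 lim' lamD phi10 r1 sE n e0).
Qed.

End scaled_ln_weak.

Theorem theorem4p12 (R : realType) (k : nat) (alpha p : 'I_k.+1 -> R)
    (halpha : forall i, 1 < alpha i <= 2)
    (halpha_decr : forall i j : 'I_k.+1, (i < j)%N -> alpha j < alpha i)
    (hp : forall i, 0 < p i)
    (nu nup : 'I_k.+1 -> probability R R)
    (hnu : forall i, is_nu (alpha i) (nu i))
    (hnup : forall i, is_boxtimes_pow (nu i) (p i) (nup i))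
    (nu_alpha_p : probability R R)
    (hnu_alpha_p : is_boxtimes_seq [seq nup i | i : 'I_k.+1] nu_alpha_p)
    (nu_t : R -> probability R R)
    (hnu_t : forall t : R, 0 < t -> is_boxtimes_pow nu_alpha_p t (nu_t t))
    (d : measure_display) (T : measurableType d) (P : probability T R)
    (F : {RV P >-> R})
    (hF : is_free_stable (alpha ord0) (distribution P F)) :
  weakly_cvg 0^'+
    (fun t : R => distribution (nu_t t) (rpow (t `^ (- (alpha ord0)^-1))))
    (distribution P (scaled_exp (p ord0 `^ (alpha ord0)^-1) \o F : {RV P >-> R})).
Proof.
have /andP[a1 _] := halpha ord0.
have a0 : 0 < alpha ord0 by lra.
pose a := (alpha ord0)^-1; pose c := p ord0 `^ a.
pose e_ t := (p ord0 * t) `^ a.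
have e_cvg : e_ t @[t --> 0^'+] --> 0^'+ by exact: powR_cvg_at_right0.
have tpos : \forall t \near (0 : R)^'+, 0 < t by exact: nbhs_right_gt.
have mu_pos : \forall t \near (0 : R)^'+, positive_law (nu_t t).
  by apply: filterS tpos => t /hnu_t[].
have [eps eps0 SE] := S_boxtimes_seq hnu_alpha_p.
have mu_S : \forall t \near (0 : R)^'+, exists2 t0, t0 <= 0 & forall s, s < t0 ->
    S_transform (nu_t t) (- expR s) =
    expR (weight (index_enum 'I_k.+1) (coef alpha p (e_ t)) (expo alpha) s).
  apply: filterS tpos => t t0; have [_ _ _ _ St] := hnu_t t t0.
  (* The product formula for the S-transform is known only on []-eps, 0[], that is for [s < ln eps];
     the continuation starts from there. *)
  exists (Num.min 0 (ln eps)); first by rewrite ge_min lexx.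
  move=> s; rewrite lt_min => /andP[s0 se].
  have es0 := expR_gt0 s.
  have es1 : expR s < 1 by rewrite -expR0 ltr_expR.
  have ese : expR s < eps by rewrite -[ltRHS]lnK ?posrE// ltr_expR.
  have zI : -1 < - expR s < 0 by rewrite ltrN2 es1 oppr_lt0 es0.
  rewrite St// SE; last by rewrite ltrN2 ese oppr_lt0 es0.
  rewrite big_image /=.
  have Snup i : S_transform (nup i) (- expR s) = expR (p i * expR ((alpha i - 1) * s)).
    have [_ _ _ _ ->//] := hnup i; have [_ ->//] := hnu i.
    by rewrite opprK -!expRM mulrC (mulrC s).
  under eq_bigr do rewrite Snup.
  rewrite -expR_sum -expRM; congr expR; rewrite /weight mulr_suml; apply: eq_bigr => i _.
  rewrite /coef /expo /e_ -powRrM mulVf ?gt_eqF// powRr1; last by rewrite mulr_ge0// ltW.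
  by field; rewrite gt_eqF.
move=> f cf [M [_ fM]].
have {}fM x : `|f x| <= M + 1 by apply: fM => //; rewrite ltrDl.
pose g (y : R) := f (expR (c * y)).
have cg : continuous g.
  move=> y; apply: (@continuous_comp _ _ _ (fun y : R => expR (c * y)) f); last exact: cf.
  apply: (@continuous_comp _ _ _ (fun y : R => c * y) expR); last exact: continuous_expR.
  by apply: cvgM; [exact: cvg_cst|exact: cvg_id].
have bf : bmeas setT f.
  by split; [exact: continuous_measurable_fun|exists (M + 1) => x _; exact: fM].
have bg : bmeas setT g.
  by split; [exact: continuous_measurable_fun|exists (M + 1) => x _; exact: fM].
have [_ lim] := scaled_ln_weak halpha halpha_decr hp e_cvg mu_pos mu_S hF cg (fun y => fM _).
apply/cvgrPdist_lt => e e0.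
apply: filterS2 tpos (lim e e0) => t t0; rewrite distrC !Rintegral_distribution//.
have -> // : \int[nu_t t]_x f (rpow (t `^ (- a)) x) = \int[nu_t t]_x g (scaled_ln (e_ t) x).
have [_ _ pos _ _] := hnu_t t t0.
have mP : measurable (`]0, +oo[%classic : set R) by exact: measurable_itv.
rewrite -!(Rintegral_full mP pos).
- apply: eq_Rintegral => x; rewrite inE /= in_itv /= andbT => x0.
  rewrite /g /rpow /scaled_ln /powR (gt_eqF x0) -/(powR t (- a)); congr (f (expR _)).
  rewrite /c /e_ powRM ?(ltW t0) ?ltW// powRN.
  by field; rewrite !gt_eqF// powR_gt0.
- by case: bg => mg _; apply: measurableT_comp => //; exact: measurable_scaled_ln.
- by case: bf => mf _; apply: measurableT_comp => //; exact: measurable_powR.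
Qed.
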